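(* Let $m,n\ge1$, $1\le r\le m$ and $N=\binom{m+1}{r}$. For $0\le j\le N$ let $C^{(r)}_j$ be the polynomial in the Goncharov–Kenyon Hamiltonians $H_1,\dots,H_m$ obtained from the plethysm $e_j[e_r[p_2]]$ in the variables $\lambda_1,\dots,\lambda_{m+1}$ by expressing it as a polynomial in the elementary symmetric polynomials $e_1,\dots,e_{m+1}$ of $\lambda_1,\dots,\lambda_{m+1}$ and substituting $e_i=H_i$ for $1\le i\le m+1$ (with $H_{m+1}=1$). Then the recurrence for the $r$-th affine slice of the $T$-system of $A_m\otimes\hat A_{2n-1}$ has coefficients $C^{(r)}_j$: for every vertex $v$ of the $r$-th affine slice and every $t\in\mathbb{Z}$ with $t+\epsilon_v$ even, $$\sum_{j=0}^{N}(-1)^j\,C^{(r)}_j\,T_v\bigl(t+2n(N-j)\bigr)=0 .$$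
   Context: Plethysm: $e_j[e_r[p_2]](\lambda_1,\dots,\lambda_{m+1})$ is the $j$-th elementary symmetric polynomial evaluated at the $\binom{m+1}{r}$ quantities $\lambda_{i_1}^2\lambda_{i_2}^2\cdots\lambda_{i_r}^2$, $1\le i_1<\dots<i_r\le m+1$. Quiver and $T$-system. The vertices of $A_m\otimes\hat A_{2n-1}$ are $(i,j)$ with $1\le i\le m$, $j\in\mathbb{Z}/2n\mathbb{Z}$. The $i$-th affine slice is $\{(i,j):j\in\mathbb{Z}/2n\}$. Fix $c\in\{0,1\}$ and let $\epsilon_{(i,j)}\in\{0,1\}$, $\epsilon_{(i,j)}\equiv i+j+c\pmod 2$ (also for $i=0,m+1$). Let $\mathbf{x}=(x_v)$ be indeterminates indexed by the vertices. The $T$-system is the family $T_v(t)\in\mathbb{Q}(\mathbf{x})$, for vertices $v$ and $t\in\mathbb{Z}$ with $t+\epsilon_v$ even, determined by $T_v(\epsilon_v)=x_v$ and $$T_{(i,j)}(t+1)T_{(i,j)}(t-1)=T_{(i,j-1)}(t)T_{(i,j+1)}(t)+T_{(i-1,j)}(t)T_{(i+1,j)}(t),$$ with the convention $T_{(0,j)}(t)=T_{(m+1,j)}(t)=1$. Hamiltonians. The cylinder $\mathcal{C}_{m,2n}$ has nodes $(i,j)$, $0\le i\le m+1$, $j\in\mathbb{Z}/2n$, and unit square cells with corners $(i-1,j),(i-1,j+1),(i,j),(i,j+1)$, $1\le i\le m+1$. Nodes with $1\le i\le m$ are identified with quiver vertices. A domino consists of two cells sharing an edge, called its cut edge (for $n=1$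 dominoes with different cut edges are considered different). For a domino tiling $D$ of $\mathcal{C}_{m,2n}$ and a node $u$, let $d_D(u)$ be the number of cut edges of dominoes of $D$ incident to $u$. The sea $S$ is the tiling whose cut edges are exactly the edges joining $(i-1,j)$ and $(i,j)$, $1\le i\le m+1$, with $\epsilon_{(i,j)}=1$. For a tiling $D$, the superposition of $D$ and $S$ (dominoes being viewed as edges of the dual graph on cells) splits into closed cycles (a domino common to $D$ and $S$ being a trivial $2$-cycle); let $\mathfrak{h}(D)$ be the number of non-contractible cycles. The Goncharov–Kenyon Hamiltonians are $$H_r=\sum_{D:\ \mathfrak{h}(D)=r}\ \prod_{u=(i,j),\,1\le i\le m}x_u^{1-d_D(u)},\qquad 0\le r\le m+1,$$ and $H_0=H_{m+1}=1$. *)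

(* Defs.v *)
From mathcomp Require Import all_boot all_order fingroup perm all_algebra.
From mathcomp.multinomials Require Import mpoly.

Set Implicit Arguments.
Unset Strict Implicit.
Unset Printing Implicit Defensive.

Import GRing.Theory.
Local Open Scope ring_scope.

(* Z/2n is 'I_(2 * n), with successor ordS and predecessor ord_pred.
   All notions below are meant for 0 < m and 0 < n. *)

Definition node (m n : nat) : Type := ('I_m.+2 * 'I_(2 * n))%type.

Definition interior m n (u : node m n) : bool := (0 < u.1 < m.+1)%N.

Definition vertex (m n : nat) : Type := {u : node m n | interior u}.

Definition epsilon m n (c : bool) (u : node m n) : nat :=
  ((u.1 + u.2 + c) %% 2)%N.

Definition left_of m n (u : node m n) : node m n := (u.1, ord_pred u.2).
Definition right_of m n (u : node m n) : node m n := (u.1, ordS u.2).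

(* The next two are only used at interior nodes. *)
Definition below m n (u : node m n) : node m n := (inord u.1.-1, u.2).
Definition above m n (u : node m n) : node m n := (inord u.1.+1, u.2).

(* The field Q(x), the indeterminates being indexed by the vertices. *)
Definition ratfun (m n : nat) : Type :=
  {fraction {mpoly rat[#|{: vertex m n}|]}}.

Definition xvar m n (v : vertex m n) : ratfun m n :=
  tofrac 'X_(enum_rank v).

Definition boundary_ext m n (T : vertex m n -> int -> ratfun m n)
    (u : node m n) (t : int) : ratfun m n :=
  if insub u is Some v then T v t else 1.

(* Values T v t with t + epsilon v odd are unconstrained and irrelevant. *)
Definition T_system m n (c : bool) (T : vertex m n -> int -> ratfun m n) :=
  (forall v, T v (epsilon c (val v))%:Z = xvar v) /\
  (forall v t, (2 %| t + 1 + (epsilon c (val v))%:Z)%Z ->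
     let T' := boundary_ext T in
     T v (t + 1) * T v (t - 1) =
       T' (left_of (val v)) t * T' (right_of (val v)) t
       + T' (below (val v)) t * T' (above (val v)) t).

(* The cell (i, j) has corners (i, j), (i, j+1), (i+1, j), (i+1, j+1). *)
Definition cell (m n : nat) : Type := ('I_m.+1 * 'I_(2 * n))%type.

(* inl (i, j) is the edge joining the nodes (i, j) and (i+1, j);
   inr (i, j) is the edge joining the nodes (i, j) and (i, j+1).
   For n = 1, inr (i, 0) and inr (i, 1) are distinct edges with the same ends. *)
Definition edge (m n : nat) : Type := (('I_m.+1 * 'I_(2 * n)) + node m n)%type.

Definition ends m n (e : edge m n) : {set node m n} :=
  match e with
  | inl p => [set (widen_ord (leqnSn m.+1) p.1, p.2); (lift ord0 p.1, p.2)]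
  | inr u => [set u; right_of u]
  end.

Definition left_side m n (b : cell m n) : edge m n := inl b.
Definition right_side m n (b : cell m n) : edge m n := inl (b.1, ordS b.2).
Definition bottom_side m n (b : cell m n) : edge m n :=
  inr (widen_ord (leqnSn m.+1) b.1, b.2).
Definition top_side m n (b : cell m n) : edge m n := inr (lift ord0 b.1, b.2).

Definition sides m n (b : cell m n) : {set edge m n} :=
  [set left_side b; right_side b; bottom_side b; top_side b].

(* A domino is represented by its cut edge, a common side of two cells, and a
   tiling by the set of its cut edges. *)
Definition tiling m n (D : {set edge m n}) : bool :=
  [forall e in D, #|[set b | e \in sides b]| == 2%N]
  && [forall b, #|sides b :&: D| == 1%N].

Definition cut_degree m n (D : {set edge m n}) (u : node m n) : nat :=
  #|[set e in D | u \in ends e]|.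

Definition sea m n (c : bool) : {set edge m n} :=
  [set e : edge m n |
     if e is inl p then epsilon c (lift ord0 p.1, p.2) == 1%N else false].

Definition joined m n (D : {set edge m n}) : rel (cell m n) :=
  fun b b' => [exists e in D, [&& e \in sides b, e \in sides b' & b != b']].

Definition cycles m n (c : bool) (D : {set edge m n}) : {set {set cell m n}} :=
  let superposed b b' := joined D b b' || joined (sea m n c) b b' in
  [set [set b' | connect superposed b b'] | b : cell m n].

Definition mate m n (D : {set edge m n}) (b : cell m n) : cell m n :=
  odflt b [pick b' | joined D b b'].

(* Horizontal displacement, in the universal cover of the cylinder, of the step
   from b to mate D b: 1 across the right side, -1 across the left side, and 0
   across the bottom and top sides. *)
Definition shift m n (D : {set edge m n}) (b : cell m n) : int :=
  (right_side b \in D)%:Z - (left_side b \in D)%:Z.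

(* Total displacement along the cycle through b, which alternates sea dominoes
   and dominoes of D. It is 2n times the winding number: the cycle is
   contractible iff its lift to the universal cover closes up. *)
Definition displacement m n (c : bool) (D : {set edge m n}) (b : cell m n) :=
  let S := sea m n c in
  \sum_(b' <- orbit (mate D \o mate S) b) (shift S b' + shift D (mate S b')).

(* The displacements at two cells of a cycle agree up to sign. *)
Definition noncontractible m n (c : bool) (D : {set edge m n})
    (A : {set cell m n}) : bool :=
  [exists b in A, displacement c D b != 0].

Definition nb_noncontractible m n (c : bool) (D : {set edge m n}) : nat :=
  #|[set A in cycles c D | noncontractible c D A]|.

Definition GK_hamiltonian m n (c : bool) (r : nat) : ratfun m n :=
  \sum_(D : {set edge m n} | tiling D && (nb_noncontractible c D == r))
    \prod_(v : vertex m n) xvar v ^ (1 - (cut_degree D (val v))%:Z).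

Definition r_subsets (k r : nat) : {set {set 'I_k}} := [set A : {set 'I_k} | #|A| == r].

(* e_j[e_r[p_2]] in k variables *)
Definition plethysm (k r j : nat) : {mpoly int[k]} :=
  mesym #|r_subsets k r| int j
    \mPo [tuple \prod_(i in enum_val a) 'X_i ^+ 2 | a < #|r_subsets k r|].

Lemma plethysm_sym k r j : plethysm k r j \is symmetric.
Proof.
apply: msym_comp_poly => [|s]; first exact: mesym_sym.
pose F (B : {set 'I_k}) : {mpoly int[k]} := \prod_(i in B) 'X_i ^+ 2.
have sF B : msym s (F B) = F [set s i | i in B].
  rewrite /F rmorph_prod big_imset /=; last by move=> x y _ _; apply: perm_inj.
  by apply: eq_bigr => i _; rewrite rmorphXn /= /msym mmapX mmap1U.
set S := r_subsets k r.
have enumS : [seq enum_val a | a <- enum 'I_#|S|] = enum S.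
  apply: (@eq_from_nth _ set0) => [|i]; rewrite size_map size_enum_ord.
    by rewrite cardE.
  move=> lt_i; rewrite (nth_map (Ordinal lt_i)) ?size_enum_ord //.
  by rewrite (enum_val_nth set0) nth_enum_ord.
have -> : [tuple msym s [tuple F (enum_val a) | a < #|S|]`_i | i < #|S|]
    = [seq F B | B <- [seq [set s i | i in B] | B : {set 'I_k} <- enum S]]
    :> seq _.
  rewrite -enumS -!map_comp /= -enumT; apply: eq_map => a.
  rewrite /= -sF; congr msym.
  by rewrite (nth_map a) ?size_enum_ord // nth_ord_enum.
have -> : [tuple F (enum_val a) | a < #|S|] = [seq F B | B <- enum S] :> seq _.
  by rewrite -enumS -map_comp; apply: eq_map.
apply: perm_map; apply: uniq_perm; first exact: enum_uniq.
  by rewrite map_inj_uniq ?enum_uniq //; apply: imset_inj; apply: perm_inj.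
have sS (u : {perm 'I_k}) B : B \in S -> [set u i | i in B] \in S.
  by rewrite !inE card_imset //; apply: perm_inj.
move=> B; apply/idP/mapP => [|[A]].
  rewrite mem_enum => /(sS s^-1%g) SB.
  exists [set (s^-1)%g i | i in B]; first by rewrite mem_enum.
  rewrite -imset_comp -[LHS]imset_id; apply: eq_imset => i /=.
  by rewrite permKV.
by rewrite !mem_enum => AS ->; apply: sS.
Qed.

(* symf p is the polynomial expressing the symmetric polynomial p in the
   elementary symmetric ones; its variable 'X_i stands for e_(i+1). *)
Lemma symf_plethysm k r j :
  symf (plethysm k r j) \mPo [tuple mesym k int i.+1 | i < k] = plethysm k r j.
Proof. by rewrite -symfP ?plethysm_sym. Qed.

(* The variable e_(m+1), of index m, is replaced by H_(m+1) = 1. *)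
Definition slice_coef m n (c : bool) (r j : nat) : ratfun m n :=
  mmap intr
    (fun i : 'I_m.+1 => if (i == m :> nat) then 1 else GK_hamiltonian m n c i.+1)
    (symf (plethysm m.+1 r j)).

(* Main.v *)
Require Import Defs.
From mathcomp Require Import all_boot all_order all_fingroup all_algebra all_field.
From mathcomp.multinomials Require Import mpoly.
From mathcomp Require Import ring zify.
From Stdlib Require Import Classical.

Set Implicit Arguments.
Unset Strict Implicit.
Unset Printing Implicit Defensive.

Import Order.TTheory GRing.Theory Num.Theory.
Local Open Scope ring_scope.

(** Why the recurrence holds.

    In the light-cone coordinates t = P + Q + i + c, j = P - Q, the T-system is
    the condensation identity of Dodgson and Desnanot-Jacobi.  So, with M P Q the
    first slice of the T-system, the value of the i-th slice at (P, Q) is the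
    i x i minor of the infinite matrix M with first row P and first column Q
    ([window_minor]).  Divisions are legitimate because every T is a quotient of
    polynomials that are positive at the point (1, ..., 1) ([T_positive]).  The
    slice m + 1 is the constant 1, hence the minors of size m + 2 vanish
    ([window_minor_vanish]) and M factors through a space of dimension m + 1:
    M P Q = u P *m w Q ([factor]).  Going once around the cylinder identifies
    M (P + n) Q with M P (Q + n), and this makes w (Q + n) = A *m w Q for one
    matrix A, the monodromy, of determinant 1.  A time step 2n at a fixed vertex
    shifts both P and Q by n, so
      T_v (t + 2nk) = det (U *m A ^+ (2k) *m W)
    for fixed matrices U and W with r rows and r columns respectively
    ([minor_diag]).  Two independent facts finish the proof.

    Linear algebra.  Such a sequence is annihilated by the product of the
    X - lambda_S ^ 2 over the r-subsets S, where lambda_S is the product over S of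
    eigenvalues of A: triangularize A over an extension field and expand the
    determinant by multilinearity ([annihilates_det_powers]).  The coefficients of
    that product are the plethysms evaluated at the eigenvalues
    ([plethysm_recurrence]).

    Combinatorics.  The elementary symmetric functions of the eigenvalues of A are
    the Hamiltonians, that is,
      det (1 - X A) = sum over the tilings D of (- X) ^ h(D) * weight(D)
    ([det_monodromy_tilings]).  Both sides equal the determinant of 1 minus a
    weighted adjacency matrix on the cells of the cylinder, in which X marks the
    steps that cross one fixed column.
    - On the tiling side, the superposition of D with the sea, read from left to
      right, is a family of paths that move one column at a time, that is, a
      permutation [flow] of the cells whose fixed points are the cells off the
      paths.  This is a bijection from tilings to the permutations that occur in
      the determinant ([flow_admissible], [cuts_flow], [slide_cuts]).  Paths
      cannot cross, so each of them closes up after exactly one turn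
      ([expg_period]); this gives the sign and identifies the number of paths with
      the number of non-contractible cycles ([odd_perm_moved],
      [nb_noncontractible_moved]).
    - On the monodromy side, certain bordered minors of M, the [wave] functions,
      are preserved by the transfer from one column to the next.  This is the
      cubic identity [four_term] between minors.  Going around the cylinder
      multiplies them by the inverse transpose of A, and the determinant collapses
      to det (1 - X A) ([det_cyclic_transfer]). *)

(** * Triangularization over an extension field *)

Lemma irreducible_factor (F : fieldType) (p : {poly F}) :
  (1 < size p)%N -> exists2 q, irreducible_poly q & q %| p.
Proof.
have [k] := ubnP (size p); elim: k p => // k IH p ltpk p_gt1.
have [irr_p | red_p] := classic (irreducible_poly p); first by exists p.
have [q sz_q] : exists2 q : {poly F}, size q != 1 & (q %| p) && ~~ (q %= p).
  apply: NNPP => H; apply: red_p; split=> // q sz_q dv_q.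
  by apply/idP; apply/negP => /negP nq; apply: H; exists q; rewrite ?dv_q.
case/andP => dv_q; rewrite -dvdp_size_eqp // => neq_q.
have p0 : p != 0 by rewrite -size_poly_gt0 (ltn_trans _ p_gt1).
have q0 : q != 0 by apply: contraNneq p0 => q0; move: dv_q; rewrite q0 dvd0p.
have lt_q : (size q < size p)%N by rewrite ltn_neqAle neq_q dvdp_leq.
have [||s irr_s dv_s] := IH q.
- exact: leq_trans lt_q _.
- by rewrite ltn_neqAle eq_sym sz_q size_poly_gt0.
by exists s => //; apply: dvdp_trans dv_s dv_q.
Qed.

(** Adjoining one root of an irreducible factor; the existence of such a
    factor is where excluded middle is used. *)
Lemma root_extension (F : fieldType) (p : {poly F}) : (1 < size p)%N ->
  exists (L : fieldType) (iota : {rmorphism F -> L}) (x : L),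
    root (map_poly iota p) x.
Proof.
case/irreducible_factor => q /irredp_FAdjoin[L _ [z qz _]] /dvdpP[s ->].
by exists L, (in_alg L), z; rewrite rmorphM rootM qz orbT.
Qed.

(** A root of the characteristic polynomial in a first extension gives an
    eigenvector; it becomes the first row of a base change, and the induction
    hypothesis, applied over that extension, may extend the field again. *)
Lemma trigonalization (n : nat) (F : fieldType) (A : 'M[F]_n) :
  exists (L : fieldType) (iota : {rmorphism F -> L}) (P T : 'M[L]_n),
    [/\ P \in unitmx, is_trig_mx T & P *m map_mx iota A = T *m P].
Proof.
elim: n F A => [|n IH] F A.
  exists F, (idfun : {rmorphism F -> F}), 1%:M, 1%:M.
  by rewrite unitmx1; split=> //; apply/matrixP => -[].
have [|L1 [i1 [x]]] := @root_extension F (char_poly A).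
  by rewrite size_char_poly.
rewrite map_char_poly -eigenvalue_root_char.
set B := map_mx i1 A => /eigenvalueP[v vB v0].
pose E := row_ebase v.
have uE : E \in unitmx by apply: row_ebase_unit.
(* The first row of E is a multiple of the eigenvector v. *)
pose e := pid_mx 1 : 'rV[L1]_(1 + n).
have eE : (e *m E) *m B = x *: (e *m E).
  have r1 : \rank v = 1%N.
    by apply/eqP; rewrite eqn_leq rank_leq_row lt0n mxrank_eq0.
  have uC : col_ebase v \in unitmx by apply: col_ebase_unit.
  have dv : v = col_ebase v *m (e *m E).
    by have := mulmx_ebase v; rewrite r1 mulmxA => ->.
  apply: (can_inj (mulKmx uC)).
  by rewrite mulmxA -dv vB [in LHS]dv scalemxAr.
pose C : 'M[L1]_(1 + n) := E *m B *m invmx E.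
have eC : e *m C = x *: e.
  by rewrite /C !mulmxA eE -scalemxAl mulmxK.
have defC : C = block_mx x%:M 0 (dlsubmx C) (drsubmx C).
  have u0 : usubmx C = x *: e.
    rewrite -eC -{2}[C]vsubmxK /e.
    have -> : pid_mx 1 = row_mx 1%:M 0 :> 'rV[L1]_(1 + n).
      by rewrite -pid_mx_row -?pid_mx_1.
    by rewrite mul_row_col mul1mx mul0mx addr0.
  rewrite -[LHS]submxK; congr block_mx.
    rewrite /ulsubmx u0; apply/matrixP => i j.
    by rewrite !mxE !ord1 /= mulr1.
  rewrite /ursubmx u0; apply/matrixP => i j; rewrite !mxE !ord1 /=.
  by rewrite mulr0.
have [L [i2 [P [T [uP trT PT]]]]] := IH L1 (drsubmx C).
exists L, (i2 \o i1 : {rmorphism F -> L}).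
pose P1 : 'M[L]_(1 + n) := block_mx 1%:M 0 0 P.
pose E2 := map_mx i2 E.
have uE2 : E2 \in unitmx by rewrite map_unitmx.
exists (P1 *m E2), (block_mx (i2 x)%:M 0 (P *m map_mx i2 (dlsubmx C)) T).
split.
- have dP1 : \det P1 = \det P by rewrite /P1 (@det_ublock _ 1 n) det1 mul1r.
  by rewrite unitmx_mul uE2 andbT unitmxE dP1 -unitmxE.
- by rewrite (@is_trig_block_mx _ 1 n 1 n) // eqxx scalar_mx_is_trig.
have -> : map_mx (i2 \o i1) A = map_mx i2 B by rewrite map_mx_comp.
have EB : E2 *m map_mx i2 B = map_mx i2 C *m E2.
  by rewrite -!map_mxM /C mulmxKV.
rewrite -mulmxA EB !mulmxA; congr (_ *m _).
rewrite [in LHS]defC map_block_mx !(@mulmx_block _ 1 n 1 n 1 n).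
rewrite !mul1mx !mul0mx !mulmx0 !mulmx1 !map_scalar_mx map_mx0 /= PT.
by rewrite !addr0 !add0r.
Qed.

Section ShiftAction.
Variable L : comNzRingType.
Implicit Types (p q : {poly L}) (g : nat -> L) (k : nat).

(** The action of a polynomial in the shift operator g(k) |-> g(k + 1). *)
Definition shift_act p g k : L := \sum_(i < size p) p`_i * g (i + k)%N.

Lemma shift_act_widen d p g k : (size p <= d)%N ->
  shift_act p g k = \sum_(i < d) p`_i * g (i + k)%N.
Proof.
move=> le_pd; rewrite /shift_act (big_ord_widen d (fun i => p`_i * g (i + k)%N)) //.
rewrite big_mkcond; apply: eq_bigr => i _; case: ltnP => // le_pi.
by rewrite nth_default ?mul0r.
Qed.

Lemma shift_actD p q g k :
  shift_act (p + q) g k = shift_act p g k + shift_act q g k.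
Proof.
pose d := maxn (size p) (size q).
rewrite !(@shift_act_widen d) ?leq_maxl ?leq_maxr ?size_polyD //.
by rewrite -big_split; apply: eq_bigr => i _; rewrite coefD mulrDl.
Qed.

Lemma shift_actC a g k : shift_act a%:P g k = a * g k.
Proof.
by rewrite (@shift_act_widen 1) ?size_polyC_leq1 // big_ord1 coefC.
Qed.

Lemma shift_actMX p g k : shift_act (p * 'X) g k = shift_act p g k.+1.
Proof.
rewrite (@shift_act_widen (size p).+1); last first.
  by rewrite (leq_trans (size_polyMleq _ _)) // size_polyX addn2.
rewrite big_ord_recl coefMX mul0r add0r; apply: eq_bigr => i _.
by rewrite coefMX /= /bump add1n /= addSnnS.
Qed.

Lemma shift_act_eq p g h k : g =1 h -> shift_act p g k = shift_act p h k.
Proof. by move=> gh; apply: eq_bigr => i _; rewrite gh. Qed.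

Lemma shift_act0 p k : shift_act p (fun=> 0) k = 0.
Proof. by rewrite /shift_act big1 // => i _; rewrite mulr0. Qed.

Lemma shift_act_sum (I : finType) (P : pred I) p (a : I -> L) (g : I -> nat -> L) k :
  shift_act p (fun l => \sum_(i | P i) a i * g i l) k
    = \sum_(i | P i) a i * shift_act p (g i) k.
Proof.
rewrite /shift_act; under eq_bigr do rewrite mulr_sumr.
rewrite exchange_big; apply: eq_bigr => i _; rewrite mulr_sumr.
by apply: eq_bigr => j _; rewrite mulrCA.
Qed.

Lemma shift_actM p q g k : shift_act (p * q) g k = shift_act p (shift_act q g) k.
Proof.
elim/poly_ind: p k => [|p a IH] k.
  by rewrite mul0r -polyC0 !shift_actC !mul0r.
rewrite mulrDl mulrAC !shift_actD !shift_actMX.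
rewrite IH shift_actC mul_polyC; congr (_ + _).
rewrite (@shift_act_widen (size q)) ?size_scale_leq // mulr_sumr.
by apply: eq_bigr => i _; rewrite coefZ mulrA.
Qed.

Definition annihilates p g := forall k, shift_act p g k = 0.

Lemma annihilatesM p q g : annihilates q g -> annihilates (p * q) g.
Proof.
move=> qg k; rewrite shift_actM (@shift_act_eq _ _ (fun=> 0)) //.
exact: shift_act0.
Qed.

Lemma annihilates_sum (I : finType) (P : pred I) p (a : I -> L) (g : I -> nat -> L) :
  (forall i, P i -> annihilates p (g i)) ->
  annihilates p (fun l => \sum_(i | P i) a i * g i l).
Proof.
move=> pg k; rewrite shift_act_sum big1 // => i Pi.
by rewrite (pg i Pi) mulr0.
Qed.

Lemma shift_act_XsubC a g k : shift_act ('X - a%:P) g k = g k.+1 - a * g k.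
Proof.
by rewrite -polyCN shift_actD -['X]mul1r shift_actMX -polyC1 !shift_actC mul1r mulNr.
Qed.

End ShiftAction.

Section DeterminantOfPowers.
Variables (L : fieldType) (m r : nat) (B : 'M[L]_m.+1).
Hypothesis trB : is_trig_mx B.
Variable W : 'M[L]_(m.+1, r).

Let D (f : {ffun 'I_r -> 'I_m.+1}) (k : nat) : L :=
  \det (\matrix_(a, b) (B ^+ k *m W) (f a) b).

Let ev (S : {set 'I_m.+1}) : L := \prod_(i in S) B i i.
Let wt (S : {set 'I_m.+1}) : nat := (\sum_(i in S) i)%N.

Let Dstep f k :
  D f k.+1 = \sum_(h : {ffun 'I_r -> 'I_m.+1}) (\prod_(a < r) B (f a) (h a)) * D h k.
Proof.
rewrite /D exprS -mulmxE -mulmxA; set Y := B ^+ k *m W.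
rewrite /determinant; under eq_bigr => s _.
  under eq_bigr => a _ do rewrite !mxE.
  rewrite bigA_distr_bigA /= mulr_sumr.
  over.
rewrite exchange_big; apply: eq_bigr => h _ /=.
rewrite mulr_sumr; apply: eq_bigr => s _.
rewrite big_split /= mulrCA; congr (_ * (_ * _)).
by apply: eq_bigr => a _; rewrite mxE.
Qed.

Let Dninj (f : {ffun 'I_r -> 'I_m.+1}) k : ~~ injectiveb f -> D f k = 0.
Proof.
case/injectivePn => a [b nab eqf]; apply: (determinant_alternate nab) => c.
by rewrite !mxE eqf.
Qed.

Let Q (X : {set {set 'I_m.+1}}) := \prod_(S in X) ('X - (ev S)%:P).
Let X d := [set S in r_subsets m.+1 r | (wt S < d)%N].

Let Qsub (Y Z : {set {set 'I_m.+1}}) g : Y \subset Z -> annihilates (Q Y) g -> annihilates (Q Z) g.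
Proof.
move=> sYZ Yg; rewrite /Q (big_setID Y) /= (setIidPr sYZ) mulrC.
exact: annihilatesM.
Qed.

Let Qstep d (f : {ffun 'I_r -> 'I_m.+1}) : (\sum_(a < r) (f a : 'I_m.+1) < d)%N -> annihilates (Q (X d)) (D f).
Proof.
elim: d f => // d IH f; rewrite ltnS leq_eqVlt => /predU1P[eq_fd | /IH]; last first.
  apply: Qsub; apply/subsetP => S; rewrite !inE => /andP[->] /=.
  by rewrite ltnS => /ltnW.
have [inj_f | ninj] := boolP (injectiveb f); last first.
  move=> k; rewrite (@shift_act_eq _ _ _ (fun=> 0)) ?shift_act0 // => l.
  exact: Dninj.
move/injectiveP in inj_f; pose S := [set f a | a in 'I_r].
have wtS : wt S = d.
  by rewrite -eq_fd /wt big_imset //= => a b _ _; apply: inj_f.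
have evS : ev S = \prod_(a < r) B (f a) (f a).
  by rewrite /ev big_imset //= => a b _ _; apply: inj_f.
have Sin : S \in r_subsets m.+1 r by rewrite inE card_imset // card_ord.
have low (h : {ffun 'I_r -> 'I_m.+1}) : h != f -> \prod_(a < r) B (f a) (h a) != 0 ->
    (\sum_(a < r) (h a : 'I_m.+1) < d)%N.
  move=> nhf /prodf_neq0 nz.
  have le a : (h a <= f a)%N.
    rewrite leqNgt; apply: contra (nz a isT) => lt_fh.
    by rewrite (is_trig_mxP trB).
  have [a na] : exists a, h a != f a.
    apply/existsP; rewrite -negb_forall; apply: contra nhf => /forallP H.
    by apply/eqP/ffunP => a; apply/eqP.
  rewrite -eq_fd (bigD1 a) //= [X in (_ < X)%N](bigD1 a) //= -addSn leq_add //.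
    by rewrite ltn_neqAle na le.
  by apply: leq_sum.
have step : shift_act ('X - (ev S)%:P) (D f)
    =1 fun k => \sum_(h : {ffun 'I_r -> 'I_m.+1} | (\sum_(a < r) (h a : 'I_m.+1) < d)%N)
        (\prod_(a < r) B (f a) (h a)) * D h k.
  move=> k; rewrite shift_act_XsubC Dstep (bigD1 f) //= evS addrC addrK.
  rewrite big_mkcond [RHS]big_mkcond /=; apply: eq_bigr => h _.
  have [->|nhf] := eqVneq h f; first by rewrite eq_fd ltnn.
  have [->|/(low h nhf) -> //] := eqVneq (\prod_(a < r) B (f a) (h a)) 0.
  by rewrite mul0r if_same.
apply: (@Qsub (S |: X d)).
  apply/subsetP => S'; rewrite !inE => /predU1P[->|/andP[-> lt]] /=.
    by move: Sin; rewrite inE wtS ltnSn andbT.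
  exact: ltnW.
rewrite /Q big_setU1 /= ?inE ?wtS ?ltnn ?andbF // mulrC => k.
rewrite shift_actM (shift_act_eq _ _ step); apply: annihilates_sum => h lt_h.
exact: IH.
Qed.

(** Expanding the determinant in its rows over the basis in which B is triangular
    reduces to the minors D f of B ^ k *m W with row indices f.  One shift maps D f
    to the sum of the D h with h <= f pointwise, and D f itself occurs with the
    factor of the subset im f; D f = 0 when f is not injective.  So, by induction on
    the sum of the entries of f, the subsets of sum at most that of f suffice to
    annihilate D f, each of them being used once. *)
Theorem annihilates_det_powers (U : 'M[L]_(r, m.+1)) :
  annihilates (\prod_(S in r_subsets m.+1 r) ('X - (\prod_(i in S) B i i)%:P))
    (fun k => \det (U *m B ^+ k *m W)).
Proof.
have expand k : \det (U *m B ^+ k *m W)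
    = \sum_(h : {ffun 'I_r -> 'I_m.+1}) (\prod_(a < r) U a (h a)) * D h k.
  rewrite -mulmxA; set Y := B ^+ k *m W; rewrite /determinant.
  under eq_bigr => s _.
    under eq_bigr => a _ do rewrite mxE.
    rewrite bigA_distr_bigA /= mulr_sumr; over.
  rewrite exchange_big; apply: eq_bigr => h _ /=.
  rewrite mulr_sumr; apply: eq_bigr => s _.
  rewrite big_split /= mulrCA; congr (_ * (_ * _)).
  by apply: eq_bigr => a _; rewrite mxE.
move=> k; rewrite (shift_act_eq _ _ expand); apply: annihilates_sum => h _.
apply: (@Qsub (X (\sum_(a < r) (h a : 'I_m.+1)).+1)); last exact: Qstep.
by apply/subsetP => S; rewrite inE => /andP[].
Qed.

End DeterminantOfPowers.

(** * The plethysm as coefficients of the recurrence *)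

Lemma mmap_intr_comp (k l : nat) (R : comNzRingType) (h : 'I_l -> R)
    (p : {mpoly int[k]}) (lq : k.-tuple {mpoly int[l]}) :
  mmap intr h (p \mPo lq) = mmap intr (fun i => mmap intr h (tnth lq i)) p.
Proof.
rewrite comp_mpolyEX raddf_sum [in RHS]/mmap; apply: eq_bigr => m _ /=.
rewrite mmapZ comp_mpolyX rmorph_prod; congr (_ * _).
by apply: eq_bigr => i _; rewrite rmorphXn.
Qed.

Lemma mmap_intr_mesym (k j : nat) (R : comNzRingType) (h : 'I_k -> R) :
  mmap intr h (mesym k int j) = \sum_(A : {set 'I_k} | #|A| == j) \prod_(i in A) h i.
Proof.
rewrite raddf_sum; apply: eq_bigr => A _ /=.
by rewrite rmorph_prod; apply: eq_bigr => i _ /=; rewrite mmapX mmap1U.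
Qed.

(** The reciprocal form of the relation between roots and coefficients. *)
Lemma coef_prod_1subX (k j : nat) (R : comNzRingType) (h : 'I_k -> R) :
  (\prod_(i < k) (1 - h i *: 'X))`_j = (-1) ^+ j * mmap intr h (mesym k int j).
Proof.
have -> : \prod_(i < k) (1 - h i *: 'X)
    = \prod_(i < k) ((- h i) *: 'X + 1) :> {poly R}.
  by apply: eq_bigr => i _; rewrite scaleNr addrC.
rewrite bigA_distr coef_sum mmap_intr_mesym mulr_sumr [RHS]big_mkcond.
apply: eq_bigr => A _ /=.
rewrite -big_mkcond /= scaler_prod coefZ prodr_const coefXn eq_sym.
case: eqP => [<-|_]; last by rewrite mulr0.
by rewrite mulr1 prodrN.
Qed.

Lemma prod_XsubC_coef (R : idomainType) (k : nat) (mu : 'I_k -> R) (j : 'I_k.+1) :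
  (\prod_(i < k) ('X - (mu i)%:P))`_(k - j) = (-1) ^+ j * mmap intr mu (mesym k int j).
Proof.
have := mroots_coeff [tuple mu i | i < k] j.
rewrite big_tuple; under eq_bigr do rewrite tnth_mktuple.
move=> ->; rewrite mmap_intr_mesym; congr (_ * _).
rewrite raddf_sum; apply: eq_bigr => A _ /=.
rewrite rmorph_prod; apply: eq_bigr => i _ /=.
by rewrite mevalXU tnth_mktuple.
Qed.

Lemma mmap_plethysm (k r j : nat) (R : comNzRingType) (h : 'I_k -> R) :
  mmap intr h (plethysm k r j)
    = mmap intr (fun a : 'I_#|r_subsets k r| => \prod_(i in enum_val a) h i ^+ 2)
        (mesym #|r_subsets k r| int j).
Proof.
rewrite mmap_intr_comp !mmap_intr_mesym; apply: eq_bigr => A _.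
apply: eq_bigr => a _; rewrite tnth_mktuple rmorph_prod.
by apply: eq_bigr => i _ /=; rewrite rmorphXn /= mmapX mmap1U.
Qed.

(** By [he], e i is the elementary symmetric function of degree i + 1 of the
    eigenvalues of A, which lie in an extension L of K; the identity, with coefficients in K, is
    proved in L and pulled back along the injection iota. *)
Lemma plethysm_recurrence (K : fieldType) (m r : nat) (A : 'M[K]_m.+1)
    (e : 'I_m.+1 -> K)
    (he : forall i : 'I_m.+1,
       (\det (1%:M - 'X *: map_mx polyC A))`_i.+1 = (-1) ^+ i.+1 * e i)
    (U : 'M[K]_(r, m.+1)) (W : 'M[K]_(m.+1, r)) :
  let N := 'C(m.+1, r) in
  \sum_(j < N.+1) (-1) ^+ j * mmap intr e (symf (plethysm m.+1 r j))
    * \det (U *m A ^+ (2 * (N - j)) *m W) = 0.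
Proof.
move=> N.
have [L [iota [P [T [uP trT PA]]]]] := trigonalization A.
pose lam i := T i i.
have PAK : map_mx iota A = invmx P *m T *m P.
  by rewrite -mulmxA -PA mulKmx.
have e_lam i : iota (e i) = mmap intr lam (mesym m.+1 int i.+1).
  have := congr1 iota (he i).
  rewrite -coef_map -det_map_mx rmorphM rmorphXn /= rmorphN1.
  have -> : map_mx (map_poly iota) (1%:M - 'X *: map_mx polyC A)
      = map_mx polyC (invmx P) *m (1%:M - 'X *: map_mx polyC T) *m map_mx polyC P.
    rewrite map_mxB map_mxZ map_mx1 /= map_polyX.
    rewrite mulmxBr mulmxBl mulmx1 -map_mxM mulVmx // map_mx1.
    rewrite -!scalemxAr -!scalemxAl -!map_mxM -PAK /=; congr (_ - _ *: _).
    by apply/matrixP => a b; rewrite !mxE map_polyC.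
  rewrite !det_mulmx mulrAC -det_mulmx -map_mxM mulVmx // map_mx1 det1 mul1r.
  have -> : \det (1%:M - 'X *: map_mx polyC T) = \prod_(a < m.+1) (1 - lam a *: 'X).
    rewrite det_trig; last first.
      apply/is_trig_mxP => a b ltab; rewrite !mxE (is_trig_mxP trT) // mulr0 subr0.
      by case: eqP ltab => // ->; rewrite ltnn.
    by apply: eq_bigr => a _; rewrite !mxE eqxx mulrC mul_polyC.
  by rewrite coef_prod_1subX => /(can_inj (signrMK _)) ->.
have cardN : #|r_subsets m.+1 r| = N by rewrite card_draws card_ord.
have coefE j : iota (mmap intr e (symf (plethysm m.+1 r j)))
    = mmap intr lam (plethysm m.+1 r j).
  rewrite -[in RHS]symf_plethysm mmap_intr_comp /mmap rmorph_sum.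
  apply: eq_bigr => mm _; rewrite rmorphM rmorph_int; congr (_ * _).
  rewrite rmorph_prod; apply: eq_bigr => i _.
  by rewrite rmorphXn e_lam tnth_mktuple.
have trT2 : is_trig_mx (T ^+ 2).
  apply/is_trig_mxP => a b ltab; rewrite expr2 mxE big1 // => d _.
  case: (ltnP a d) => [ltad|leda]; first by rewrite (is_trig_mxP trT) ?mul0r.
  by rewrite [T d b](is_trig_mxP trT) ?mulr0 // (leq_ltn_trans leda).
have T2 i : (T ^+ 2) i i = lam i ^+ 2.
  rewrite [T ^+ 2]expr2 mxE (bigD1 i) //= big1 ?addr0 // => d ndi.
  case: (ltngtP i d) => [ltid|ltdi|/val_inj eqid].
  - by rewrite (is_trig_mxP trT) ?mul0r.
  - by rewrite [T d i](is_trig_mxP trT) ?mulr0.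
  - by rewrite eqid eqxx in ndi.
pose U' := map_mx iota U *m invmx P; pose W' := P *m map_mx iota W.
have detE k : iota (\det (U *m A ^+ (2 * k) *m W)) = \det (U' *m (T ^+ 2) ^+ k *m W').
  rewrite -det_map_mx !map_mxM -exprM; congr (\det _).
  rewrite /U' /W' -!mulmxA; congr (_ *m _); rewrite !mulmxA; congr (_ *m _).
  rewrite rmorphXn /=; elim: (2 * k)%N => [|l IH].
    by rewrite !expr0 mulmx1 mulVmx.
  rewrite exprSr IH PAK -mulmxE !mulmxA.
  by rewrite mulmxK // -[_ *m T ^+ l *m T]mulmxA mulmxE -exprSr.
have := annihilates_det_powers trT2 W' U' 0.
under eq_bigr => S _ do under eq_bigr => i _ do rewrite T2.
set p := \prod_(S in _) _; move=> act0.
have pE : p = \prod_(a < #|r_subsets m.+1 r|)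
    ('X - (\prod_(i in enum_val a) lam i ^+ 2)%:P).
  by rewrite /p big_enum_val.
have sz_p : (size p <= N.+1)%N.
  by rewrite pE -big_enum /= size_prod_XsubC -cardE card_ord cardN.
apply: (fmorph_inj iota); rewrite rmorph0 -{}[RHS]act0.
rewrite (shift_act_widen _ _ sz_p) rmorph_sum.
rewrite [RHS](reindex_inj rev_ord_inj) /=; apply: eq_bigr => j _.
rewrite !rmorphM rmorphXn /= rmorphN1 coefE detE subSS addn0; congr (_ * _).
rewrite mmap_plethysm pE.
by case: _ / cardN in j *; rewrite prod_XsubC_coef.
Qed.

(** * Minors relative to a common pivot block *)

Section Minors.
Variable K : fieldType.
Implicit Type F : nat -> nat -> K.

Definition minor F (p : nat) (r c : nat -> nat) : K :=
  \det (\matrix_(i < p, j < p) F (r i) (c j)).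

Lemma eq_minor F F' p r r' c c' :
  (forall i j, (i < p)%N -> (j < p)%N -> F (r i) (c j) = F' (r' i) (c' j)) ->
  minor F p r c = minor F' p r' c'.
Proof. by move=> eqF; congr (\det _); apply/matrixP => i j; rewrite !mxE eqF. Qed.

Lemma minor_tr F p r c : minor F p r c = minor (fun i j => F j i) p c r.
Proof. by rewrite /minor -det_tr; congr (\det _); apply/matrixP => i j; rewrite !mxE. Qed.

(** The sequence r with x inserted at position k. *)
Definition insert_at (k x : nat) (r : nat -> nat) (i : nat) : nat :=
  if (i < k)%N then r i else if i == k then x else r i.-1.

(** Moving the first row behind the next k rows is a cycle of length k + 1. *)
Lemma minor_rot F p k x r c : (k <= p)%N ->
  minor F p.+1 (insert_at 0 x r) c = (-1) ^+ k * minor F p.+1 (insert_at k x r) c.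
Proof.
rewrite -ltnS => lt_kp; pose ok := Ordinal lt_kp.
have -> : minor F p.+1 (insert_at 0 x r) c
  = \det (row_perm (lift_perm ord0 ok 1) (\matrix_(i < p.+1, j < p.+1) F (insert_at k x r i) (c j))).
  congr (\det _); apply/matrixP => i j; rewrite !mxE; congr (F _ _).
  case: (unliftP ord0 i) => [a|] ->.
    rewrite lift_perm_lift perm1 /insert_at /= /bump.
    by case: (leqP k a) => /= [le|lt]; rewrite ?add0n ?add1n ?lt //= !ltnNge (leqW le) /= gtn_eqF.
  by rewrite lift_perm_id /insert_at /= ltnn eqxx.
by rewrite row_permE det_mulmx det_perm odd_lift_perm odd_perm1 addbF signr_odd.
Qed.

Section Schur.
Variables (F : nat -> nat -> K) (k : nat).
Let C := \matrix_(i < k, j < k) F i.+1 j.+1.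
Hypothesis C0 : minor F k succn succn != 0.

(** The entries of the Schur complement of the block with rows and columns
    1, ..., k.  The pivot block is the middle one, so that row 0 and column 0 stay
    available, as in the condensation identity. *)
Definition schur x y : K :=
  F x y - ((\row_(j < k) F x j.+1) *m invmx C *m (\col_(i < k) F i.+1 y)) 0 0.

Lemma minor_schur s (r c : nat -> nat) :
  (forall i, (i < k)%N -> r i = i.+1) -> (forall i, (i < k)%N -> c i = i.+1) ->
  minor F (k + s) r c
    = minor F k succn succn * minor schur s (fun i => r (k + i)%N) (fun i => c (k + i)%N).
Proof.
move=> hr hc.
have uC : C \in unitmx by rewrite unitmxE unitfE.
pose Y := \matrix_(i < k, j < s) F i.+1 (c (k + j)%N).
pose X := \matrix_(i < s, j < k) F (r (k + i)%N) j.+1.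
pose Z := \matrix_(i < s, j < s) F (r (k + i)%N) (c (k + j)%N).
have -> : minor F (k + s) r c = \det (block_mx C Y X Z).
  congr (\det _); apply/matrixP => i j; rewrite !mxE.
  case: splitP => a ->; rewrite !mxE; case: splitP => b ->; rewrite !mxE.
  - by rewrite hr ?hc.
  - by rewrite hr.
  - by rewrite hc.
  - by [].
have -> : block_mx C Y X Z
    = block_mx 1%:M 0 (X *m invmx C) 1%:M *m block_mx C Y 0 (Z - X *m invmx C *m Y).
  by rewrite mulmx_block !mul1mx !mul0mx !addr0 mulmxKV // addrC subrK.
rewrite det_mulmx det_lblock !det1 !mul1r det_ublock; congr (_ * \det _).
apply/matrixP => i j; rewrite !mxE /schur; congr (_ - _).
rewrite !mxE; apply: eq_bigr => a _; rewrite !mxE; congr (_ * _).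
by apply: eq_bigr => b _; rewrite !mxE.
Qed.

(** The part of a sequence, with x inserted at position k, that lies outside the
    pivot block. *)
Definition tail_at (x : nat) (r : nat -> nat) (i : nat) : nat :=
  if i is i'.+1 then r (k + i')%N else x.

Let insert_low x r i : (forall i, (i < k)%N -> r i = i.+1) ->
  (i < k)%N -> insert_at k x r i = i.+1.
Proof. by move=> hr lt; rewrite /insert_at lt hr. Qed.

Let insert_tail x r i : insert_at k x r (k + i) = tail_at x r i.
Proof.
rewrite /insert_at ltnNge leq_addr /=; case: i => [|i] /=; first by rewrite addn0 eqxx.
by rewrite -{2}[k]addn0 eqn_add2l addnS.
Qed.

Lemma minor_schur_row s x (r c : nat -> nat) :
  (forall i, (i < k)%N -> r i = i.+1) -> (forall i, (i < k)%N -> c i = i.+1) ->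
  minor F (k + s).+1 (insert_at 0 x r) c
    = (-1) ^+ k * minor F k succn succn
      * minor schur s.+1 (tail_at x r) (fun i => c (k + i)%N).
Proof.
move=> hr hc; rewrite (@minor_rot _ _ k) ?leq_addr // -addnS minor_schur //.
  by rewrite mulrA; congr (_ * _); apply: eq_minor => i j _ _; rewrite insert_tail.
by move=> i; apply: insert_low.
Qed.

Lemma minor_schur_row_col s x y (r c : nat -> nat) :
  (forall i, (i < k)%N -> r i = i.+1) -> (forall i, (i < k)%N -> c i = i.+1) ->
  minor F (k + s).+1 (insert_at 0 x r) (insert_at 0 y c)
    = minor F k succn succn * minor schur s.+1 (tail_at x r) (tail_at y c).
Proof.
move=> hr hc; rewrite (@minor_rot _ _ k) ?leq_addr // minor_tr (@minor_rot _ _ k) ?leq_addr //.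
rewrite -minor_tr mulrA -exprD addnn -mul2n exprM sqrrN expr1n expr1n mul1r.
rewrite -addnS minor_schur //; last 2 first.
- by move=> i; apply: insert_low.
- by move=> i; apply: insert_low.
by congr (_ * _); apply: eq_minor => i j _ _; rewrite !insert_tail.
Qed.

End Schur.

Lemma minor_schur_col F k (C0 : minor F k succn succn != 0) s y (r c : nat -> nat) :
  (forall i, (i < k)%N -> r i = i.+1) -> (forall i, (i < k)%N -> c i = i.+1) ->
  minor F (k + s).+1 r (insert_at 0 y c)
    = (-1) ^+ k * minor F k succn succn
      * minor (schur F k) s.+1 (fun i => r (k + i)%N) (tail_at k y c).
Proof.
move=> hr hc; rewrite minor_tr (@minor_rot _ _ k) ?leq_addr // -minor_tr.
rewrite -addnS minor_schur //.
  rewrite mulrA; congr (_ * _); apply: eq_minor => i j _ _; congr (schur _ _ _ _).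
  rewrite /insert_at ltnNge leq_addr /=; case: j => [|j] /=; first by rewrite addn0 eqxx.
  by rewrite -{2}[k]addn0 eqn_add2l addnS.
by move=> i lt; rewrite /insert_at lt hc.
Qed.

Lemma minor1 F r c : minor F 1 r c = F (r 0%N) (c 0%N).
Proof. by rewrite /minor det_mx11 mxE. Qed.

Lemma minor2 F r c : minor F 2 r c
  = F (r 0%N) (c 0%N) * F (r 1%N) (c 1%N) - F (r 0%N) (c 1%N) * F (r 1%N) (c 0%N).
Proof.
rewrite /minor (expand_det_row _ ord0) !big_ord_recl big_ord0 /cofactor !det_mx11 !mxE /=.
by rewrite /bump /= !(expr0, expr1, addn0, addn1) /=; ring.
Qed.

Lemma minor3 F r c : minor F 3 r c
  = F (r 0%N) (c 0%N) * F (r 1%N) (c 1%N) * F (r 2%N) (c 2%N)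
  - F (r 0%N) (c 0%N) * F (r 1%N) (c 2%N) * F (r 2%N) (c 1%N)
  - F (r 0%N) (c 1%N) * F (r 1%N) (c 0%N) * F (r 2%N) (c 2%N)
  + F (r 0%N) (c 1%N) * F (r 1%N) (c 2%N) * F (r 2%N) (c 0%N)
  + F (r 0%N) (c 2%N) * F (r 1%N) (c 0%N) * F (r 2%N) (c 1%N)
  - F (r 0%N) (c 2%N) * F (r 1%N) (c 1%N) * F (r 2%N) (c 0%N).
Proof.
rewrite /minor (expand_det_row _ ord0) !big_ord_recl big_ord0 /cofactor.
rewrite !(expand_det_row _ ord0) !big_ord_recl !big_ord0 /cofactor !det_mx11 !mxE /=.
rewrite /bump /= !(expr0, expr1, addn0, addn1, add1n, exprS) /=; ring.
Qed.


Lemma sign_cases k : (-1) ^+ k = 1 :> K \/ (-1) ^+ k = - 1 :> K.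
Proof. by rewrite -signr_odd; case: odd; [right; rewrite expr1 | left]. Qed.

Lemma insert0 i : insert_at 0 0%N succn i = i.
Proof. by case: i. Qed.

(** The case of a nonsingular middle block, where it is the 2 x 2 determinant of
    the Schur complement. *)
Lemma dodgson F k : minor F k succn succn != 0 ->
  minor F k.+2 id id * minor F k succn succn
  = minor F k.+1 id id * minor F k.+1 succn succn
    - minor F k.+1 id succn * minor F k.+1 succn id.
Proof.
move=> C0; set d := minor F k succn succn; set S := schur F k.
have -> : minor F k.+2 id id = d * (S 0%N 0%N * S k.+1 k.+1 - S 0%N k.+1 * S k.+1 0%N).
  rewrite (@eq_minor F F _ _ (insert_at 0 0%N succn) _ (insert_at 0 0%N succn)).
    by rewrite -[k.+1 in LHS]addn1 minor_schur_row_col // minor2 /= !addn0.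
  by move=> i j _ _; rewrite !insert0.
have -> : minor F k.+1 id id = d * S 0%N 0%N.
  rewrite (@eq_minor F F _ _ (insert_at 0 0%N succn) _ (insert_at 0 0%N succn)).
    by rewrite -[k in LHS]addn0 minor_schur_row_col // minor1.
  by move=> i j _ _; rewrite !insert0.
have -> : minor F k.+1 id succn = (-1) ^+ k * d * S 0%N k.+1.
  rewrite (@eq_minor F F _ _ (insert_at 0 0%N succn) _ succn).
    by rewrite -[k in LHS]addn0 minor_schur_row // minor1 /= !addn0.
  by move=> i j _ _; rewrite !insert0.
have -> : minor F k.+1 succn id = (-1) ^+ k * d * S k.+1 0%N.
  rewrite (@eq_minor F F _ _ succn _ (insert_at 0 0%N succn)).
    by rewrite -[k in LHS]addn0 minor_schur_col // minor1 /= !addn0.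
  by move=> i j _ _; rewrite !insert0.
have -> : minor F k.+1 succn succn = d * S k.+1 k.+1.
  by rewrite -[k.+1 in LHS]addn1 minor_schur // minor1 addn0.
by case: (sign_cases k) => ->; ring.
Qed.

(** The sequence 0, ..., k, k + 2, k + 3, ... that omits k + 1. *)
Definition skip_to (k : nat) (i : nat) : nat := if (i <= k)%N then i else i.+1.

(** With rows a, C, b, xi (C being rows 1, ..., k) and columns e, D, d (D being
    columns 1, ..., k + 1), this reads
    [aC xi|Dd] [Cb|D] [aCb|eD] = [Cb xi|eD] [aC|D] [aCb|Dd]
    + [aCb xi|eDd] [aC|D] [Cb|D] + [C xi|D] [aCb|Dd] [aCb|eD].
    All factors contain the pivot block, and both sides carry row a and column e
    equally often, so no sign survives; what remains is a polynomial identity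
    between the nine entries of a 3 x 3 Schur complement. *)
Lemma four_term F k : minor F k succn succn != 0 ->
  minor F k.+2 (skip_to k) succn * minor F k.+1 succn succn * minor F k.+2 id id
  = minor F k.+2 succn id * minor F k.+1 id succn * minor F k.+2 id succn
  + minor F k.+3 id id * minor F k.+1 id succn * minor F k.+1 succn succn
  + minor F k.+1 (fun i => (skip_to k i.+1)) succn * minor F k.+2 id succn * minor F k.+2 id id.
Proof.
move=> C0; set d := minor F k succn succn; set S := schur F k.
have skip_insert i : insert_at 0 0 (fun i => skip_to k i.+1) i = skip_to k i.
  by case: i.
have skip_low i : (i < k)%N -> skip_to k i.+1 = i.+1 by rewrite /skip_to => ->.
have skip_k a : skip_to k (k + a).+1 = (k + a).+2.
  by rewrite /skip_to ltnNge leq_addr.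
have -> : minor F k.+2 (skip_to k) succn
    = (-1) ^+ k * d * (S 0%N k.+1 * S k.+2 k.+2 - S 0%N k.+2 * S k.+2 k.+1).
  rewrite (@eq_minor F F _ _ (insert_at 0 0 (fun i => skip_to k i.+1)) _ succn).
    by rewrite -[k.+1 in LHS]addn1 minor_schur_row // minor2 /= skip_k !addn0 !addn1.
  by move=> i j _ _; rewrite !skip_insert.
have -> : minor F k.+1 (fun i => skip_to k i.+1) succn = d * S k.+2 k.+1.
  by rewrite -[k.+1 in LHS]addn1 minor_schur // minor1 skip_k addn0.
have -> : minor F k.+3 id id = d * minor S 3 (tail_at k 0 succn) (tail_at k 0 succn).
  rewrite (@eq_minor F F _ _ (insert_at 0 0%N succn) _ (insert_at 0 0%N succn)).
    by rewrite -[k.+2 in LHS]addn2 minor_schur_row_col.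
  by move=> i j _ _; rewrite !insert0.
have -> : minor F k.+2 id id = d * (S 0%N 0%N * S k.+1 k.+1 - S 0%N k.+1 * S k.+1 0%N).
  rewrite (@eq_minor F F _ _ (insert_at 0 0%N succn) _ (insert_at 0 0%N succn)).
    by rewrite -[k.+1 in LHS]addn1 minor_schur_row_col // minor2 /= !addn0.
  by move=> i j _ _; rewrite !insert0.
have -> : minor F k.+2 id succn
    = (-1) ^+ k * d * (S 0%N k.+1 * S k.+1 k.+2 - S 0%N k.+2 * S k.+1 k.+1).
  rewrite (@eq_minor F F _ _ (insert_at 0 0%N succn) _ succn).
    by rewrite -[k.+1 in LHS]addn1 minor_schur_row // minor2 /= !addn0 !addn1.
  by move=> i j _ _; rewrite !insert0.
have -> : minor F k.+2 succn id
    = (-1) ^+ k * d * (S k.+1 0%N * S k.+2 k.+1 - S k.+1 k.+1 * S k.+2 0%N).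
  rewrite (@eq_minor F F _ _ succn _ (insert_at 0 0%N succn)).
    by rewrite -[k.+1 in LHS]addn1 minor_schur_col // minor2 /= !addn0 !addn1.
  by move=> i j _ _; rewrite !insert0.
have -> : minor F k.+1 id succn = (-1) ^+ k * d * S 0%N k.+1.
  rewrite (@eq_minor F F _ _ (insert_at 0 0%N succn) _ succn).
    by rewrite -[k in LHS]addn0 minor_schur_row // minor1 /= !addn0.
  by move=> i j _ _; rewrite !insert0.
have -> : minor F k.+1 succn succn = d * S k.+1 k.+1.
  by rewrite -[k.+1 in LHS]addn1 minor_schur // minor1 addn0.
rewrite minor3 /= !addn0 !addn1.
by case: (sign_cases k) => ->; ring.
Qed.
End Minors.

(** * Solutions of the octahedron recurrence as minors; the monodromy *)

Lemma bump_ord i (a : 'I_i) : bump i a = a.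
Proof. by rewrite /bump leqNgt ltn_ord. Qed.

Local Ltac index_arith :=
  rewrite /skip_to; intros; cbn beta; repeat case: ifP; intros; try split; lia.

Section Grid.
Variables (K : fieldType) (m n : nat) (G : nat -> int -> int -> K).
Hypothesis G0 : forall P Q, G 0 P Q = 1.
Hypothesis Gtop : forall P Q, G m.+1 P Q = 1.
Hypothesis Gneq0 : forall i P Q, (i <= m.+1)%N -> G i P Q != 0.
Hypothesis Goct : forall i P Q, (0 < i <= m)%N ->
  G i P Q * G i (P + 1) (Q + 1)
    = G i (P + 1) Q * G i P (Q + 1) + G i.+1 P Q * G i.-1 (P + 1) (Q + 1).
Hypothesis Gper : forall i (P Q : int), G i (P + n%:Z) (Q - n%:Z) = G i P Q.
Hypotheses (m_gt0 : (0 < m)%N) (n_gt0 : (0 < n)%N).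

Let M := G 1.

Definition window (P Q : int) (a b : nat) : K := M (P + a%:Z) (Q + b%:Z).

Lemma window_succ_id p P Q :
  minor (window P Q) p succn id = minor (window (P + 1) Q) p id id.
Proof. by apply: eq_minor => i j _ _; congr (M _ _); lia. Qed.

Lemma window_id_succ p P Q :
  minor (window P Q) p id succn = minor (window P (Q + 1)) p id id.
Proof. by apply: eq_minor => i j _ _; congr (M _ _); lia. Qed.

Lemma window_succ_succ p P Q :
  minor (window P Q) p succn succn = minor (window (P + 1) (Q + 1)) p id id.
Proof. by apply: eq_minor => i j _ _; congr (M _ _); lia. Qed.

(** The octahedron recurrence and the condensation identity determine the next
    slice by the same formula, division by the slice k at (P + 1, Q + 1). *)
Lemma window_minor i P Q : (i <= m.+1)%N -> minor (window P Q) i id id = G i P Q.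
Proof.
suff H k : (k <= m)%N -> forall P Q, minor (window P Q) k id id = G k P Q /\
    minor (window P Q) k.+1 id id = G k.+1 P Q.
  by case: i => [_|i lt]; [case: (H 0%N isT P Q) | case: (H i lt P Q)].
elim: k => [_ {}P {}Q|k IH lt_km {}P {}Q].
  rewrite minor1 /minor det_mx00 G0; split=> //.
  by rewrite /window !addr0.
have {}IH := IH (ltnW lt_km); have [_ ek1] := IH P Q; split=> //.
have Gk : G k (P + 1) (Q + 1) != 0 by rewrite Gneq0 // ltnW // ltnW.
have [ek _] := IH (P + 1) (Q + 1).
have := @dodgson _ (window P Q) k.
rewrite !window_succ_id !window_id_succ !window_succ_succ ek => /(_ Gk).
have [_ ->] := IH (P + 1) (Q + 1); have [_ ->] := IH P (Q + 1).
have [_ ->] := IH (P + 1) Q; rewrite ek1 Goct //= => H.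
by apply: (mulIf Gk); rewrite H; ring.
Qed.

Lemma window_minor_vanish P Q : minor (window P Q) m.+2 id id = 0.
Proof.
have Gm : G m (P + 1) (Q + 1) != 0 by rewrite Gneq0.
have := @dodgson _ (window P Q) m.
rewrite !window_succ_id !window_id_succ !window_succ_succ
  !(@window_minor m) // !(@window_minor m.+1) // !Gtop.
by move=> /(_ Gm) /eqP; rewrite subrr mulf_eq0 (negbTE Gm) orbF => /eqP.
Qed.

Let X (P Q : int) : 'M[K]_m.+1 := \matrix_(a, b) window P Q a b.

Lemma det_window P Q : \det (X P Q) = 1.
Proof. by rewrite -(Gtop P Q) -window_minor. Qed.

Lemma unit_window P Q : X P Q \in unitmx.
Proof. by rewrite unitmxE det_window unitr1. Qed.

(** The vanishing minors of size m + 2 express row P + m + 1 by the m + 1 previous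
    rows on any m + 2 consecutive columns.  Two such windows that overlap in m + 1
    columns have the same coefficients, because a window of size m + 1 is
    invertible. *)
Lemma row_dependence (P : int) : exists c : 'rV[K]_m.+1,
  forall Q : int, M (P + m.+1%:Z) Q = \sum_a c 0 a * M (P + a%:Z) Q.
Proof.
pose row (Q : int) : 'rV[K]_m.+1 := \row_b M (P + m.+1%:Z) (Q + b%:Z).
(* The coefficients of the dependence, read off the columns Q, ..., Q + m. *)
pose cv (Q : int) := row Q *m invmx (X P Q).
have rowE (Q : int) b : (b < m.+1)%N ->
    M (P + m.+1%:Z) (Q + b%:Z) = \sum_a cv Q 0 a * M (P + a%:Z) (Q + b%:Z).
  move=> lt_b; have : cv Q *m X P Q = row Q by rewrite mulmxKV ?unit_window.
  move/matrixP/(_ 0 (Ordinal lt_b)); rewrite !mxE /= => <-.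
  by apply: eq_bigr => a _; rewrite !mxE.
have next (Q : int) : cv (Q + 1) = cv Q.
  have /det0P[v v0 vX] : \det (\matrix_(a < m.+2, b < m.+2) window P Q a b) == 0.
    by apply/eqP; apply: window_minor_vanish.
  have vE b : (b < m.+2)%N -> \sum_(a < m.+1) v 0 (widen_ord (leqnSn _) a) *
      M (P + a%:Z) (Q + b%:Z) = - (v 0 ord_max * M (P + m.+1%:Z) (Q + b%:Z)).
    move=> lt_b; move/matrixP/(_ 0 (Ordinal lt_b)): vX; rewrite !mxE big_ord_recr /=.
    move/eqP; rewrite addr_eq0 !mxE /= => /eqP <-.
    by apply: eq_bigr => a _; rewrite !mxE.
  pose v' : 'rV[K]_m.+1 := \row_a v 0 (widen_ord (leqnSn _) a).
  have vX0 : v' *m X P Q = - (v 0 ord_max *: row Q).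
    apply/rowP => b; rewrite !mxE -vE ?(ltn_trans (ltn_ord b)) //.
    by apply: eq_bigr => a _; rewrite !mxE.
  have vX1 : v' *m X P (Q + 1) = - (v 0 ord_max *: row (Q + 1)).
    apply/rowP => b; rewrite !mxE.
    have -> : Q + 1 + b%:Z = Q + (b.+1)%:Z by lia.
    rewrite -vE; last by rewrite ltnS ltn_ord.
    by apply: eq_bigr => a _; rewrite !mxE /window; congr (_ * M _ _); lia.
  have vmax : v 0 ord_max != 0.
    apply: contraNneq v0 => vm; apply/eqP/rowP => a; rewrite mxE.
    have v'0 : v' = 0.
      by apply: (can_inj (mulmxK (unit_window P Q))); rewrite vX0 vm scale0r oppr0 mul0mx.
    have [j ->|->//] := unliftP ord_max a.
    move/rowP/(_ j): v'0; rewrite !mxE => <-; congr (v _ _); apply: val_inj.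
    by rewrite /= /bump leqNgt ltn_ord.
  apply: (scalerI vmax); rewrite /cv !scalemxAl.
  apply: oppr_inj; rewrite -!mulNmx -vX0 -vX1.
  by rewrite !mulmxK ?unit_window.
have cvE (Q : int) : cv Q = cv 0.
  have nat_case (Q' : int) (k : nat) : cv (Q' + k%:Z) = cv Q'.
    by elim: k => [|k IH]; rewrite ?addr0 // -IH -(next (Q' + k%:Z)); congr cv; lia.
  case: Q => k; first by rewrite -(nat_case 0 k) add0r.
  by rewrite -(nat_case (Negz k) k.+1); congr cv; lia.
exists (cv 0) => Q; have := rowE Q 0%N isT; rewrite addr0 cvE => ->.
by [].
Qed.

Let w Q : 'cV[K]_m.+1 := \col_a M a%:Z Q.

(** For P >= 0, as the recurrence of [row_dependence] runs upwards from the first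
    m + 1 rows. *)
Lemma factor_nat (p : nat) : exists u : 'rV[K]_m.+1, forall Q, M p%:Z Q = (u *m w Q) 0 0.
Proof.
elim/ltn_ind: p => p IH; have [lt_pm | le_mp] := ltnP p m.+1.
  exists (delta_mx 0 (Ordinal lt_pm)) => Q.
  by rewrite -rowE !mxE.
have [c cE] := row_dependence (p - m.+1)%:Z.
have [f fE] : exists f : 'I_m.+1 -> 'rV[K]_m.+1, forall (a : 'I_m.+1) (Q : int),
    M (p - m.+1 + a)%N%:Z Q = (f a *m w Q) 0 0.
  apply: (@fin_all_exists _ _ (fun (a : 'I_m.+1) (v : 'rV[K]_m.+1) =>
    forall Q : int, M (p - m.+1 + a)%N%:Z Q = (v *m w Q) 0 0)) => a.
  by apply: IH; have := ltn_ord a; lia.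
exists (\sum_a c 0 a *: f a) => Q.
have -> : p%:Z = (p - m.+1)%:Z + m.+1%:Z by lia.
rewrite cE mulmx_suml summxE; apply: eq_bigr => a _.
by rewrite -scalemxAl mxE -fE; congr (_ * M _ _); lia.
Qed.

Let u (P : int) : 'rV[K]_m.+1 := (\row_b M P b%:Z) *m invmx (X 0 0).

Lemma uE P : (exists u : 'rV[K]_m.+1, forall Q, M P Q = (u *m w Q) 0 0) ->
  forall Q, M P Q = (u P *m w Q) 0 0.
Proof.
case=> v vE; suff -> : u P = v by [].
have -> : v = v *m X 0 0 *m invmx (X 0 0) by rewrite mulmxK ?unit_window.
congr (_ *m _); apply/rowP => b; rewrite mxE vE !mxE; apply: eq_bigr => a _.
by rewrite !mxE /window; congr (_ * M _ _); lia.
Qed.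

Definition monodromy : 'M[K]_m.+1 := \matrix_(a, b) u (a + n)%N%:Z 0 b.
Local Notation A := monodromy.

Lemma M_shift P Q : M (P + n%:Z) Q = M P (Q + n%:Z).
Proof. by rewrite -[RHS](Gper 1); congr (G _ _ _); lia. Qed.

(** The rows n, ..., n + m of M are combinations of the rows 0, ..., m; by the
    symmetry [M_shift] this is a statement about the columns w. *)
Lemma w_shift Q : w (Q + n%:Z) = A *m w Q.
Proof.
apply/colP => a; rewrite !mxE -M_shift (uE (factor_nat (a + n))) mxE.
by apply: eq_bigr => b _; rewrite !mxE.
Qed.

Lemma det_monodromy : \det A = 1.
Proof.
have: X 0 n%:Z = A *m X 0 0.
  apply/matrixP => a b; move/colP/(_ a): (w_shift b%:Z); rewrite !mxE => H.
  transitivity (M a (b%:Z + n%:Z)); first by congr (M _ _); lia.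
  by rewrite H; apply: eq_bigr => j _; rewrite !mxE; congr (_ * _).
by move/(congr1 determinant); rewrite det_mulmx !det_window mulr1.
Qed.

Lemma unit_monodromy : A \in unitmx.
Proof. by rewrite unitmxE det_monodromy unitr1. Qed.

(** Negative rows are reached by the symmetry [M_shift], which trades them for a
    shift of the columns, and that shift is undone by the inverse monodromy. *)
Lemma factor P Q : M P Q = (u P *m w Q) 0 0.
Proof.
apply: uE; have [k ge0] : exists k : nat, 0 <= P + (n * k)%N%:Z.
  by exists `|P|%N; nia.
elim: k P ge0 => [|k IH] P ge0.
  have -> : P = `|P|%N%:Z by lia.
  exact: factor_nat.
have [|v vE] := IH (P + n%:Z); first by lia.
exists (v *m invmx A) => R.
have -> : w R = A *m w (R - n%:Z) by rewrite -w_shift subrK.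
rewrite mulmxA mulmxKV ?unit_monodromy // -vE M_shift.
by congr (M _ _); lia.
Qed.

Lemma w_shift_iter Q k : w (Q + (n * k)%N%:Z) = A ^+ k *m w Q.
Proof.
elim: k => [|k IH]; first by rewrite expr0 mul1mx muln0 addr0.
by rewrite exprS -mulmxE -mulmxA -IH -w_shift; congr (w _); lia.
Qed.

Lemma M_shift_iter P Q k : M (P + (n * k)%N%:Z) Q = M P (Q + (n * k)%N%:Z).
Proof.
elim: k P Q => [|k IH] P Q; first by rewrite muln0 !addr0.
transitivity (M (P + (n * k)%N%:Z) (Q + n%:Z)).
  by rewrite -M_shift; congr (M _ _); lia.
by rewrite IH; congr (M _ _); lia.
Qed.

(** The time step 2n at a fixed vertex moves both P and Q by n, hence the columns
    alone by 2n, which is two turns of the monodromy. *)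
Lemma minor_diag i P Q : (i <= m.+1)%N ->
  exists (U : 'M[K]_(i, m.+1)) (W : 'M[K]_(m.+1, i)),
  forall k : nat, G i (P + (n * k)%N%:Z) (Q + (n * k)%N%:Z)
    = \det (U *m A ^+ (2 * k) *m W).
Proof.
move=> le_im.
exists (\matrix_(a < i, l < m.+1) u (P + a%:Z) 0 l).
exists (\matrix_(l < m.+1, b < i) w (Q + b%:Z) l 0) => k.
rewrite -window_minor //; congr (\det _); apply/matrixP => a b; rewrite mxE /window.
have -> : M (P + (n * k)%N%:Z + a%:Z) (Q + (n * k)%N%:Z + b%:Z)
    = M (P + a%:Z) ((Q + b%:Z) + (n * (2 * k))%N%:Z).
  transitivity (M ((P + a%:Z) + (n * k)%N%:Z) (Q + (n * k)%N%:Z + b%:Z)).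
    by congr (M _ _); lia.
  by rewrite M_shift_iter; congr (M _ _); lia.
rewrite factor w_shift_iter -mulmxA !mxE; apply: eq_bigr => l _.
by rewrite !mxE; congr (_ * _); apply: eq_bigr => l' _; rewrite !mxE.
Qed.

(** The contiguous minor of size i + 1 whose last row is replaced by an arbitrary
    function xi of the column. *)
Definition bordered (i : nat) (R C : int) (xi : int -> K) : K :=
  minor (fun a b => if (a < i)%N then M (R + a%:Z) (C + b%:Z) else xi (C + b%:Z))
    i.+1 id id.

Lemma bordered_shift i (R C : int) xi :
  bordered i (R + n%:Z) (C - n%:Z) xi = bordered i R C (fun q => xi (q - n%:Z)).
Proof.
apply: eq_minor => a b _ _; case: ifP => _; last by congr (xi _); lia.
by rewrite -[RHS](Gper 1); congr (G _ _ _); lia.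
Qed.

Lemma bordered_eq i (R C : int) xi xi' : xi =1 xi' -> bordered i R C xi = bordered i R C xi'.
Proof. by move=> exi; apply: eq_minor => a b _ _; rewrite exi. Qed.

Let bordered_expand i (R C : int) : exists cof : 'I_i.+1 -> K, forall xi,
  bordered i R C xi = \sum_(b < i.+1) xi (C + b%:Z) * cof b.
Proof.
exists (fun b => cofactor (\matrix_(a < i.+1, b < i.+1)
  (if (a < i)%N then M (R + a%:Z) (C + b%:Z) else 0)) ord_max b) => xi.
rewrite /bordered /minor (expand_det_row _ ord_max); apply: eq_bigr => b _.
rewrite mxE /= ltnn; congr (_ * (_ * \det _)).
by apply/matrixP => a d; rewrite !mxE /= bump_ord ltn_ord.
Qed.

Lemma bordered_sum (I : finType) (e : I -> K) i (R C : int) (xi : I -> int -> K) :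
  bordered i R C (fun q => \sum_l e l * xi l q) = \sum_l e l * bordered i R C (xi l).
Proof.
have [cof cofE] := bordered_expand i R C.
rewrite cofE; under [RHS]eq_bigr do rewrite cofE mulr_sumr.
rewrite exchange_big; apply: eq_bigr => b _; rewrite mulr_suml.
by apply: eq_bigr => l _; rewrite mulrA.
Qed.

Lemma bordered_last i (R C : int) xi : (i <= m.+1)%N ->
  (forall b : nat, (b < i)%N -> xi (C + b%:Z) = 0) ->
  bordered i R C xi = xi (C + i%:Z) * G i R C.
Proof.
move=> le_im xi0; rewrite /bordered /minor (expand_det_row _ ord_max).
rewrite big_ord_recr big1 /= => [|b _]; last first.
  by rewrite mxE /= ltnn xi0 ?mul0r ?ltn_ord.
rewrite add0r mxE /= ltnn -window_minor // /cofactor addnn -mul2n exprM sqrrN !expr1n mul1r.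
congr (_ * \det _); apply/matrixP => a d.
by rewrite !mxE /= !bump_ord ltn_ord.
Qed.

Lemma bordered_first i (R C : int) xi : (i <= m.+1)%N ->
  (forall b : nat, (b < i)%N -> xi (C + b.+1%:Z) = 0) ->
  bordered i R C xi = (-1) ^+ i * (xi C * G i R (C + 1)).
Proof.
move=> le_im xi0; rewrite /bordered /minor (expand_det_row _ ord_max).
rewrite big_ord_recl big1 /= => [|b _]; last first.
  by rewrite mxE /= ltnn xi0 ?mul0r ?ltn_ord.
rewrite addr0 mxE /= ltnn addr0 -window_minor // /cofactor addn0 mulrCA.
congr (_ * (_ * \det _)); apply/matrixP => a d.
rewrite !mxE /= bump_ord ltn_ord /window /bump add1n.
by congr (M _ _); lia.
Qed.

(** A minor of size m + 2 of a matrix of rank m + 1. *)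
Lemma bordered_top (R C P : int) : bordered m.+1 R C (M P) = 0.
Proof.
pose U : 'M[K]_(m.+2, m.+1) := \matrix_(a, l) u (if (a < m.+1)%N then R + a%:Z else P) 0 l.
pose W : 'M[K]_(m.+1, m.+2) := \matrix_(l, b) w (C + b%:Z) l 0.
have -> : bordered m.+1 R C (M P) = \det (U *m W).
  congr (\det _); apply/matrixP => a b; rewrite !mxE /=.
  case: ifP => lt_am; rewrite factor mxE; apply: eq_bigr => l _; rewrite !mxE lt_am //.
apply/eqP; rewrite -[_ == 0]negbK -unitfE -unitmxE -row_free_unit -row_leq_rank -ltnNge.
by rewrite ltnS (leq_trans (mxrankM_maxr _ _)) ?rank_leq_row.
Qed.

(** The identity [four_term] in which the border is the row xi. *)
Lemma bordered_four i (P Q : int) xi : (0 < i <= m)%N ->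
  bordered i P (Q + 1) xi * G i (P + 1) (Q + 1) * G i.+1 P Q
  = bordered i (P + 1) Q xi * G i P (Q + 1) * G i.+1 P (Q + 1)
  + bordered i.+1 P Q xi * G i P (Q + 1) * G i (P + 1) (Q + 1)
  + bordered i.-1 (P + 1) (Q + 1) xi * G i.+1 P (Q + 1) * G i.+1 P Q.
Proof.
case: i => // k /= lt_km.
pose F a b := if (a < k.+2)%N then M (P + a%:Z) (Q + b%:Z) else xi (Q + b%:Z).
have FG p r c (P' Q' : int) : (p <= m.+1)%N ->
    (forall a, (a < p)%N -> (r a < k.+2)%N /\ P + (r a)%:Z = P' + a%:Z) ->
    (forall b : nat, Q + (c b)%:Z = Q' + b%:Z) ->
    minor F p r c = G p P' Q'.
  move=> le_pm hr hc; rewrite -window_minor //; apply: eq_minor => a b lt_a _.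
  by have [lt_ra era] := hr a lt_a; rewrite /F lt_ra /window era hc.
have FB p r c (P' Q' : int) :
    (forall a, (a < p)%N -> (r a < k.+2)%N /\ P + (r a)%:Z = P' + a%:Z) -> r p = k.+2 ->
    (forall b : nat, Q + (c b)%:Z = Q' + b%:Z) ->
    minor F p.+1 r c = bordered p P' Q' xi.
  move=> hr hrp hc; apply: eq_minor => a b lt_a _; rewrite /F hc.
  case: (ltnP a p) => [lt_ap|le_pa].
    by have [-> ->] := hr a lt_ap.
  have -> : a = p by lia.
  by rewrite hrp ltnn.
have := @four_term _ F k.
rewrite (FG k succn succn (P + 1) (Q + 1)); [|index_arith..].
rewrite Gneq0; last by lia.
move=> /(_ isT).
rewrite (FB k.+1 (skip_to k) succn P (Q + 1)); [|index_arith..].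
rewrite (FG k.+1 succn succn (P + 1) (Q + 1)); [|index_arith..].
rewrite (FG k.+2 id id P Q); [|index_arith..].
rewrite (FB k.+1 succn id (P + 1) Q); [|index_arith..].
rewrite (FG k.+1 id succn P (Q + 1)); [|index_arith..].
rewrite (FG k.+2 id succn P (Q + 1)); [|index_arith..].
rewrite (FB k.+2 id id P Q); [|index_arith..].
by rewrite (FB k _ succn (P + 1) (Q + 1)); [|index_arith..].
Qed.

Lemma bordered_three (P Q : int) xi :
  bordered 0 P (Q + 1) xi * G 1 P Q
  = bordered 0 (P + 1) Q xi * G 1 P (Q + 1) + bordered 1 P Q xi.
Proof.
rewrite /bordered !minor1 minor2 /= !addr0 -/M; ring.
Qed.

Variable c : nat.

(** The index, in the light-cone direction, of the cell in row i of column j;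
    a cell and its right neighbour share it when they form a sea domino. *)
Definition level (i j : nat) : nat := uphalf (i + j + c).

(** The value of the grid at the node (i, j) at time 0 or 1, whichever has the
    right parity. *)
Definition initial_value (i j : nat) : K :=
  G i ((level i j)%:Z - i%:Z - c%:Z) ((level i j)%:Z - i%:Z - c%:Z - j%:Z).

(** A solution, for each row P of M, of the transfer from column to column defined
    by the domino weights; see [wave_odd] and [wave_even]. *)
Definition wave (j i : nat) (P : int) : K :=
  bordered i ((level i j)%:Z - i%:Z - c%:Z) (- (level i j)%:Z) (M P).

Definition wave_mx (j : nat) : 'M[K]_m.+1 := \matrix_(i, P) wave j i P%:Z.

(** Both the bordering rows and the columns move by n, in opposite directions, so
    only the border M P sees the shift; there the monodromy appears. *)
Lemma wave_mx_shift j : wave_mx j = wave_mx (j + 2 * n)%N *m A^T.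
Proof.
apply/matrixP => i P; rewrite [LHS]mxE [RHS]mxE /wave.
have lev : level i (j + 2 * n)%N = (level i j + n)%N by rewrite /level; lia.
transitivity (\sum_l A P l * bordered i ((level i j)%:Z - i%:Z - c%:Z + n%:Z)
    (- (level i j)%:Z - n%:Z) (M l%:Z)).
  rewrite -bordered_sum bordered_shift; apply: bordered_eq => q.
  have -> : M P%:Z q = M P%:Z (q - n%:Z + n%:Z) by rewrite subrK.
  have /colP/(_ P) := w_shift (q - n%:Z).
  by rewrite !mxE => ->; apply: eq_bigr => l _; rewrite !mxE.
apply: eq_bigr => l _; rewrite [RHS]mulrC; congr (_ * _); first by rewrite [RHS]mxE.
by rewrite mxE /wave lev; congr (bordered _ _ _ _); lia.
Qed.

(** The columns used by the i-th bordered minor form an interval that grows by one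
    element at one of its ends with each i.  If xi vanishes on the interval for i,
    the minor for i + 1 is xi at the new column times a nonzero contiguous minor. *)
Lemma bordered_kernel (R lev : nat -> int) xi :
  (forall i, lev i.+1 = lev i \/ lev i.+1 = lev i + 1) ->
  (forall i, (i <= m)%N -> bordered i (R i) (- lev i) xi = 0) ->
  forall i b : nat, (b <= i <= m)%N -> xi (- lev i + b%:Z) = 0.
Proof.
move=> lev_step ker; elim=> [|i IH] b.
  rewrite leqn0 => /andP[/eqP-> _]; have := ker 0%N isT.
  by rewrite /bordered minor1 /=.
case/andP => le_bi lt_im; have kerS := ker i.+1 lt_im.
have Gi P Q : G i.+1 P Q == 0 = false by apply/negbTE/Gneq0/leqW.
have [eq_lev|eq_lev] := lev_step i.
  have [le_bi'|lt_ib] := leqP b i; first by rewrite eq_lev IH // le_bi' ltnW.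
  have -> : b = i.+1 by lia.
  move/eqP: kerS; rewrite bordered_last ?leqW //; first by rewrite mulf_eq0 Gi orbF => /eqP.
  by move=> d lt_di; rewrite eq_lev IH // -ltnS lt_di ltnW.
case: b le_bi => [_|b lt_bi]; last first.
  have -> : - lev i.+1 + b.+1%:Z = - lev i + b%:Z by rewrite eq_lev; lia.
  by rewrite IH // -ltnS lt_bi ltnW.
move/eqP: kerS; rewrite bordered_first ?leqW //; first by rewrite !mulf_eq0 signr_eq0 Gi orbF addr0 => /eqP.
move=> d lt_di.
have -> : - lev i.+1 + d.+1%:Z = - lev i + d%:Z by rewrite eq_lev; lia.
by rewrite IH // -ltnS lt_di ltnW.
Qed.

(** A vector in the kernel would be a combination of the rows 0, ..., m of M
    that vanishes on m + 1 consecutive columns. *)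
Lemma wave_mx_unit j : wave_mx j \in unitmx.
Proof.
rewrite unitmxE unitfE -det_tr; apply: contraT; rewrite negbK => /det0P[v v0 vV].
pose xi q := \sum_P v 0 P * M P%:Z q.
have ker i : (i <= m)%N ->
    bordered i ((level i j)%:Z - i%:Z - c%:Z) (- (level i j)%:Z) xi = 0.
  rewrite -ltnS => lt_im; rewrite /xi bordered_sum.
  have /rowP/(_ (Ordinal lt_im)) := vV; rewrite !mxE => vV0.
  by rewrite -[RHS]vV0; apply: eq_bigr => P _; rewrite !mxE.
have xi0 := @bordered_kernel (fun i => (level i j)%:Z - i%:Z - c%:Z)
  (fun i => (level i j)%:Z) xi _ ker.
have {}xi0 : v *m X 0 (- (level m j)%:Z) = 0.
  apply/rowP => b; rewrite !mxE -[RHS](xi0 _ m b); first last.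
  - by rewrite -ltnS ltn_ord leqnn.
  - by move=> i; rewrite /level; lia.
  apply: eq_bigr => P _; rewrite !mxE; congr (_ * M _ _); lia.
case/negP: v0; apply/eqP; apply: (can_inj (mulmxK (unit_window 0 (- (level m j)%:Z)))).
by rewrite xi0 mul0mx.
Qed.

Lemma wave_odd j i P : odd (i + j + c) -> wave j i P = wave j.+1 i P.
Proof.
move=> odd_ij; rewrite /wave.
by have -> : level i j.+1 = level i j by rewrite /level; lia.
Qed.

(** The three terms on the right are the three ways in which a domino other than
    the sea domino can cover the even cell (i, j): across its right, top and bottom
    sides. *)
Lemma wave_even j i P : (i <= m)%N -> ~~ odd (i + j + c) ->
  wave j i P%:Z * initial_value i j.+1 * initial_value i.+1 j.+1
  = wave j.+1 i P%:Z * initial_value i j * initial_value i.+1 j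
  + (if (i < m)%N then wave j.+1 i.+1 P%:Z * initial_value i j * initial_value i j.+1 else 0)
  + (if (0 < i)%N then wave j.+1 i.-1 P%:Z * initial_value i.+1 j * initial_value i.+1 j.+1 else 0).
Proof.
move=> le_im even_ij; rewrite /wave /initial_value.
have l1 : level i j.+1 = (level i j).+1 by rewrite /level; lia.
have l2 : level i.+1 j = (level i j).+1 by rewrite /level; lia.
have l3 : level i.+1 j.+1 = (level i j).+1 by rewrite /level; lia.
have l4 : (0 < i)%N -> level i.-1 j.+1 = level i j by rewrite /level; lia.
have lev : (2 * level i j = i + j + c)%N by rewrite /level; lia.
rewrite l1 l2 l3; set k := level i j in l4 lev *; set P0 := k%:Z - i%:Z - c%:Z.
pose Q0 := - k%:Z - 1.
have -> : - k%:Z = Q0 + 1 by lia.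
have -> : - k.+1%:Z = Q0 by lia.
have -> : k.+1%:Z - i%:Z - c%:Z = P0 + 1 by lia.
have -> : k.+1%:Z - i.+1%:Z - c%:Z = P0 by lia.
have -> : P0 + 1 - j.+1%:Z = Q0 + 1 by lia.
have -> : P0 - j.+1%:Z = Q0 by lia.
have -> : P0 - j%:Z = Q0 + 1 by lia.
have [i0|i_gt0] := posnP i.
  by rewrite i0 m_gt0 addr0 !G0 !mulr1 bordered_three.
(* For i = m the term of the row above vanishes. *)
have top : (if (i < m)%N then bordered i.+1 P0 Q0 (M P%:Z) * G i P0 (Q0 + 1)
     * G i (P0 + 1) (Q0 + 1) else 0) = bordered i.+1 P0 Q0 (M P%:Z) * G i P0 (Q0 + 1) * G i (P0 + 1) (Q0 + 1).
  case: ltnP => // le_mi; have -> : i = m by lia.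
  by rewrite bordered_top !mul0r.
rewrite top l4 //.
have -> : k%:Z - i.-1%:Z - c%:Z = P0 + 1 by lia.
have -> : - k%:Z = Q0 + 1 by lia.
by rewrite bordered_four ?i_gt0.
Qed.

End Grid.

(** * Permutations that move non-crossing paths around a cycle of columns *)

Section CyclicPermutation.
Variables (U : finType) (N : nat) (row : U -> nat) (col : U -> 'I_N) (s : {perm U}).
Hypothesis N_gt1 : (1 < N)%N.
Hypothesis row_col_inj : forall a b, row a = row b -> col a = col b -> a = b.
Hypothesis s_col : forall a, s a != a -> col (s a) = ordS (col a).
Hypothesis s_mono : forall a b, s a != a -> s b != b -> col a = col b ->
  (row a < row b)%N -> (row (s a) < row (s b))%N.

Lemma val_iter_ordS k (j : 'I_N) : iter k (@ordS N) j = ((j + k) %% N)%N :> nat.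
Proof.
elim: k => [|k IH] /=; first by rewrite addn0 modn_small.
by rewrite IH -addn1 modnDml addn1 addnS.
Qed.

Lemma moved_iter k a : s a != a -> (s ^+ k)%g a != s ((s ^+ k)%g a).
Proof. by rewrite eq_sym -permM -expgSr expgS permM (inj_eq perm_inj). Qed.

Lemma moved_expg k a : s a != a -> s ((s ^+ k)%g a) != (s ^+ k)%g a.
Proof. by move=> /(moved_iter k); rewrite eq_sym. Qed.

Lemma col_expg k a : s a != a -> col ((s ^+ k)%g a) = iter k (@ordS N) (col a).
Proof.
move=> ma; elim: k => [|k IH]; first by rewrite expg0 perm1.
by rewrite expgSr permM s_col ?moved_expg // IH.
Qed.

Lemma row_expg k a b : s a != a -> s b != b -> col a = col b ->
  (row a < row b)%N -> (row ((s ^+ k)%g a) < row ((s ^+ k)%g b))%N.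
Proof.
move=> ma mb eqc lt; elim: k => [|k IH]; first by rewrite expg0 !perm1.
by rewrite !expgSr !permM s_mono ?moved_expg // !col_expg ?eqc.
Qed.

Lemma iter_ordS_full (j : 'I_N) : iter N (@ordS N) j = j.
Proof. by apply: val_inj; rewrite /= val_iter_ordS modnDr modn_small. Qed.

(** The N-th power preserves each column and the order of the moved points in it,
    and an order preserving permutation of a finite chain is the identity.  Iterating
    the power on a point that it raised, or lowered, would never come back. *)
Lemma expg_period a : s a != a -> (s ^+ N)%g a = a.
Proof.
move=> ma; pose t := (s ^+ N)%g.
have mt k b : s b != b -> s ((t ^+ k)%g b) != (t ^+ k)%g b.
  by rewrite -expgM; apply: moved_expg.
have ct k b : s b != b -> col ((t ^+ k)%g b) = col b.
  move=> mb; elim: k => [|k IH]; first by rewrite expg0 perm1.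
  by rewrite expgSr permM col_expg ?mt // iter_ordS_full.
have no_incr b b' : s b != b -> s b' != b' -> col b = col b' ->
    (forall k, (t ^+ k.+1)%g b = (t ^+ k)%g b') -> ~~ (row b < row b')%N.
  move=> mb mb' ec eb; apply/negP => lt.
  have incr k : (row ((t ^+ k)%g b) < row ((t ^+ k.+1)%g b))%N.
    by rewrite eb -expgM row_expg.
  have lt0 k : (row b < row ((t ^+ k.+1)%g b))%N.
    elim: k => [|k IH]; first by have := incr 0%N; rewrite expg0 perm1.
    exact: ltn_trans IH (incr _).
  have := lt0 #[t]%g.-1; rewrite prednK ?order_gt0 // expg_order perm1.
  by rewrite ltnn.
have mta : s (t a) != t a by have := mt 1%N a ma; rewrite expg1.
have cta : col (t a) = col a by have := ct 1%N a ma; rewrite expg1.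
apply: row_col_inj => //; apply/eqP; rewrite eqn_leq; apply/andP; split.
  rewrite leqNgt; apply: no_incr => // k.
  by rewrite expgS permM.
rewrite leqNgt.
have tV k : ((t^-1) ^+ k.+1)%g (t a) = ((t^-1) ^+ k)%g a.
  by rewrite expgS permM permK.
apply/negP => lt.
have incr k : (row ((t ^+ k.+1)%g a) < row ((t ^+ k)%g a))%N.
  by rewrite expgS permM -expgM row_expg.
have lt0 k : (row ((t ^+ k.+1)%g a) < row a)%N.
  elim: k => [|k IH]; first by have := incr 0%N; rewrite expg0 perm1.
  exact: ltn_trans (incr _) IH.
have := lt0 #[t]%g.-1; rewrite prednK ?order_gt0 // expg_order perm1.
by rewrite ltnn.
Qed.

Lemma porbit_moved a b : s a != a -> b \in porbit s a -> s b != b.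
Proof. by move=> ma /porbitP[k ->]; apply: moved_expg. Qed.

Lemma porbit_col_inj a b : s a != a -> b \in porbit s a -> col b = col a -> b = a.
Proof.
move=> ma /porbitP[k ->]; rewrite (divn_eq k N) expgD permM => ec.
have per i : (s ^+ (i * N))%g a = a.
  elim: i => [|i IH]; first by rewrite expg0 perm1.
  by rewrite mulSn expgD permM expg_period.
move: ec; rewrite !per col_expg // => /(congr1 val).
rewrite /= val_iter_ordS => ec.
suff -> : (k %% N = 0)%N by rewrite expg0 perm1.
have lt1 := ltn_ord (col a); have lt2 : (k %% N < N)%N by rewrite ltn_mod ltnW.
move: ec; have [lt|ge] := ltnP (col a + k %% N) N; first by rewrite modn_small // ; lia.
rewrite -(subnK ge) modnDr modn_small; lia.
Qed.

Lemma porbit_meets_col j a : s a != a -> exists2 b, b \in porbit s a & col b = j.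
Proof.
move=> ma; exists ((s ^+ (j + (N - col a)))%g a); first exact: mem_porbit.
rewrite col_expg //; apply: val_inj; rewrite /= val_iter_ordS addnCA subnKC; last exact: ltnW.
by rewrite modnDr modn_small.
Qed.

Definition moved_in j := [set a | (s a != a) && (col a == j)].

(** Each nontrivial orbit meets each column exactly once. *)
Lemma card_moved_in j : #|[set porbit s a | a in [set a | s a != a]]| = #|moved_in j|.
Proof.
rewrite -(card_in_imset (f := porbit s) (D := mem (moved_in j))).
  apply: eq_card => O; apply/imsetP/imsetP => -[a]; rewrite inE.
    move=> ma ->; have [b ba cb] := porbit_meets_col j ma; exists b.
      by rewrite inE (porbit_moved ma ba) cb eqxx.
    by apply/eqP; rewrite eq_porbit_mem porbit_sym.
  by case/andP => ma _ ->; exists a; rewrite ?inE.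
move=> a b; rewrite !inE => /andP[ma /eqP ca] /andP[mb /eqP cb] eqO.
by apply: porbit_col_inj => //; rewrite ?ca ?cb // -eq_porbit_mem eqO.
Qed.

Lemma card_moved j : #|[set a | s a != a]| = (N * #|moved_in j|)%N.
Proof.
have -> : #|[set a | s a != a]| = (\sum_(i < N) #|moved_in i|)%N.
  rewrite -sum1_card (partition_big col xpredT) //=; apply: eq_bigr => i _.
  by rewrite -sum1_card; apply: eq_bigl => a; rewrite !inE.
rewrite (eq_bigr (fun=> #|moved_in j|)) ?sum_nat_const ?card_ord // => i _.
by rewrite -card_moved_in (card_moved_in j).
Qed.

(** There are as many nontrivial orbits as moved points in a column, and each is a
    cycle of even length N, hence odd. *)
Lemma odd_perm_moved j : ~~ odd N -> odd_perm s = odd #|moved_in j|.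
Proof.
move=> evenN; pose Mv := [set a | s a != a].
have Ufix : #|U| = (#|Mv| + #|~: Mv|)%N by rewrite cardsC.
have orb : #|porbits s| = (#|moved_in j| + #|~: Mv|)%N.
  have fixE a : a \in ~: Mv -> porbit s a = [set a].
    rewrite !inE negbK => /eqP fa; apply/setP => b; rewrite inE.
    apply/porbitP/eqP => [[k ->]|->]; last by exists 0%N; rewrite expg0 perm1.
    by elim: k => [|k IH]; rewrite ?expg0 ?perm1 // expgSr permM IH.
  have -> : porbits s = [set porbit s a | a in Mv] :|: [set porbit s a | a in ~: Mv].
    rewrite -imsetU setUCr; apply/setP => O.
    by apply/imsetP/imsetP => -[a _ ->]; exists a.
  have disj : [set porbit s a | a in Mv] :&: [set porbit s a | a in ~: Mv] = set0.
    apply/setP => O; rewrite !inE; apply/negP.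
    move=> /andP[/imsetP[a Ma ->] /imsetP[b Mb]].
    rewrite (fixE b Mb) => eqO; move: (Mb); rewrite !inE negbK => /eqP fb.
    have : a \in [set b] by rewrite -eqO porbit_id.
    by rewrite inE => /eqP ab; move: Ma; rewrite inE ab fb eqxx.
  rewrite cardsU disj cards0 subn0 (card_moved_in j); congr (_ + _)%N.
  apply: card_in_imset => a b Ma Mb; rewrite (fixE a Ma) (fixE b Mb).
  exact: set1_inj.
rewrite /odd_perm Ufix orb !oddD (card_moved j) oddM (negbTE evenN) /=.
by rewrite addbC -addbA addbb addbF.
Qed.
End CyclicPermutation.

Section DeterminantOverFinType.
Variables (R : comNzRingType) (U : finType).

Let tr_inj (s : 'S_#|U|) : injective (fun x : U => enum_val (s (enum_rank x))).
Proof. by move=> x y /enum_val_inj/perm_inj/enum_rank_inj. Qed.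

Let tr (s : 'S_#|U|) : {perm U} := perm (@tr_inj s).

Let rt_inj (s : {perm U}) : injective (fun a : 'I_#|U| => enum_rank (s (enum_val a))).
Proof. by move=> x y /enum_rank_inj/perm_inj/enum_val_inj. Qed.

Let rt (s : {perm U}) : 'S_#|U| := perm (@rt_inj s).

Let odd_tr s : odd_perm (tr s) = odd_perm s.
Proof.
rewrite /odd_perm card_ord; congr (_ (+) odd _).
have iterE k a : (tr s ^+ k)%g (enum_val a) = enum_val ((s ^+ k)%g a).
  elim: k => [|k IH]; first by rewrite !expg0 !perm1.
  by rewrite !expgSr !permM IH permE enum_valK.
have orbE a : porbit (tr s) (enum_val a) = [set enum_val b | b in porbit s a].
  apply/setP => x; apply/porbitP/imsetP => [[k ->]|[b /porbitP[k ->] ->]].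
    by rewrite iterE; exists ((s ^+ k)%g a); rewrite ?mem_porbit.
  by exists k; rewrite iterE.
rewrite -[RHS](card_imset _ (imset_inj (@enum_val_inj _ U))).
apply: eq_card => O; apply/imsetP/imsetP => [[x _ ->]|[O' /imsetP[a _ ->] ->]].
  exists (porbit s (enum_rank x)); first exact: imset_f.
  by rewrite -orbE enum_rankK.
by exists (enum_val a) => //; rewrite orbE.
Qed.

(** Determinants are defined over ordinals; this one is expanded over permutations
    of the index type itself. *)
Lemma det_enum (F : U -> U -> R) :
  \det (\matrix_(a < #|U|, b < #|U|) F (enum_val a) (enum_val b))
    = \sum_(s : {perm U}) (-1) ^+ s * \prod_x F x (s x).
Proof.
rewrite /determinant [RHS](reindex tr) /=; last first.
  by exists rt => s _; apply/permP => a; rewrite !permE ?enum_valK ?enum_rankK.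
apply: eq_bigr => s _; rewrite odd_tr; congr (_ * _).
rewrite [RHS](reindex (@enum_val _ U)) /=; last first.
  by exists enum_rank => a _; rewrite ?enum_valK ?enum_rankK.
by apply: eq_bigr => a _; rewrite mxE permE enum_valK.
Qed.
End DeterminantOverFinType.

(** * Cells of the cylinder *)

Section Geometry.
Variables (m n : nat) (c : bool).
Local Notation cell := (cell m n).
Implicit Types (b : cell) (D : {set edge m n}).

Definition east b : cell := (b.1, ordS b.2).
Definition west b : cell := (b.1, ord_pred b.2).
Definition north b : cell := (inord b.1.+1, b.2).
Definition south b : cell := (inord b.1.-1, b.2).
(** Colour of the checkerboard.  The left side of a cell belongs to the sea exactly
    when the cell is even, so a sea domino consists of an odd cell and of the even
    cell to its right. *)
Definition odd_cell b : bool := odd (b.1 + b.2 + c).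

Lemma eastK : cancel east west.
Proof. by case=> i j; rewrite /east /west /= ordSK. Qed.

Lemma westK : cancel west east.
Proof. by case=> i j; rewrite /east /west /= ord_predK. Qed.

Lemma ordS_neq (n_gt0 : (0 < n)%N) (j : 'I_(2 * n)) : ordS j != j.
Proof.
rewrite -val_eqE /=; have := ltn_ord j; have [lt|ge] := ltnP j.+1 (2 * n)%N.
  by move=> _; rewrite modn_small //; apply/eqP; lia.
move=> lt; have -> : j.+1 = (2 * n)%N by lia.
by rewrite modnn; apply/eqP; lia.
Qed.

Lemma odd_ordS (j : 'I_(2 * n)) : odd (ordS j) = ~~ odd j.
Proof. by rewrite /= odd_mod ?oddM. Qed.

Lemma odd_east b : odd_cell (east b) = ~~ odd_cell b.
Proof. by rewrite /odd_cell !oddD odd_ordS addbN addNb. Qed.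

Lemma odd_west b : odd_cell (west b) = ~~ odd_cell b.
Proof. by rewrite -{2}[b]westK odd_east negbK. Qed.

Lemma north_row b : (b.1 < m)%N -> (north b).1 = b.1.+1 :> nat.
Proof. by move=> lt; rewrite /= inordK ?ltnS. Qed.

Lemma south_row b : (south b).1 = b.1.-1 :> nat.
Proof. by rewrite /= inordK // (leq_ltn_trans (leq_pred _)). Qed.

Lemma odd_north b : (b.1 < m)%N -> odd_cell (north b) = ~~ odd_cell b.
Proof. by move=> lt; rewrite /odd_cell north_row // !addSn. Qed.

Lemma odd_south b : (0 < b.1)%N -> odd_cell (south b) = ~~ odd_cell b.
Proof.
move=> lt; rewrite /odd_cell south_row -{2}[b.1 : nat]prednK // !addSn /=.
by rewrite negbK.
Qed.

Lemma cellP b b' : b.1 = b'.1 :> nat -> b.2 = b'.2 -> b = b'.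
Proof. by case: b b' => [i j] [i' j'] /= /val_inj -> ->. Qed.

Lemma northK b : (b.1 < m)%N -> south (north b) = b.
Proof. by move=> lt; apply: cellP; rewrite ?south_row ?north_row. Qed.

Lemma southK b : (0 < b.1)%N -> north (south b) = b.
Proof.
move=> lt; have := ltn_ord b.1 => lt'.
by apply: cellP => //; rewrite north_row south_row ?prednK.
Qed.

Lemma right_side_east b : right_side b = inl (east b). Proof. by []. Qed.

Lemma top_side_north b : (b.1 < m)%N -> top_side b = bottom_side (north b).
Proof.
move=> lt; congr (inr (_, _)); apply: val_inj.
by rewrite /= north_row // /bump.
Qed.

Lemma bottom_side_south b : (0 < b.1)%N -> bottom_side b = top_side (south b).
Proof.
move=> lt; rewrite top_side_north ?southK // south_row.
by have := ltn_ord b.1; lia.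
Qed.

Lemma sea_inl b : (inl b \in sea m n c) = ~~ odd_cell b.
Proof.
rewrite inE; change (epsilon c (lift ord0 b.1, b.2) == 1%N = ~~ odd_cell b).
have e : (lift ord0 b.1 + b.2 + c = (b.1 + b.2 + c).+1)%N by rewrite /= /bump; lia.
by rewrite /epsilon [X in (X %% 2)%N]e modn2 /odd_cell /=; case: odd.
Qed.

Lemma sea_inr u : (inr u \in sea m n c) = false.
Proof. by rewrite inE. Qed.

Lemma card_sides (n_gt0 : (0 < n)%N) D b :
  #|sides b :&: D| = ((left_side b \in D) + (right_side b \in D)
                     + (bottom_side b \in D) + (top_side b \in D))%N.
Proof.
have nlr : left_side b != right_side b.
  apply/eqP => -[/(congr1 (fun x : cell => x.2))] /= e; have := ordS_neq n_gt0 b.2.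
  by rewrite -e eqxx.
have nbt : bottom_side b != top_side b.
  by apply/eqP => -[] /= e; move: e; rewrite /bump; lia.
rewrite -sum1_card (eq_bigl (fun e => (e \in sides b) && (e \in D))); last first.
  by move=> e; rewrite inE.
have -> : sides b = top_side b |: (bottom_side b |: (right_side b |: [set left_side b])).
  by apply/setP => e; rewrite !inE; do 4!case: (e == _).
rewrite big_mkcondr /= !big_setU1 ?big_set1 /=.
- by do 4!case: (_ \in D).
- by rewrite inE eq_sym.
- by rewrite !inE.
by rewrite !inE (eq_sym (top_side b)) (negbTE nbt).
Qed.

End Geometry.

(** * Domino tilings and their flows *)

Section Tilings.
Variables (m n : nat) (c : bool).
Local Notation cell := (cell m n).
Local Notation odd_cell := (@odd_cell m n c).
Implicit Types (b : cell) (D : {set edge m n}).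

Lemma in_sides_inl b b' : (inl b \in sides b') = (b == b') || (b == east b').
Proof. by rewrite !inE /bottom_side /top_side /left_side right_side_east !orbF. Qed.

Lemma in_sides_inr (u : node m n) b :
  (inr u \in sides b)
    = (u.2 == b.2) && ((u.1 == b.1 :> nat) || (u.1 == b.1.+1 :> nat)).
Proof.
case: u b => i j [i' j']; rewrite !inE /bottom_side /top_side /left_side /right_side /=.
by rewrite andbC andb_orl.
Qed.

Lemma cells_of_vertical b : [set b' | inl b \in sides b'] = [set b; west b].
Proof.
apply/setP => b'; rewrite inE in_sides_inl !inE eq_sym; congr (_ || _).
by apply/eqP/eqP => ->; rewrite ?eastK ?westK.
Qed.

Lemma cells_of_horizontal (u : node m n) : interior u ->
  [set b | inr u \in sides b] = [set (inord u.1, u.2); (inord u.1.-1, u.2)].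
Proof.
move=> /andP[u_gt0 lt_um]; apply/setP => -[i j].
rewrite inE in_sides_inr !inE !xpair_eqE -!val_eqE /= !inordK //; last by lia.
by rewrite -andb_orl andbC; congr (_ && _); [lia | rewrite eq_sym].
Qed.

Lemma interior_top b : interior ((lift ord0 b.1, b.2) : node m n) = (b.1 < m)%N.
Proof. by rewrite /interior /= /bump; lia. Qed.

Lemma interior_bottom b :
  interior ((widen_ord (leqnSn m.+1) b.1, b.2) : node m n) = (0 < b.1)%N.
Proof. by rewrite /interior /= ltn_ord andbT. Qed.

Hypothesis n_gt0 : (0 < n)%N.

Lemma west_neq b : west b != b.
Proof.
apply/eqP => e; have := ordS_neq n_gt0 b.2; case/eqP.
by rewrite -[RHS](congr1 (fun x : cell => x.2) (westK b)) /= -{1}e.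
Qed.

Lemma card_cells_of_vertical b : #|[set b' | inl b \in sides b']| = 2%N.
Proof. by rewrite cells_of_vertical cards2 eq_sym west_neq. Qed.

(** Edges on the two boundary circles lie on a single cell, so a tiling cannot cut
    them. *)
Lemma card_cells_of_horizontal (u : node m n) :
  (#|[set b | inr u \in sides b]| == 2%N) = interior u.
Proof.
have [int_u|] := boolP (interior u).
  rewrite cells_of_horizontal // cards2 xpair_eqE eqxx andbT -val_eqE /=.
  by case/andP: int_u => gt0 lt; rewrite !inordK //; lia.
rewrite negb_and -leqNgt -leqNgt => bdry; apply/negbTE.
suff : (#|[set b | inr u \in sides b]| <= 1)%N by case: #|_| => [|[]].
apply/card_le1P => -[i j]; rewrite inE in_sides_inr /= => /andP[/eqP ej ei] [i' j'].
rewrite inE in_sides_inr !inE /= xpair_eqE ej eq_sym andbC -val_eqE /=; congr (_ && _).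
have -> : (i' == i) = (i' == i :> nat) by [].
have := ltn_ord i; have := ltn_ord i'; move: ei bdry.
by move: (u.1 : nat) (i : nat) (i' : nat) => x y z; lia.
Qed.

Lemma tilingP D : reflect
  ((forall u, inr u \in D -> interior u) /\
   forall b, ((left_side b \in D) + (right_side b \in D)
                     + (bottom_side b \in D) + (top_side b \in D) = 1)%N)
  (tiling D).
Proof.
apply: (iffP andP) => [[/forall_inP De /forallP Db] | [De Db]]; split.
- by move=> u /De; rewrite card_cells_of_horizontal.
- by move=> b; rewrite -card_sides //; apply/eqP.
- apply/forall_inP => -[b _|u /De]; first by rewrite card_cells_of_vertical.
  by rewrite card_cells_of_horizontal.
- by apply/forallP => b; rewrite card_sides // Db.
Qed.

(** The state of row i between two columns is attached to the cell whose left side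
    is the edge there.  A path is present at a cell if its left side is cut in
    exactly one of the tiling and the sea.  At an odd cell it goes straight through
    the sea domino; at an even cell it leaves through the domino of D, whose cut edge
    tells the row in which it continues.  Cells without path are fixed. *)
Definition slide D b : cell :=
  if odd_cell b then (if inl b \in D then east b else b)
  else if inl b \in D then b
  else if right_side b \in D then east b
  else if top_side b \in D then east (north b) else east (south b).

(** The same paths, read from right to left. *)
Definition unslide D b : cell :=
  if odd_cell b then (if inl b \in D then west b else b)
  else if inl b \in D then b
  else if inl (west b) \in D then west b
  else if top_side (west b) \in D then north (west b) else south (west b).

Section OneTiling.
Variable D : {set edge m n}.
Hypothesis tD : tiling D.

Lemma tiling_top b : top_side b \in D -> (b.1 < m)%N.
Proof. by case/tilingP: tD => De _ /De; rewrite interior_top. Qed.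

Lemma tiling_bottom b : bottom_side b \in D -> (0 < b.1)%N.
Proof. by case/tilingP: tD => De _ /De; rewrite interior_bottom. Qed.

Lemma tiling_one b : ((left_side b \in D) + (right_side b \in D)
   + (bottom_side b \in D) + (top_side b \in D) = 1)%N.
Proof. by case/tilingP: tD. Qed.

Lemma slide_top b : ~~ odd_cell b -> top_side b \in D -> slide D b = east (north b).
Proof.
rewrite /slide => /negbTE -> tb; have := tiling_one b; rewrite tb /left_side.
by do 3!case: (_ \in D).
Qed.

Lemma slide_bottom b : ~~ odd_cell b -> bottom_side b \in D -> slide D b = east (south b).
Proof.
rewrite /slide => /negbTE -> bb; have := tiling_one b; rewrite bb /left_side.
by do 3!case: (_ \in D).
Qed.

Lemma slide_right b : ~~ odd_cell b -> right_side b \in D -> slide D b = east b.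
Proof.
rewrite /slide => /negbTE -> rb; have := tiling_one b; rewrite rb /left_side.
by do 3!case: (_ \in D).
Qed.

Lemma unslideK : cancel (unslide D) (slide D).
Proof.
move=> b; rewrite /unslide.
have [ob|eb] := boolP (odd_cell b).
  have [lb|nlb] := boolP (inl b \in D); last by rewrite /slide ob (negbTE nlb).
  by rewrite slide_right ?odd_west ?ob ?right_side_east ?westK.
have ow : odd_cell (west b) by rewrite odd_west.
have [lb|nlb] := boolP (inl b \in D); first by rewrite /slide (negbTE eb) lb.
have [lw|nlw] := boolP (inl (west b) \in D); first by rewrite /slide ow lw westK.
have [tw|ntw] := boolP (top_side (west b) \in D).
  have lt := tiling_top tw.
  by rewrite slide_bottom ?northK ?westK ?odd_north ?ow // -top_side_north.
have bw : bottom_side (west b) \in D.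
  have := tiling_one (west b); rewrite right_side_east westK /left_side.
  by rewrite (negbTE nlb) (negbTE nlw) (negbTE ntw); case: (_ \in D).
have gt := tiling_bottom bw.
by rewrite slide_top ?southK ?westK ?odd_south ?ow // -bottom_side_south.
Qed.

Lemma slide_inj : injective (slide D).
Proof. exact: can_inj (canF_sym unslideK). Qed.

End OneTiling.

(** The permutation [slide], which is injective when D is a tiling. *)
Definition flow D : {perm cell} :=
  if injectiveP (slide D) is ReflectT inj_s then perm inj_s else 1%g.

Lemma flowE D b : tiling D -> flow D b = slide D b.
Proof.
move=> /slide_inj inj_s; rewrite /flow.
by case: injectiveP => [inj_s'|/(_ inj_s)//]; rewrite permE.
Qed.

(** The steps that a flow can make: the nonzero entries of the matrix whose
    determinant is computed below. *)
Definition admissible b b' : bool :=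
  [|| b' == b, b' == east b | ~~ odd_cell b &&
     ((b.1 < m)%N && (b' == east (north b)) || (0 < b.1)%N && (b' == east (south b)))].

(** The inverse of [flow]: a vertical edge is cut when a path is present there and
    the sea does not cut it, or conversely; a horizontal edge is cut when a path
    crosses between the two rows that it separates. *)
Definition cuts (s : cell -> cell) : {set edge m n} :=
  [set e : edge m n | match e with
   | inl b => (s b == b) (+) odd_cell b
   | inr u => interior u &&
      ((s (inord u.1.-1, u.2) == east (inord u.1, u.2))
       || (s (inord u.1, u.2) == east (inord u.1.-1, u.2)))
   end].

End Tilings.

(** * Tilings correspond to admissible permutations *)

Section FlowBijection.
Variables (m n : nat) (c : bool).
Local Notation cell := (cell m n).
Local Notation odd_cell := (@odd_cell m n c).
Local Notation admissible := (@admissible m n c).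
Local Notation flow := (@flow m n c).
Local Notation slide := (@slide m n c).
Local Notation cuts := (@cuts m n c).
Implicit Types (b : cell) (D : {set edge m n}).

Lemma east_eq b b' : (east b == east b') = (b == b').
Proof. exact: inj_eq (can_inj (@eastK m n)) _ _. Qed.

Lemma north_neq b : (b.1 < m)%N -> (north b == b) = false.
Proof.
move=> lt; apply/eqP => /(congr1 (fun x : cell => x.1 : nat)).
by rewrite north_row //; lia.
Qed.

Lemma south_neq b : (0 < b.1)%N -> (south b == b) = false.
Proof.
move=> lt; apply/eqP => /(congr1 (fun x : cell => x.1 : nat)).
by rewrite south_row; lia.
Qed.

Lemma north_south_neq b : (b.1 < m)%N -> (0 < b.1)%N -> (north b == south b) = false.
Proof.
move=> lt gt; apply/eqP => /(congr1 (fun x : cell => x.1 : nat)).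
by rewrite north_row // south_row; lia.
Qed.

Hypothesis n_gt0 : (0 < n)%N.

Lemma east_same_col b b' : b.2 = b'.2 -> (east b == b') = false.
Proof.
move=> ec; apply/eqP => e; have := ordS_neq n_gt0 b.2.
by rewrite [X in _ != X]ec -e eqxx.
Qed.

Lemma slide_admissible D b : tiling D -> admissible b (slide D b).
Proof.
move=> tD; rewrite /slide /admissible.
have [ob|eb] := boolP (odd_cell b); first by case: ifP; rewrite eqxx ?orbT.
case: ifP => lb; first by rewrite eqxx.
case: ifP => rb; first by rewrite eqxx orbT.
case: ifP => tb; first by rewrite (tiling_top n_gt0 tD tb) eqxx !orbT.
have bb : bottom_side b \in D.
  have := tiling_one n_gt0 tD b; rewrite tb rb [left_side b \in D]lb.
  by case: (_ \in D).
by rewrite (tiling_bottom n_gt0 tD bb) eqxx !orbT.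
Qed.

Lemma in_cuts_left s b : (left_side b \in cuts s) = (s b == b) (+) odd_cell b.
Proof. by rewrite inE. Qed.

Lemma in_cuts_right s b :
  (right_side b \in cuts s) = (s (east b) == east b) (+) ~~ odd_cell b.
Proof. by rewrite right_side_east inE odd_east. Qed.

Lemma in_cuts_top s b : (top_side b \in cuts s)
  = (b.1 < m)%N && ((s b == east (north b)) || (s (north b) == east b)).
Proof.
rewrite /top_side inE interior_top //; congr (_ && _).
have -> : (inord (lift ord0 b.1).-1, b.2) = b.
  by apply: cellP => //; rewrite /= inordK ?add0n.
by [].
Qed.

Lemma in_cuts_bottom s b : (bottom_side b \in cuts s)
  = (0 < b.1)%N && ((s (south b) == east b) || (s b == east (south b))).
Proof.
have [gt|le] := ltnP 0 b.1; last first.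
  by rewrite /bottom_side inE interior_bottom ltnNge le.
rewrite bottom_side_south // in_cuts_top southK // south_row.
by have -> : (b.1.-1 < m)%N by have := ltn_ord b.1; lia.
Qed.

Section AdmissiblePerm.
Variable s : {perm cell}.
Hypothesis adm_s : forall b, admissible b (s b).

Lemma odd_straight b : odd_cell b -> s b = b \/ s b = east b.
Proof.
move=> ob; have := adm_s b; rewrite /admissible ob /= orbF.
by case/orP => /eqP ->; [left | right].
Qed.

Lemma odd_not_across b b' : odd_cell b -> b'.2 = b.2 -> b' != b -> (s b == east b') = false.
Proof.
move=> ob ec nb; case: (odd_straight ob) => ->; last by rewrite east_eq eq_sym (negbTE nb).
by rewrite eq_sym east_same_col.
Qed.

Lemma cuts_top_even b : ~~ odd_cell b ->
  (top_side b \in cuts s) = (b.1 < m)%N && (s b == east (north b)).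
Proof.
move=> eb; rewrite in_cuts_top; case: ltnP => //= lt.
by rewrite (@odd_not_across (north b) b) ?orbF ?odd_north // eq_sym north_neq.
Qed.

Lemma cuts_bottom_even b : ~~ odd_cell b ->
  (bottom_side b \in cuts s) = (0 < b.1)%N && (s b == east (south b)).
Proof.
move=> eb; rewrite in_cuts_bottom; case: ltnP => //= lt.
by rewrite (@odd_not_across (south b) b) ?orbF ?odd_south // eq_sym south_neq.
Qed.

Lemma cuts_top_odd b : odd_cell b ->
  (top_side b \in cuts s) = (b.1 < m)%N && (s (north b) == east b).
Proof.
move=> ob; rewrite in_cuts_top; case: ltnP => //= lt.
by rewrite (@odd_not_across b (north b)) ?north_neq.
Qed.

Lemma cuts_bottom_odd b : odd_cell b ->
  (bottom_side b \in cuts s) = (0 < b.1)%N && (s (south b) == east b).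
Proof.
move=> ob; rewrite in_cuts_bottom; case: ltnP => //= lt.
by rewrite (@odd_not_across b (south b)) ?orbF ?south_neq.
Qed.

(** Where the point that arrives at the cell to the right of b comes from. *)
Lemma source_of_east b : [|| s (east b) == east b, s b == east b | odd_cell b &&
   ((b.1 < m)%N && (s (north b) == east b) || (0 < b.1)%N && (s (south b) == east b))].
Proof.
have [q sq] : exists q : cell, s q = east b by exists ((s^-1)%g (east b)); rewrite permKV.
have := adm_s q; rewrite sq /admissible => /or3P[/eqP eq_q|/eqP eq_q|].
- by have -> : s (east b) = east b by [rewrite {1}eq_q]; rewrite eqxx.
- have eq_b : b = q by apply: can_inj (@eastK m n) _ _ eq_q.
  by have -> : s b = east b by [rewrite {1}eq_b]; rewrite eqxx orbT.
case/andP => eq /orP[] /andP[lt]; rewrite east_eq => /eqP eb.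
  have sq' : s q = east (north q) by rewrite sq {1}eb.
  by rewrite eb odd_north // eq northK // sq' eqxx north_row // !orbT.
have sq' : s q = east (south q) by rewrite sq {1}eb.
rewrite eb odd_south // eq southK // sq' eqxx south_row.
by have -> : (q.1.-1 < m)%N by [have := ltn_ord q.1; lia]; rewrite !orbT.
Qed.

Lemma cuts_right_even b : ~~ odd_cell b ->
  (right_side b \in cuts s) = (s b == east b).
Proof.
move=> eb; rewrite in_cuts_right eb addbT; apply/idP/eqP => [ne|eb'].
  by have := source_of_east b; rewrite (negbTE ne) (negbTE eb) orbF => /eqP.
by rewrite -{2}eb' (inj_eq perm_inj) east_same_col.
Qed.

Lemma cuts_right_odd b : odd_cell b ->
  (right_side b \in cuts s) = (s (east b) == east b).
Proof. by move=> ob; rewrite in_cuts_right ob addbF. Qed.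

(** The four sides of an even cell are cut according to the image of the cell under
    s, those of an odd cell according to the preimage of its right neighbour; either
    way exactly one of four possibilities occurs. *)
Lemma tiling_cuts : tiling (cuts s).
Proof.
apply/tilingP => //; split=> [u|b]; first by rewrite inE => /andP[].
rewrite in_cuts_left; have [ob|eb] := boolP (odd_cell b).
  have -> : (s b == b) (+) true = (s b == east b).
    by case: (odd_straight ob) => ->; rewrite ?eqxx ?east_same_col // eq_sym east_same_col.
  rewrite cuts_right_odd // cuts_top_odd // cuts_bottom_odd //.
  have neq x y : x != y -> s x = east b -> (s y == east b) = false.
    by move=> nxy <-; rewrite (inj_eq perm_inj) eq_sym (negbTE nxy).
  have nB : east b != b by rewrite east_same_col.
  have nN : east b != north b by rewrite east_same_col.
  have nS : east b != south b by rewrite east_same_col.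
  case/or3P: (source_of_east b) => [/eqP e|/eqP e|].
  - by rewrite e eqxx !(neq _ b nB e) (neq _ _ nN e) (neq _ _ nS e) !andbF.
  - rewrite e eqxx; rewrite eq_sym in nB; rewrite (neq _ _ nB e).
    have -> : (0 < b.1)%N && (s (south b) == east b) = false.
      by case: ltnP => //= gt; rewrite (neq _ _ _ e) // eq_sym south_neq.
    have -> // : (b.1 < m)%N && (s (north b) == east b) = false.
    by case: ltnP => //= lt; rewrite (neq _ _ _ e) // eq_sym north_neq.
  case/andP => _ /orP[] /andP[lt /eqP e]; rewrite lt e eqxx /=.
    rewrite eq_sym in nN; rewrite (neq _ b _ e) ?north_neq // (neq _ _ nN e).
    have -> // : (0 < b.1)%N && (s (south b) == east b) = false.
    by case: ltnP => //= gt; rewrite (neq _ _ _ e) // north_south_neq.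
  rewrite eq_sym in nS; rewrite (neq _ b _ e) ?south_neq // (neq _ _ nS e).
  have -> // : (b.1 < m)%N && (s (north b) == east b) = false.
  by case: ltnP => //= gt; rewrite (neq _ _ _ e) // eq_sym north_south_neq.
rewrite addbF cuts_right_even // cuts_top_even // cuts_bottom_even //.
have nB x : x.2 = b.2 -> (b == east x) = false.
  by move=> ec; rewrite eq_sym east_same_col.
have := adm_s b; rewrite /admissible eb /= => /or3P[/eqP ->|/eqP ->|].
- by rewrite eqxx !nB // !andbF.
- rewrite !east_eq eqxx east_same_col //.
  have -> : (0 < b.1)%N && (b == south b) = false.
    by case: ltnP => //= gt; rewrite eq_sym south_neq.
  have -> // : (b.1 < m)%N && (b == north b) = false.
  by case: ltnP => //= lt; rewrite eq_sym north_neq.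
case/orP=> /andP[lt /eqP ->]; rewrite lt !east_eq eqxx /= east_same_col //.
  rewrite north_neq //; have -> // : (0 < b.1)%N && (north b == south b) = false.
  by case: ltnP => //= gt; rewrite north_south_neq.
rewrite south_neq //; have -> // : (b.1 < m)%N && (south b == north b) = false.
by case: ltnP => //= gt; rewrite eq_sym north_south_neq.
Qed.

Lemma slide_cuts b : slide (cuts s) b = s b.
Proof.
rewrite /slide; have := in_cuts_left s b; rewrite /left_side => ->.
have [ob|eb] := boolP (odd_cell b).
  by case: (odd_straight ob) => ->; rewrite ?eqxx ?east_same_col.
rewrite addbF cuts_right_even // cuts_top_even //.
case: eqP => [-> //|n1]; case: eqP => [-> //|n2].
have := adm_s b; rewrite /admissible; do 2!case: eqP => //= _.
by rewrite eb /= => /orP[] /andP[lt /eqP ->]; rewrite ?lt ?eqxx //=;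
  case: ifP => // /andP[_ /eqP].
Qed.

End AdmissiblePerm.

Lemma flow_admissible D b : tiling D -> admissible b (flow D b).
Proof. by move=> tD; rewrite flowE //; apply: slide_admissible. Qed.

Lemma cuts_flow D : tiling D -> cuts (flow D) = D.
Proof.
move=> tD; have adm b : admissible b (flow D b) by apply: flow_admissible.
have left b : (left_side b \in cuts (flow D)) = (left_side b \in D).
  rewrite in_cuts_left flowE // /slide.
  have [ob|eb] := boolP (odd_cell b).
    by case: ifP => lb; rewrite ?eqxx ?east_same_col ?[left_side b \in D]lb.
  case: ifP => lb; first by rewrite eqxx ?[left_side b \in D]lb.
  by rewrite ?[left_side b \in D]lb; do 2?case: ifP => _; rewrite east_same_col.
have top b : (top_side b \in cuts (flow D)) = (top_side b \in D).
  have [lt|ge] := ltnP b.1 m; last first.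
    rewrite in_cuts_top ltnNge ge /=; apply/esym/negP => /(tiling_top n_gt0 tD).
    by rewrite ltnNge ge.
  have [ob|eb] := boolP (odd_cell b).
    rewrite cuts_top_odd // lt /= flowE //.
    have eN : ~~ odd_cell (north b) by rewrite odd_north ?ob.
    have tb := top_side_north lt.
    apply/eqP/idP => [|tbD]; last by rewrite slide_bottom ?northK -?tb.
    rewrite tb; have := tiling_one n_gt0 tD (north b).
    rewrite /slide (negbTE eN) /left_side; case: ifP => lb.
      by move=> _ /eqP; rewrite eq_sym east_same_col.
    case: ifP => rb; first by move=> _ /eqP; rewrite east_eq north_neq.
    case: ifP => tb'; last by case: (_ \in D).
    move=> _ /eqP; rewrite east_eq => /eqP/(congr1 (fun x : cell => x.1 : nat)).
    by rewrite (north_row (tiling_top n_gt0 tD tb')) (north_row lt); lia.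
  rewrite cuts_top_even // lt /= flowE //; apply/eqP/idP => [|tbD]; last exact: slide_top.
  rewrite /slide (negbTE eb); case: ifP => lb.
    by move/eqP; rewrite eq_sym east_same_col.
  case: ifP => rb; first by move/eqP; rewrite east_eq eq_sym north_neq.
  case: ifP => // tb' /eqP; rewrite east_eq => /eqP eNS.
  have := tiling_one n_gt0 tD b; rewrite tb' rb [left_side b \in D]lb.
  case bb: (bottom_side b \in D) => // _; have gt := tiling_bottom n_gt0 tD bb.
  by have := north_south_neq lt gt; rewrite -eNS eqxx.
apply/setP => -[b|u]; first exact: left.
have [int_u|nint] := boolP (interior u); last first.
  rewrite inE (negbTE nint); apply/esym/negP => /(proj1 (tilingP n_gt0 _ tD)).
  by rewrite (negbTE nint).
have -> : inr u = top_side (inord u.1.-1, u.2) :> edge m n.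
  case: u int_u => i j /andP[/= gt lt]; congr (inr (_, _)); apply: val_inj.
  by rewrite /= inordK /bump; lia.
exact: top.
Qed.

End FlowBijection.

(** * Paths of the flow and non-contractible cycles *)

Section Components.
Variables (m n : nat) (c : bool).
Hypothesis n_gt0 : (0 < n)%N.
Local Notation cell := (cell m n).
Local Notation odd_cell := (@odd_cell m n c).
Local Notation sea := (sea m n c).
Implicit Types (b : cell) (D : {set edge m n}).

Lemma tiling_sea : tiling sea.
Proof.
apply/tilingP => //; split=> [u|b]; first by rewrite sea_inr.
rewrite !sea_inr /left_side right_side_east !sea_inl odd_east negbK.
by case: odd_cell.
Qed.

Lemma joined_sym D b b' : joined D b b' = joined D b' b.
Proof.
by apply: eq_existsb => e; rewrite [b == b']eq_sym [(e \in sides b) && _]andbCA.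
Qed.

Lemma joinedP D b b' : reflect
  (exists e, [/\ e \in D, e \in sides b, e \in sides b' & b != b']) (joined D b b').
Proof.
apply: (iffP existsP) => -[e]; first by case/and4P; exists e.
by case=> *; exists e; apply/and4P.
Qed.

Lemma joined_cases D b b' : tiling D -> joined D b b' ->
  (exists x : cell, inl x \in D /\ [set b; b'] = [set x; west x]) \/
  (exists x : cell, [/\ (x.1 < m)%N, top_side x \in D & [set b; b'] = [set x; north x]]).
Proof.
move=> tD /joinedP[e [De be b'e nbb']].
have two : [set x | e \in sides x] = [set b; b'].
  have bin x : e \in sides x -> x \in [set x | e \in sides x] by move=> xe; rewrite in_set.
  apply/esym/eqP; rewrite eqEcard cards2 nbb' subUset !sub1set (bin b be) (bin b' b'e) /=.
  by case/andP: tD => /forall_inP/(_ e De)/eqP ->.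
case: e => [x|u] in De two {be b'e}; [left; exists x | right].
  by rewrite -two cells_of_vertical.
have int_u : interior u by case/tilingP: tD => // H _; apply: H.
case/andP: (int_u) => gt lt.
exists (inord u.1.-1, u.2); have tu : top_side (inord u.1.-1, u.2) = inr u :> edge m n.
  case: u gt lt {De two int_u} => i j /= gt lt; congr (inr (_, _)); apply: val_inj.
  by rewrite /= inordK /bump; lia.
rewrite tu De -two cells_of_horizontal //; split=> //.
  by rewrite /= inordK; lia.
rewrite setUC; congr [set _; _]; apply: cellP => //.
by rewrite /north /= !inordK //; lia.
Qed.

Lemma joined_parity D b b' : tiling D -> joined D b b' -> odd_cell b' = ~~ odd_cell b.
Proof.
move=> tD jbb'; have nbb' : b != b' by case/joinedP: jbb' => e [].
have : [set b; b'] = [set b'; b] by rewrite setUC.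
case: (joined_cases tD jbb') => -[x]; [case=> _ | case=> lt _] => exx _.
  have : b \in [set x; west x] by rewrite -exx !inE eqxx.
  have : b' \in [set x; west x] by rewrite -exx !inE eqxx orbT.
  rewrite !inE => /orP[]/eqP eb' /orP[]/eqP eb; move: nbb'; rewrite eb eb' ?eqxx //;
  by rewrite odd_west ?negbK.
have : b \in [set x; north x] by rewrite -exx !inE eqxx.
have : b' \in [set x; north x] by rewrite -exx !inE eqxx orbT.
rewrite !inE => /orP[]/eqP eb' /orP[]/eqP eb; move: nbb'; rewrite eb eb' ?eqxx //;
by rewrite odd_north ?negbK.
Qed.

Lemma joined_mate D b : tiling D -> joined D b (mate D b).
Proof.
move=> tD; rewrite /mate; case: pickP => //= none.
case/andP: tD => /forall_inP De /forallP/(_ b) /cards1P[e be].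
have : e \in sides b :&: D by rewrite be set11.
rewrite inE => /andP[eb eD]; have /cards2P[x [y [nxy exy]]] := De e eD.
have : b \in [set x | e \in sides x] by rewrite inE.
rewrite exy !inE => bxy.
have xe : e \in sides x by have : x \in [set x; y] by [rewrite !inE eqxx]; rewrite -exy inE.
have ye : e \in sides y by have : y \in [set x; y] by [rewrite !inE eqxx orbT]; rewrite -exy inE.
case/orP: bxy => /eqP bxy.
  by have /negbT/negP[] := none y; apply/joinedP; exists e; rewrite bxy in eb *.
by have /negbT/negP[] := none x; apply/joinedP; exists e; rewrite bxy in eb *; rewrite eq_sym.
Qed.

Lemma joined_uniq D b b1 b2 : tiling D -> joined D b b1 -> joined D b b2 -> b1 = b2.
Proof.
move=> tD /joinedP[e1 [e1D be1 b1e1 n1]] /joinedP[e2 [e2D be2 b2e2 n2]].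
case/andP: tD => /forall_inP De /forallP/(_ b) /cards1P[e be].
have e1e : e1 \in sides b :&: D by rewrite inE be1.
have e2e : e2 \in sides b :&: D by rewrite inE be2.
rewrite be !inE in e1e e2e; rewrite (eqP e1e) in e1D be1 b1e1; rewrite (eqP e2e) in b2e2.
have /cards2P[x [y [nxy exy]]] := De e e1D.
have inxy z : e \in sides z -> (z == x) || (z == y).
  by move=> ze; have : z \in [set x | e \in sides x] by [rewrite inE]; rewrite exy !inE.
move: (inxy _ be1) (inxy _ b1e1) (inxy _ b2e2).
move=> /orP[]/eqP eb /orP[]/eqP eb1 /orP[]/eqP eb2; move: n1 n2;
by rewrite eb eb1 eb2 ?eqxx.
Qed.

Lemma mate_eq D b b' : tiling D -> joined D b b' -> mate D b = b'.
Proof. by move=> tD; apply: joined_uniq tD (joined_mate b tD). Qed.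

Lemma joined_vertical D b : inl b \in D -> joined D b (west b).
Proof.
move=> bD; apply/joinedP; exists (inl b).
by rewrite !in_sides_inl westK !eqxx orbT [b == west b]eq_sym west_neq.
Qed.

Lemma joined_top D b : tiling D -> top_side b \in D -> joined D b (north b).
Proof.
move=> tD bD; have lt := tiling_top n_gt0 tD bD.
apply/joinedP; exists (top_side b); rewrite bD eq_sym north_neq //; split=> //.
  by rewrite /sides !inE eqxx !orbT.
by rewrite top_side_north // /sides !inE eqxx !orbT.
Qed.

Lemma odd_mate D b : tiling D -> odd_cell (mate D b) = ~~ odd_cell b.
Proof. by move=> tD; apply: joined_parity tD (joined_mate b tD). Qed.

Lemma joined_sea b : odd_cell b -> joined sea b (east b).
Proof.
move=> ob; rewrite joined_sym -{2}[b]eastK; apply: joined_vertical.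
by rewrite sea_inl odd_east ob.
Qed.

Lemma mate_sea_odd b : odd_cell b -> mate sea b = east b.
Proof. by move=> ob; apply: mate_eq tiling_sea (joined_sea ob). Qed.

Lemma mate_sea_even b : ~~ odd_cell b -> mate sea b = west b.
Proof. by move=> eb; apply: mate_eq tiling_sea (joined_vertical _); rewrite sea_inl. Qed.

Section OneTiling.
Variable D : {set edge m n}.
Hypothesis tD : tiling D.
Local Notation s := (flow c D).

Lemma flow_col b : s b != b -> (s b).2 = ordS b.2.
Proof.
have := flow_admissible c n_gt0 b tD; rewrite /admissible => /or3P[->//|/eqP -> //|].
by case/andP => _ /orP[]/andP[_ /eqP ->].
Qed.

Lemma flow_mono_arith (x y p q : nat) (ox oy : bool) : (x < y)%N -> p != q ->
  [\/ p = x, ~~ ox /\ p = x.+1 | [/\ ~~ ox, (0 < x)%N & p = x.-1]] ->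
  [\/ q = y, ~~ oy /\ q = y.+1 | [/\ ~~ oy, (0 < y)%N & q = y.-1]] ->
  (y = x.+1 -> oy = ~~ ox) -> (p < q)%N.
Proof.
move=> lt ne ra rb adj; have [/adj eo|ney] := eqVneq y x.+1.
  by case: ra => [ra|[ex ra]|[_ gt ra]]; case: rb => [rb|[ey rb]|[ey gt' rb]]; lia.
by case: ra => [ra|[ex ra]|[_ gt ra]]; case: rb => [rb|[ey rb]|[ey gt' rb]]; lia.
Qed.

(** Paths do not cross.  They change rows by at most one, and two adjacent rows of a
    column have opposite colours, so that one of the two paths goes straight. *)
Lemma flow_mono a b : s a != a -> s b != b -> a.2 = b.2 ->
  (a.1 < b.1)%N -> ((s a).1 < (s b).1)%N.
Proof.
have rows x : s x != x -> [\/ ((s x).1 = x.1 :> nat),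
    ~~ odd_cell x /\ ((s x).1 = x.1.+1 :> nat) |
    [/\ ~~ odd_cell x, (0 < x.1)%N & ((s x).1 = x.1.-1 :> nat)]].
  have := flow_admissible c n_gt0 x tD; rewrite /admissible => /or3P[->//|/eqP -> _|].
    by constructor 1.
  case/andP=> ex /orP[] /andP[lt /eqP ->] _; [constructor 2 | constructor 3].
    by rewrite /east north_row.
  by rewrite /east south_row.
move=> ma mb ec lt.
have ne : (s a).1 != (s b).1 :> nat.
  apply/eqP => er; have := perm_inj (cellP er _); rewrite !flow_col // ec.
  by move=> /(_ erefl) eab; move: lt; rewrite eab ltnn.
have adj : (b.1 = a.1.+1 :> nat) -> odd_cell b = ~~ odd_cell a.
  by move=> er; rewrite /odd_cell er ec !addSn.
exact: (flow_mono_arith lt ne (rows a ma) (rows b mb) adj).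
Qed.

Let N_gt1 : (1 < 2 * n)%N. Proof. by lia. Qed.

Lemma moved_odd b : odd_cell b -> (s b != b) = (inl b \in D).
Proof.
by move=> ob; rewrite flowE // /slide ob; case: ifP; rewrite ?eqxx ?east_same_col.
Qed.

Lemma moved_even b : ~~ odd_cell b -> (s b != b) = (inl b \notin D).
Proof.
move=> eb; rewrite flowE // /slide (negbTE eb); case: ifP; rewrite ?eqxx //.
by do 2?case: ifP => _; rewrite east_same_col.
Qed.

Let super b b' := joined D b b' || joined sea b b'.

Let super_sym : connect_sym super.
Proof. by apply: sym_connect_sym => b b'; rewrite /super !(joined_sym _ b). Qed.

(** The even cell of the sea domino that covers b. *)
Definition evened b : cell := if odd_cell b then east b else b.
(** The path through a cell, which is constant on the cycles of the superposition
    with the sea ([strand_connect]). *)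
Definition strand b : {set cell} := porbit s (evened b).

Lemma porbit_flow b : porbit s (s b) = porbit s b.
Proof. by apply/eqP; rewrite eq_porbit_mem; have := mem_porbit s 1 b; rewrite expg1. Qed.

Lemma strand_west x : inl x \in D \/ ~~ odd_cell x -> strand (west x) = strand x.
Proof.
rewrite /strand /evened odd_west; have [ox|ex] := boolP (odd_cell x); last by rewrite westK.
case=> // xD; rewrite -porbit_flow -[in RHS]porbit_flow.
have -> : s (west x) = x.
  by rewrite flowE // slide_right ?odd_west ?ox ?right_side_east ?westK.
have <- : s x = east x by rewrite flowE // /slide ox xD.
by rewrite !porbit_flow.
Qed.

Lemma strand_north x : top_side x \in D -> strand (north x) = strand x.
Proof.
move=> xD; have lt := tiling_top n_gt0 tD xD.
rewrite /strand /evened odd_north //; have [ox|ex] := boolP (odd_cell x).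
  rewrite -porbit_flow flowE // slide_bottom ?odd_north ?ox ?northK //.
  by rewrite -top_side_north.
by rewrite -[RHS]porbit_flow flowE // slide_top.
Qed.

Lemma strand_connect b b' : connect super b b' -> strand b = strand b'.
Proof.
have step E x b1 b2 : [set b1; b2] = [set x; E] -> strand E = strand x ->
    strand b1 = strand b2.
  move=> e12 eE; have : b1 \in [set x; E] by rewrite -e12 !inE eqxx.
  have : b2 \in [set x; E] by rewrite -e12 !inE eqxx orbT.
  by rewrite !inE => /orP[]/eqP -> /orP[]/eqP ->; rewrite ?eE.
case/connectP => p; elim: p b => [|x p IH] b /=; first by move=> _ ->.
case/andP => bx /IH{}IH /IH <-; case/orP: bx => [/(joined_cases tD)|/(joined_cases tiling_sea)].
  case=> -[y] [] => [yD|lt yD] exy.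
    by apply: step exy _; apply: strand_west; left.
  by apply: step exy _; apply: strand_north.
case=> -[y] [] => [|_]; last by rewrite sea_inr.
rewrite sea_inl => yD exy.
by apply: step exy _; apply: strand_west; right.
Qed.

Lemma connect_flow b : connect super b (s b).
Proof.
have sea_step x : odd_cell x -> connect super x (east x).
  by move=> ox; apply: connect1; rewrite /super joined_sea ?orbT.
rewrite flowE // /slide; have [ob|eb] := boolP (odd_cell b).
  by case: ifP => // _; apply: sea_step.
have D_step x y : joined D x y -> connect super x y.
  by move=> xy; apply: connect1; rewrite /super xy.
case: ifP => // lb; case: ifP => rb.
  by apply: D_step; rewrite joined_sym -{2}[b]eastK joined_vertical.
case: ifP => tb.
  apply: connect_trans (D_step _ _ (joined_top tD tb)) _.
  by apply: sea_step; rewrite odd_north // (tiling_top n_gt0 tD tb).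
have bb : bottom_side b \in D.
  have := tiling_one n_gt0 tD b; rewrite tb rb [left_side b \in D]lb.
  by case: (_ \in D).
have gt := tiling_bottom n_gt0 tD bb.
apply: (@connect_trans _ _ (south b)); last by apply: sea_step; rewrite odd_south.
apply: D_step; rewrite joined_sym -{2}[b](southK gt); apply: joined_top => //.
by rewrite -bottom_side_south.
Qed.

Lemma connect_porbit b b' : b' \in porbit s b -> connect super b b'.
Proof.
case/porbitP => k ->; elim: k => [|k IH]; first by rewrite expg0 perm1 connect0.
by rewrite expgSr permM; apply: connect_trans IH (connect_flow _).
Qed.

Lemma evened_connect b : connect super b (evened b).
Proof.
rewrite /evened; case: ifP => [ob|_]; last exact: connect0.
by apply: connect1; rewrite /super joined_sea ?orbT.
Qed.

Lemma evened_even b : ~~ odd_cell (evened b).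
Proof. by rewrite /evened; case: ifP => [ob|->//]; rewrite odd_east ob. Qed.

Lemma strand_moved b : s b != b -> strand b = porbit s b.
Proof.
rewrite /strand /evened; case: ifP => // ob; rewrite moved_odd // => bD.
by rewrite -[RHS]porbit_flow; congr (porbit s _); rewrite flowE // /slide ob bD.
Qed.

Lemma evened_moved b : s b != b -> s (evened b) != evened b.
Proof.
move=> mb; rewrite /evened; case: ifP => // ob.
have <- : s b = east b.
  by move: mb; rewrite moved_odd // flowE // /slide ob => ->.
by rewrite (inj_eq perm_inj).
Qed.

(** The cycle is then a domino common to the tiling and the sea, traversed back and
    forth. *)
Lemma displacement_fixed b : s (evened b) = evened b -> displacement c D b = 0.
Proof.
move=> fixb; have eb := evened_even b.
have bD : inl (evened b) \in D.
  by have := moved_even eb; rewrite fixb eqxx => /esym/negbFE.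
have one x : (left_side x \in D) -> (right_side x \in D) = false.
  by move=> lx; have := tiling_one n_gt0 tD x; rewrite lx; case: (_ \in D).
have one' x : (right_side x \in D) -> (left_side x \in D) = false.
  by move=> lx; have := tiling_one n_gt0 tD x; rewrite lx; case: (_ \in D).
have [mm zero] : mate D (mate sea b) = b /\ shift sea b + shift D (mate sea b) = 0.
  rewrite /shift /left_side !right_side_east !sea_inl ?odd_east ?negbK.
  move: bD; rewrite /evened; case: ifP => ob bD.
    rewrite mate_sea_odd // -right_side_east one // bD; split=> //.
    by rewrite (mate_eq tD (joined_vertical bD)) eastK.
  have eb' : ~~ odd_cell b by rewrite ob.
  rewrite mate_sea_even // westK bD; split.
    by apply: mate_eq => //; rewrite joined_sym joined_vertical.
  by rewrite [inl (west b) \in D](one' (west b)) // right_side_east westK.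
rewrite /displacement big1_seq // => x /andP[_].
rewrite -fconnect_orbit => /connectP[p pth ->].
suff -> : last b p = b by [].
elim: p pth => //= x' p IH /andP[/eqP <- pth]; rewrite /= mm in pth *; exact: IH.
Qed.

(** Starting from an odd cell, the sea dominoes are always traversed to the right
    and the dominoes of D go left by at most one, so the displacement is a sum of
    nonnegative terms; the term of the moved cell is positive. *)
Lemma displacement_moved x : ~~ odd_cell x -> s x != x -> displacement c D (west x) != 0.
Proof.
move=> ex mx; have ow : odd_cell (west x) by rewrite odd_west.
have odd_orb b : b \in fingraph.orbit (mate D \o mate sea) (west x) -> odd_cell b.
  rewrite -fconnect_orbit => /connectP[p pth ->].
  elim: p (west x) ow pth => //= y p IH z oz /andP[/eqP <- pth]; apply: IH pth.
  by rewrite /= !odd_mate ?tiling_sea // oz.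
have term b : odd_cell b -> shift sea b + shift D (mate sea b)
    = 1 + ((right_side (east b) \in D)%:Z - (inl (east b) \in D)%:Z).
  move=> ob; rewrite mate_sea_odd // /shift /left_side !right_side_east !sea_inl //.
  by rewrite odd_east ob.
rewrite /displacement big_seq.
rewrite (eq_bigr (fun b => 1 + ((right_side (east b) \in D)%:Z - (inl (east b) \in D)%:Z))); last first.
  by move=> b /odd_orb/term.
rewrite -big_seq.
have win : west x \in fingraph.orbit (mate D \o mate sea) (west x) by rewrite -fconnect_orbit connect0.
rewrite (big_rem _ win) /= westK.
have -> : inl x \in D = false by apply/negbTE; rewrite -moved_even.
set S := \sum_(_ <- _) _; have : 0 <= S.
  apply: Num.Theory.sumr_ge0 => b _; by do 2!case: (_ \in D).
by case: (_ \in D); lia.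
Qed.

(** A non-contractible cycle contains a moved cell, hence the whole path of that
    cell, and this path meets column j exactly once. *)
Lemma nb_noncontractible_moved (j : 'I_(2 * n)) :
  nb_noncontractible c D = #|moved_in (fun b : cell => b.2) s j|.
Proof.
pose comp b := [set b' | connect super b b'].
have compP b b' : connect super b b' -> comp b = comp b'.
  by move=> bb'; apply/setP => x; rewrite !inE; apply: same_connect.
rewrite -(card_in_imset (f := comp) (D := mem (moved_in (fun b : cell => b.2) s j))).
  rewrite /nb_noncontractible; apply: eq_card => A; rewrite inE.
  apply/andP/imsetP => [[/imsetP[b0 _ ->]] | [b]].
    case/exists_inP => b; rewrite inE => b0b disp.
    have me : s (evened b) != evened b by apply: contraNneq disp => /displacement_fixed ->.
    have [b' b'in cb'] := porbit_meets_col flow_col j me.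
    exists b'; first by rewrite inE (porbit_moved me b'in) cb' eqxx.
    apply: compP; apply: connect_trans b0b _; apply: connect_trans (evened_connect b) _.
    exact: connect_porbit.
  rewrite inE => /andP[mb _] ->; split; first by apply/imsetP; exists b.
  apply/exists_inP; exists (west (evened b)).
    rewrite inE; apply: connect_trans (evened_connect b) _.
    by apply: connect1; rewrite /super (@joined_vertical sea) ?orbT // sea_inl ?evened_even.
  by apply: displacement_moved; rewrite ?evened_even ?evened_moved.
move=> b b'; rewrite !inE => /andP[mb /eqP cb] /andP[mb' /eqP cb'] eqc.
have bb' : connect super b b'.
  by have : b' \in comp b' by [rewrite inE connect0]; rewrite -eqc inE.
have := strand_connect bb'; rewrite !strand_moved // => eqO.
apply: (porbit_col_inj N_gt1 (@cellP m n) flow_col flow_mono) => //; last by rewrite cb cb'.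
by rewrite -eq_porbit_mem eqO.
Qed.

End OneTiling.
End Components.

(** * Weights; the determinant as a sum over tilings *)

Section Weights.
Variables (m n : nat) (c : bool) (K : fieldType) (x : vertex m n -> K).
Hypothesis x_neq0 : forall v, x v != 0.
Local Notation cell := (cell m n).
Local Notation odd_cell := (@odd_cell m n c).
Implicit Types (b : cell) (D : {set edge m n}) (u : node m n).

Definition node_value u : K := if insub u is Some v then x v else 1.
Local Notation X := node_value.

Lemma node_value_neq0 u : X u != 0.
Proof. by rewrite /X; case: insubP => [v _ _|_]; rewrite ?oner_eq0. Qed.

Lemma node_value_val (v : vertex m n) : X (val v) = x v.
Proof. by rewrite /X valK. Qed.

Lemma node_value_boundary u : ~~ interior u -> X u = 1.
Proof. by move=> nint; rewrite /X insubN. Qed.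

Lemma prod_vertex (F : node m n -> K) : (forall u, ~~ interior u -> F u = 1) ->
  \prod_(v : vertex m n) F (val v) = \prod_u F u.
Proof.
move=> F1; rewrite [RHS](bigID (@interior m n)) /= [X in _ * X]big1 ?mulr1; last first.
  by move=> u; apply: F1.
rewrite [RHS](reindex_omap (val : vertex m n -> node m n) insub) /=; last first.
  by move=> u int_u; rewrite insubT.
by apply: eq_bigl => v; rewrite (valP v) valK eqxx.
Qed.

Definition sw b : node m n := (widen_ord (leqnSn m.+1) b.1, b.2).
Definition nw b : node m n := (lift ord0 b.1, b.2).
Definition se b : node m n := (widen_ord (leqnSn m.+1) b.1, ordS b.2).
Definition ne b : node m n := (lift ord0 b.1, ordS b.2).

Definition tiling_weight D : K := \prod_v x v ^ (1 - (cut_degree D (val v))%:Z).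

Definition edge_weight (e : edge m n) : K := \prod_(u in ends e) (X u)^-1.

(** A node is divided out once for each cut edge that ends there. *)
Lemma tiling_weightE D : tiling_weight D = \prod_u X u * \prod_(e in D) edge_weight e.
Proof.
have -> : tiling_weight D = \prod_u (X u * \prod_(e in D | u \in ends e) (X u)^-1).
  rewrite -prod_vertex => [|u /node_value_boundary ->]; last first.
    by rewrite mul1r big1 // => e _; rewrite invr1.
  apply: eq_bigr => v _; rewrite node_value_val expfzDr // expr1z; congr (_ * _).
  rewrite prodr_const -exprnN exprVn /cut_degree; congr (_ ^- _).
  by apply: eq_card => e; rewrite inE unfold_in.
rewrite big_split; congr (_ * _) => /=.
rewrite (exchange_big_dep (mem D)) /=; last by move=> u e _ /andP[].
by apply: eq_bigr => e eD; apply: eq_bigl => u; rewrite eD.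
Qed.

(** The left sides of the even cells are the cut edges of the sea, and every
    interior node is the end of exactly one of them. *)
Lemma prod_even_cells : \prod_(b | ~~ odd_cell b) (X (sw b) * X (nw b)) = \prod_u X u.
Proof.
pose even_node u := ~~ odd (u.1 + u.2 + c).
rewrite big_split /= [RHS](bigID even_node) /=; congr (_ * _).
  have bd u : u.1 = ord_max -> X u = 1.
    by move=> e; apply: node_value_boundary; rewrite /interior e /= ltnn ?andbF.
  rewrite [RHS](bigID (fun u => u.1 == ord_max)) /= [X in X * _]big1 ?mul1r; last first.
    by move=> u /andP[_ /eqP /bd].
  rewrite [RHS](reindex_omap sw (fun u => omap (fun i => (i, u.2)) (unlift ord_max u.1))) /=.
    apply: eq_bigl => -[i j]; rewrite /even_node /odd_cell /sw /=.
    have -> : widen_ord (leqnSn m.+1) i = lift ord_max i.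
      by apply: val_inj; rewrite /= /bump leqNgt ltn_ord.
    by rewrite liftK eq_sym neq_lift eqxx !andbT.
  case=> i j /= /andP[_]; case: unliftP => [i' ->|->]; last by rewrite eqxx.
  move=> _; congr (Some (_, _)); apply: val_inj.
  by rewrite /= /bump leqNgt ltn_ord.
have bd u : u.1 = ord0 -> X u = 1.
  by move=> e; apply: node_value_boundary; rewrite /interior e.
rewrite [RHS](bigID (fun u => u.1 == ord0)) /= [X in X * _]big1 ?mul1r; last first.
  by move=> u /andP[_ /eqP /bd].
rewrite [RHS](reindex_omap nw (fun u => omap (fun i => (i, u.2)) (unlift ord0 u.1))) /=.
  apply: eq_bigl => -[i j]; rewrite /even_node /odd_cell /nw /=.
  by rewrite liftK eqxx !andbT negbK add0n.
by case=> i j /= /andP[_]; case: unliftP => [i' ->|->]; rewrite ?eqxx.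
Qed.

Hypothesis n_gt0 : (0 < n)%N.

Lemma edge_weight2 u u' : u != u' ->
  \prod_(w in [set u; u']) (X w)^-1 = (X u * X u')^-1.
Proof. by move=> nuu'; rewrite big_setU1 ?inE //= big_set1 invfM. Qed.

Lemma sw_nw b : sw b != nw b.
Proof. by rewrite xpair_eqE negb_and -val_eqE /= /bump; apply/orP; left; lia. Qed.

Lemma se_ne b : se b != ne b.
Proof. by rewrite xpair_eqE negb_and -val_eqE /= /bump; apply/orP; left; lia. Qed.

Lemma sw_se b : sw b != se b.
Proof. by rewrite xpair_eqE eqxx eq_sym ordS_neq. Qed.

Lemma nw_ne b : nw b != ne b.
Proof. by rewrite xpair_eqE eqxx eq_sym ordS_neq. Qed.

(** The two cells of a domino have opposite colours. *)
Lemma prod_tiling (f : edge m n -> K) D : tiling D ->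
  \prod_(e in D) f e = \prod_(b | ~~ odd_cell b) \prod_(e in D | e \in sides b) f e.
Proof.
move=> tD; rewrite (exchange_big_dep (mem D)) /=; last by move=> b e _ /andP[].
apply: eq_bigr => e eD.
rewrite (eq_bigl (fun b => (b \in [set b | e \in sides b]) && ~~ odd_cell b)); last first.
  by move=> b; rewrite [in RHS]in_set [e \in D]eD andbC.
have two (b1 b2 : cell) (F : K) : b1 != b2 -> odd_cell b2 = ~~ odd_cell b1 ->
    \prod_(b | (b \in [set b1; b2]) && ~~ odd_cell b) F = F.
  move=> nb12 ob; rewrite big_mkcondr big_setU1 ?inE //= big_set1 ob negbK.
  by case: (odd_cell b1); rewrite ?mulr1 ?mul1r.
case: e eD => [b _|u uD]; first by rewrite cells_of_vertical two ?odd_west // eq_sym west_neq.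
have int_u : interior u by case/tilingP: tD => // H _; apply: H.
rewrite cells_of_horizontal //; case/andP: int_u => gt lt.
rewrite two //; first by rewrite xpair_eqE eqxx andbT -val_eqE /= !inordK //; lia.
rewrite /odd_cell /= !inordK //; last by lia.
by rewrite -{2}(prednK gt) !addSn /= negbK.
Qed.

(** The weight of a step from an even cell is the weight of the cut edge used by the
    path divided by that of the left side, which is the cut edge of the sea domino. *)
Definition step_weight b b' : K :=
  if odd_cell b then (b' == east b)%:R else
    (b' == east b)%:R * (X (sw b) * X (nw b) / (X (se b) * X (ne b)))
  + ((b.1 < m)%N && (b' == east (north b)))%:R * (X (sw b) / X (ne b))
  + ((0 < b.1)%N && (b' == east (south b)))%:R * (X (nw b) / X (se b)).

Let sum_pred1_mul (b : cell) (a : K) (f : cell -> K) :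
  \sum_b' (b' == b)%:R * a * f b' = a * f b.
Proof.
rewrite (bigD1 b) //= eqxx mul1r big1 ?addr0 // => b' /negbTE ->.
by rewrite !mul0r.
Qed.

Lemma sum_step_weight_odd b (f : cell -> K) : odd_cell b ->
  \sum_b' step_weight b b' * f b' = f (east b).
Proof.
move=> ob; transitivity (\sum_b' (b' == east b)%:R * 1 * f b').
  by apply: eq_bigr => b' _; rewrite /step_weight ob mulr1.
by rewrite sum_pred1_mul mul1r.
Qed.

(** The hypothesis is the transfer relation with denominators cleared. *)
Lemma sum_step_weight_even b (f : cell -> K) (w0 : K) : ~~ odd_cell b ->
  w0 * X (se b) * X (ne b) = f (east b) * X (sw b) * X (nw b)
    + (if (b.1 < m)%N then f (east (north b)) * X (sw b) * X (se b) else 0)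
    + (if (0 < b.1)%N then f (east (south b)) * X (nw b) * X (ne b) else 0) ->
  \sum_b' step_weight b b' * f b' = w0.
Proof.
move=> eb H.
transitivity (\sum_b' ((b' == east b)%:R
    * (X (sw b) * X (nw b) / (X (se b) * X (ne b))) * f b'
  + (b' == east (north b))%:R * (if (b.1 < m)%N then X (sw b) / X (ne b) else 0) * f b'
  + (b' == east (south b))%:R * (if (0 < b.1)%N then X (nw b) / X (se b) else 0) * f b')).
  apply: eq_bigr => b' _; rewrite /step_weight (negbTE eb) !mulrDl.
  congr (_ + _ + _); congr (_ * _); case: ifP => _ /=; rewrite ?mul0r ?mulr0 //.
rewrite !big_split /= !sum_pred1_mul.
have zse := node_value_neq0 (se b); have zne := node_value_neq0 (ne b).
apply: (mulIf zse); apply: (mulIf zne); rewrite H.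
move: (X (sw b)) (X (nw b)) (X (se b)) (X (ne b)) zse zne => x1 x2 x3 x4 zse zne.
by case: ifP => _; case: ifP => _; field; rewrite zse zne.
Qed.

Lemma step_weight_self b : step_weight b b = 0.
Proof.
rewrite /step_weight !(eq_sym b) !east_same_col // !andbF !mul0r !addr0.
by case: ifP.
Qed.

Lemma step_weight_admissible b b' : b' != b -> ~~ admissible c b b' -> step_weight b b' = 0.
Proof.
rewrite /admissible /step_weight => /negbTE ->; rewrite orFb negb_or => /andP[/negbTE ->].
by case: odd_cell => //=; rewrite negb_or => /andP[/negbTE -> /negbTE ->]; rewrite !mul0r !addr0.
Qed.

Lemma tiling_weight_flow D : tiling D ->
  tiling_weight D = \prod_(b | flow c D b != b) step_weight b (flow c D b).
Proof.
move=> tD; rewrite tiling_weightE -prod_even_cells (prod_tiling _ tD) -big_split /=.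
rewrite [RHS](bigID odd_cell) /= [X in _ = X * _]big1 ?mul1r; last first.
  move=> b /andP[mb ob]; rewrite /step_weight ob flowE // /slide ob.
  by move: mb; rewrite moved_odd // => ->; rewrite eqxx.
rewrite [RHS]big_mkcondl; apply: eq_bigr => b eb.
pose sd := [:: left_side b; right_side b; bottom_side b; top_side b].
have nz := node_value_neq0.
have wl : edge_weight (left_side b) = (X (sw b) * X (nw b))^-1.
  by rewrite /edge_weight /ends -edge_weight2 ?sw_nw.
have wr : edge_weight (right_side b) = (X (se b) * X (ne b))^-1.
  by rewrite /edge_weight /ends -edge_weight2 ?se_ne.
have wb : edge_weight (bottom_side b) = (X (sw b) * X (se b))^-1.
  by rewrite /edge_weight /ends -edge_weight2 ?sw_se.
have wt : edge_weight (top_side b) = (X (nw b) * X (ne b))^-1.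
  by rewrite /edge_weight /ends -edge_weight2 ?nw_ne.
have one e : e \in D -> e \in sides b ->
    \prod_(e' in D | e' \in sides b) edge_weight e' = edge_weight e.
  move=> eD eb'; case/andP: (tD) => _ /forallP/(_ b)/cards1P[e0 be0].
  have : e \in sides b :&: D by rewrite inE eb'.
  rewrite be0 inE => /eqP ee0.
  rewrite (eq_bigl (fun e' => e' \in [set e0])) ?big_set1 ?ee0 // => e'.
  by rewrite -be0 in_setI andbC.
rewrite moved_even //; have [lb|nlb] /= := boolP (inl b \in D).
  rewrite (one (left_side b)) //; last by rewrite /sides !inE eqxx.
  by rewrite wl divff // mulf_neq0.
rewrite /step_weight (negbTE eb).
have [rb|nrb] := boolP (right_side b \in D).
  rewrite (one (right_side b)) //; last by rewrite /sides !inE eqxx !orbT.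
  rewrite flowE // slide_right // wr !east_eq eqxx mul1r.
  have -> : (b.1 < m)%N && (b == north b) = false.
    by case: ltnP => //= lt; rewrite eq_sym north_neq.
  have -> : (0 < b.1)%N && (b == south b) = false.
    by case: ltnP => //= lt; rewrite eq_sym south_neq.
  by rewrite !mul0r !addr0.
have [tb|ntb] := boolP (top_side b \in D).
  have lt := tiling_top n_gt0 tD tb.
  rewrite (one (top_side b)) //; last by rewrite /sides !inE eqxx !orbT.
  rewrite flowE // slide_top // wt !east_eq lt eqxx north_neq // mul0r add0r mul1r.
  have -> : (0 < b.1)%N && (north b == south b) = false.
    by case: ltnP => //= gt; rewrite north_south_neq.
  rewrite mul0r addr0; field; by rewrite !nz.
have bb : bottom_side b \in D.
  have := tiling_one n_gt0 tD b; rewrite (negbTE ntb) (negbTE nrb) [left_side b \in D](negbTE nlb).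
  by case: (_ \in D).
have gt := tiling_bottom n_gt0 tD bb.
rewrite (one (bottom_side b)) //; last by rewrite /sides !inE eqxx !orbT.
rewrite flowE // slide_bottom // wb !east_eq gt eqxx south_neq // mul0r add0r mul1r.
have -> : (b.1 < m)%N && (south b == north b) = false.
  by case: ltnP => //= lt; rewrite eq_sym north_south_neq.
rewrite mul0r add0r; field; by rewrite !nz.
Qed.

(** The indeterminate marks the steps that leave column j, that is, counts paths. *)
Definition twisted_step (j : 'I_(2 * n)) b b' : {poly K} :=
  (b == b')%:R - (if b.2 == j then 'X else 1) * (step_weight b b')%:P.

(** A permutation that contributes is the flow of a unique tiling.  Its moved points
    number 2n times the number k of paths, so the signs of their factors cancel;
    the signature is (-1) ^ k and column j contributes X ^ k. *)
Theorem det_twisted_step (j : 'I_(2 * n)) :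
  \sum_(s : {perm cell}) (-1) ^+ s * \prod_b twisted_step j b (s b)
    = \sum_(D : {set edge m n} | tiling D)
        (- 'X) ^+ nb_noncontractible c D * (tiling_weight D)%:P.
Proof.
rewrite (bigID (fun s : {perm cell} => [forall b, admissible c b (s b)])) /=.
rewrite [X in _ + X]big1 ?addr0; last first.
  move=> s; rewrite negb_forall => /existsP[b nadm].
  have nsb : s b != b by apply: contraNneq nadm => ->; rewrite /admissible eqxx.
  rewrite (bigD1 b) //= /twisted_step eq_sym (negbTE nsb) step_weight_admissible //.
  by rewrite polyC0 mulr0 subrr mul0r mulr0.
rewrite (reindex_onto (flow c) (fun s => cuts c s)) /=; last first.
  move=> s /forallP adm; apply/permP => b.
  by rewrite flowE ?tiling_cuts ?slide_cuts.
apply: eq_big => [D|D tD'].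
  apply/andP/idP => [[/forallP adm /eqP <-]|tD]; first exact: tiling_cuts.
  split; last by rewrite cuts_flow.
  by apply/forallP => b; apply: flow_admissible.
have tD : tiling D.
  by case/andP: tD' => /forallP adm /eqP <-; apply: tiling_cuts.
have even2n : ~~ odd (2 * n)%N by rewrite oddM.
have N_gt1 : (1 < 2 * n)%N by lia.
set s := flow c D; set k := nb_noncontractible c D.
have kE : #|moved_in (fun b : cell => b.2) s j| = k.
  by rewrite /k (nb_noncontractible_moved c n_gt0 tD j).
have -> : odd_perm s = odd k.
  by rewrite -kE; exact: (odd_perm_moved N_gt1 (@cellP m n) (flow_col n_gt0 tD) (flow_mono n_gt0 tD) j even2n).
have cardM : #|[set b | s b != b]| = (2 * n * k)%N.
  by rewrite -kE; exact: (card_moved N_gt1 (@cellP m n) (flow_col n_gt0 tD) (flow_mono n_gt0 tD)).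
rewrite signr_odd (bigID (fun b => s b != b)) /= [X in _ * (_ * X)]big1 ?mulr1; last first.
  by move=> b; rewrite negbK => /eqP ->; rewrite /twisted_step eqxx step_weight_self mulr0 subr0.
rewrite (eq_bigr (fun b => - ((if b.2 == j then 'X else 1) * (step_weight b (s b))%:P))); last first.
  by move=> b mb; rewrite /twisted_step eq_sym (negbTE mb) sub0r.
rewrite prodrN big_split /= -rmorph_prod -tiling_weight_flow //.
have -> : #|[pred b | s b != b]| = (2 * n * k)%N.
  by rewrite -cardM; apply: eq_card => b; rewrite !inE.
rewrite -mulnA exprM sqrrN expr1n expr1n mul1r mulrA; congr (_ * _).
rewrite -big_mkcondr /= prodr_const [in RHS]exprNn -kE; congr (_ * _).
by congr (_ ^+ _); apply: eq_card => b; rewrite !inE.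
Qed.

End Weights.

(** * The determinant as a characteristic polynomial *)

(** Both determinants are that of the block matrix with rows (1, U) and (V, 1). *)
Lemma det_1sub_mulC (R : comNzRingType) (p q : nat) (U : 'M[R]_(p, q)) (V : 'M[R]_(q, p)) :
  \det (1%:M - U *m V) = \det (1%:M - V *m U).
Proof.
have e1 : block_mx 1%:M U V 1%:M
    = block_mx 1%:M 0 V 1%:M *m block_mx 1%:M U 0 (1%:M - V *m U).
  by rewrite mulmx_block !mul1mx !mul0mx !mulmx1 !addr0 addrC subrK.
have e2 : block_mx 1%:M U V 1%:M
    = block_mx (1%:M - U *m V) U 0 1%:M *m block_mx 1%:M 0 V 1%:M.
  by rewrite mulmx_block !mul1mx !mul0mx !mulmx1 !mulmx0 !add0r subrK.
have := congr1 determinant e1; rewrite e2 !det_mulmx det_lblock !det_ublock !det1.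
by rewrite !mul1r !mulr1.
Qed.

Section CyclicTransfer.
Variables (m n : nat) (K : fieldType).
Local Notation cell := (cell m n).
Variables (st : cell -> cell -> K) (V : nat -> 'M[K]_m.+1).
Hypothesis n_gt0 : (0 < n)%N.
Hypothesis st_col : forall b b', st b b' != 0 -> b'.2 = ordS b.2.
Hypothesis st_V : forall (b : cell) P,
  \sum_b' st b b' * V b.2.+1 b'.1 P = V b.2 b.1 P.
Hypothesis V_unit : V (2 * n)%N \in unitmx.

Let col0_proof : (0 < 2 * n)%N. Proof. by rewrite muln_gt0. Qed.
Let col0 : 'I_(2 * n) := Ordinal col0_proof.
Let last_proof : ((2 * n).-1 < 2 * n)%N. Proof. by rewrite prednK. Qed.
(** The steps that leave this column close up the cylinder. *)
Definition last_column : 'I_(2 * n) := Ordinal last_proof.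
Local Notation last := last_column.

Let ordS_last : ordS last = col0.
Proof. by apply: val_inj; rewrite /= prednK ?modnn. Qed.

Let ordS_val (j : 'I_(2 * n)) : j != last -> ordS j = j.+1 :> nat.
Proof.
move=> nj; rewrite /= modn_small //; have := ltn_ord j.
by rewrite -val_eqE /= in nj; move/eqP in nj; lia.
Qed.

Let z (b b' : cell) : K := (b == b')%:R - (if b.2 == last then 0 else st b b').
Let corner (b b' : cell) : K := if b.2 == last then st b b' else 0.
Local Notation q := #|{: cell}|.
Local Notation mx F := (\matrix_(a < q, b < q) F (enum_val a) (enum_val b)).

Let det_z : \det (mx z) = 1.
Proof.
rewrite det_enum (bigD1 1%g) //= [X in _ + X]big1 ?addr0 => [|s ns]; last first.
  apply/eqP; rewrite mulf_eq0 signr_eq0 /=; apply: contraNT ns => /prodf_neq0 nz.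
  have step b : s b = b \/ ((s b).2 = b.2.+1 :> nat).
    have := nz b isT; rewrite /z; case: (eqVneq b (s b)) => [<-|_]; first by left.
    case: (eqVneq b.2 last) => [_|nl]; first by rewrite subr0 eqxx.
    by rewrite sub0r oppr_eq0 => /st_col ->; right; apply: ordS_val.
  apply/eqP/permP => b; rewrite perm1.
  (* Inside the strip a step never lowers the column, while a permutation
     preserves the sum of all columns. *)
  have sum_eq : (\sum_(b : cell) ((s b).2 : nat) = \sum_(b : cell) (b.2 : nat))%N.
    by rewrite [RHS](reindex_inj (@perm_inj _ s)).
  case: (step b) => // sb; exfalso; move: sum_eq.
  rewrite (bigD1 b) //= [in RHS](bigD1 b) //= sb.
  have : (\sum_(i : cell | i != b) (i.2 : nat) <= \sum_(i : cell | i != b) ((s i).2 : nat))%N.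
    by apply: leq_sum => i _; case: (step i) => ->.
  move=> le e; have := leq_add (leqnn b.2.+1) le.
  by rewrite e addSn ltnn.
rewrite odd_perm1 expr0 mul1r big1 // => b _; rewrite perm1 /z eqxx.
have -> : st b b = 0.
  apply/eqP; apply: contraT => /st_col e; have := ordS_neq n_gt0 b.2.
  by rewrite -e eqxx.
by rewrite if_same subr0.
Qed.

Let F : 'M[K]_(q, m.+1) :=
  \matrix_(a, P) V (enum_val a : cell).2 (enum_val a : cell).1 P.
Let E : 'M[K]_(m.+1, q) := \matrix_(i, a) ((enum_val a : cell) == (i, col0))%:R.

Let sum_enum (f : cell -> K) : \sum_(a < q) f (enum_val a) = \sum_b f b.
Proof.
rewrite [RHS](reindex (@enum_val _ {: cell})) //=.
by exists enum_rank => a _; rewrite ?enum_valK ?enum_rankK.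
Qed.

Let sum_pred1 (b : cell) (f : cell -> K) : \sum_b' (b' == b)%:R * f b' = f b.
Proof.
rewrite (bigD1 b) //= eqxx mul1r big1 ?addr0 // => b' /negbTE ->.
by rewrite mul0r.
Qed.

Let corner_factor : mx corner = mx z *m F *m invmx (V (2 * n)%N) *m E.
Proof.
(* The columns of corner over the first column of the cylinder. *)
pose H : 'M[K]_(q, m.+1) := \matrix_(a, i) corner (enum_val a) (i, col0).
have -> : mx z *m F = H *m V (2 * n)%N.
  apply/matrixP => a P; rewrite !mxE.
  under eq_bigr do rewrite !mxE.
  rewrite (sum_enum (fun b' => z (enum_val a) b' * V b'.2 b'.1 P)).
  set b := enum_val a.
  have -> : \sum_b' z b b' * V b'.2 b'.1 P
      = V b.2 b.1 P - (if b.2 == last then 0 else V b.2 b.1 P).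
    rewrite -{1}(sum_pred1 b (fun b' => V b'.2 b'.1 P)).
    have -> : (if b.2 == last then 0 else V b.2 b.1 P)
        = \sum_b' (if b.2 == last then 0 else st b b') * V b'.2 b'.1 P.
      case: eqVneq => [_|nl]; first by rewrite big1 // => b' _; rewrite mul0r.
      rewrite -st_V; apply: eq_bigr => b' _.
      have [->|/st_col e] := eqVneq (st b b') 0; first by rewrite !mul0r.
      by rewrite e ordS_val.
    rewrite -sumrB; apply: eq_bigr => b' _.
    by rewrite /z mulrBl eq_sym.
  case: eqVneq => [bl|nl]; last first.
    rewrite subrr big1 // => i _; rewrite !mxE /corner -/b (negbTE nl) mul0r //.
  rewrite subr0 -st_V bl /= prednK //.
  have inj_i : injective (fun i : 'I_m.+1 => (i, col0) : cell) by move=> i i' [].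
  rewrite (bigID (fun b' : cell => b'.2 == col0)) /= [X in _ + X]big1 ?addr0; last first.
    move=> b' nb'; have [->|/st_col e] := eqVneq (st b b') 0; first by rewrite mul0r.
    by move: nb'; rewrite e bl ordS_last eqxx.
  rewrite (reindex_omap (fun i : 'I_m.+1 => (i, col0) : cell) (fun b' => Some b'.1)) /=; last first.
    by case=> i j /= /eqP ->.
  apply: eq_big => [i|i _]; first by rewrite !eqxx.
  by rewrite !mxE /corner -/b bl eqxx.
rewrite -mulmxA; have -> : H *m V (2 * n)%N *m (invmx (V (2 * n)%N) *m E) = H *m E.
  by rewrite mulmxA mulmxK.
apply/matrixP => a a'; rewrite !mxE; set b := enum_val a; set b' := enum_val a'.
rewrite (bigD1 b'.1) //= !mxE -/b -/b' big1 ?addr0; last first.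
  move=> i ni; rewrite !mxE -/b'; case: eqP => [e|]; last by rewrite mulr0.
  by rewrite e eqxx in ni.
case: b' => i j /=; rewrite xpair_eqE eqxx /=; case: eqVneq => [->|nj]; first by rewrite mulr1.
rewrite mulr0 /corner; case: eqVneq => // bl.
have [//|/st_col /= e] := eqVneq (st b (i, j)) 0.
by rewrite e bl ordS_last eqxx in nj.
Qed.

(** Split the steps into those inside the strip, which with the identity form the
    unipotent matrix z, and those that leave the last column, the matrix corner.
    The matrix F of all values of V satisfies that z F is supported on the last
    column, by the transfer relation [st_V]; this factors corner through F and the
    values at column 2n ([corner_factor]), and [det_1sub_mulC] moves the determinant to
    dimension m + 1. *)
Lemma det_cyclic_transfer :
  \sum_(s : {perm cell}) (-1) ^+ s * \prod_b
      ((b == s b)%:R - (if b.2 == last then 'X else 1) * (st b (s b))%:P : {poly K})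
  = \det (1%:M - 'X *: map_mx polyC (V 0%N *m invmx (V (2 * n)%N))).
Proof.
rewrite -(det_enum (fun b b' : cell =>
  (b == b')%:R - (if b.2 == last then 'X else 1) * (st b b')%:P : {poly K})).
pose FV := F *m invmx (V (2 * n)%N).
have -> : \matrix_(a < q, b < q) ((enum_val a == enum_val b)%:R
     - (if (enum_val a).2 == last then 'X else 1) * (st (enum_val a) (enum_val b))%:P : {poly K})
   = map_mx polyC (mx z) *m (1%:M - ('X *: map_mx polyC FV) *m map_mx polyC E).
  rewrite mulmxBr mulmx1 -scalemxAl -scalemxAr -!map_mxM /FV !mulmxA -corner_factor.
  apply/matrixP => a b; rewrite !mxE /z /corner.
  by case: ifP => _; rewrite ?subr0 ?polyCB ?polyC0 ?mulr0 ?subr0 ?mul1r ?rmorph_nat.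
rewrite det_mulmx det_map_mx det_z mul1r det_1sub_mulC -scalemxAr -map_mxM.
congr (\det (_ - _ *: map_mx _ _)); rewrite /FV mulmxA; congr (_ *m _).
apply/matrixP => i P; rewrite !mxE; under eq_bigr do rewrite !mxE.
by rewrite (sum_enum (fun b => (b == (i, col0))%:R * V b.2 b.1 P)) sum_pred1.
Qed.

End CyclicTransfer.

(** * Extreme coefficient, conjugation, and positivity *)

Lemma coef_prod_linear_size (K : fieldType) k (a b : 'I_k -> K)
    (f := fun i => (a i)%:P - 'X * (b i)%:P : {poly K}) :
  (size (\prod_i f i)%R <= k.+1)%N /\ (\prod_i f i)`_k = \prod_i (- b i).
Proof.
rewrite {}/f; elim: k a b => [|k IH] a b.
  by split; rewrite !big_ord0 ?coef1 // size_poly1.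
rewrite !big_ord_recl; set p := \prod_(i < k) _.
have [sz_p cp] : (size p <= k.+1)%N /\ p`_k = \prod_(i < k) (- b (lift ord0 i)).
  exact: (IH (fun i => a (lift ord0 i)) (fun i => b (lift ord0 i))).
split.
  apply: leq_trans (size_polyMleq _ _) _.
  have sz2 : (size ((a ord0)%:P - 'X * (b ord0)%:P)%R <= 2)%N.
    rewrite (leq_trans (size_polyD _ _)) // geq_max size_polyN.
    rewrite (leq_trans (size_polyC_leq1 _)) //= (leq_trans (size_polyMleq _ _)) //.
    by rewrite size_polyX; have := size_polyC_leq1 (b ord0); lia.
  by lia.
rewrite mulrBl coefB coefCM -mulrA coefXM /= coefCM cp.
by rewrite nth_default // mulr0 sub0r mulNr.
Qed.

Lemma coef_prod_linear (K : fieldType) k (a b : 'I_k -> K) :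
  (\prod_i ((a i)%:P - 'X * (b i)%:P : {poly K}))`_k = \prod_i (- b i).
Proof. by case: (coef_prod_linear_size a b). Qed.

(** Each entry is linear in X, and the top coefficient of a product of linear
    factors is the product of their slopes. *)
Lemma coef_det_1subX (K : fieldType) k (B : 'M[K]_k) :
  (\det (1%:M - 'X *: map_mx polyC B))`_k = (-1) ^+ k * \det B.
Proof.
rewrite /determinant coef_sum mulr_sumr; apply: eq_bigr => s _.
have -> : \prod_i (1%:M - 'X *: map_mx polyC B) i (s i)
    = \prod_i (((i == s i)%:R)%:P - 'X * (B i (s i))%:P).
  by apply: eq_bigr => i _; rewrite !mxE rmorph_nat.
have -> : (-1) ^+ s = ((-1) ^+ s)%:P :> {poly K} by rewrite rmorphXn rmorphN1.
by rewrite coefCM coef_prod_linear prodrN card_ord mulrCA.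
Qed.

(** V is the product of V' with the transpose of A, so V *m invmx V' is conjugate to
    that transpose. *)
Lemma det_1subX_conj (K : fieldType) k (A V V' : 'M[K]_k) :
  V' \in unitmx -> V = V' *m A^T ->
  \det (1%:M - 'X *: map_mx polyC (V *m invmx V')) = \det (1%:M - 'X *: map_mx polyC A).
Proof.
move=> uV ->; rewrite -[RHS]det_tr.
have -> : (1%:M - 'X *: map_mx polyC A)^T = 1%:M - 'X *: map_mx polyC A^T.
  by apply/matrixP => i j; rewrite !mxE eq_sym.
have -> : 1%:M - 'X *: map_mx polyC (V' *m A^T *m invmx V')
    = map_mx polyC V' *m (1%:M - 'X *: map_mx polyC A^T) *m map_mx polyC (invmx V').
  rewrite mulmxBr mulmxBl mulmx1 -map_mxM mulmxV // map_mx1.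
  by rewrite -scalemxAr -scalemxAl -!map_mxM.
rewrite !det_mulmx mulrAC -det_mulmx -map_mxM mulmxV // map_mx1 det1 mul1r //.
Qed.

Section Positivity.
Variable k : nat.

(** Positivity at the point (1, ..., 1) stands for the absence of subtractions: it
    is preserved by sums, products and quotients, and implies nonvanishing. *)
Definition positive (f : {fraction {mpoly rat[k]}}) : Prop :=
  exists p q : {mpoly rat[k]},
    [/\ 0 < p.@[fun=> 1], 0 < q.@[fun=> 1] & f * tofrac q = tofrac p].

Let pos_neq0 (p : {mpoly rat[k]}) : 0 < p.@[fun=> 1] -> tofrac p != 0.
Proof. by rewrite tofrac_eq0; apply: contraTneq => ->; rewrite meval0 ltxx. Qed.

Lemma positive_neq0 f : positive f -> f != 0.
Proof.
case=> p [q [p0 _ e]]; apply: contraNneq (pos_neq0 p0) => f0.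
by rewrite -e f0 mul0r.
Qed.

Lemma positive1 : positive 1.
Proof. by exists 1, 1; rewrite meval1 mul1r; split. Qed.

Lemma positiveX i : positive (tofrac 'X_i).
Proof. by exists 'X_i, 1; rewrite mevalXU meval1 tofrac1 mulr1; split. Qed.

Lemma positiveM f g : positive f -> positive g -> positive (f * g).
Proof.
move=> [p [q [p0 q0 e]]] [p' [q' [p0' q0' e']]]; exists (p * p'), (q * q').
by rewrite !mevalM !mulr_gt0 // !tofracM mulrACA e e'; split.
Qed.

Lemma positiveD f g : positive f -> positive g -> positive (f + g).
Proof.
move=> [p [q [p0 q0 e]]] [p' [q' [p0' q0' e']]].
exists (p * q' + p' * q), (q * q').
rewrite mevalD !mevalM addr_gt0 ?mulr_gt0 //; split=> //.
rewrite tofracD !tofracM -e -e'; ring.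
Qed.

Lemma positive_div f g h : positive g -> positive h -> f * g = h -> positive f.
Proof.
move=> [p [q [p0 q0 e]]] [p' [q' [p0' q0' e']]] fgh.
exists (p' * q), (p * q'); rewrite !mevalM !mulr_gt0 //; split=> //.
by rewrite !tofracM -e' -e -fgh; ring.
Qed.

End Positivity.

(** * Columns of the cylinder as residues *)

Section Columns.
Variable n : nat.
Hypothesis n_gt0 : (0 < n)%N.

Lemma column_proof (z : int) : (`|(z %% (2 * n)%N%:Z)%Z| < 2 * n)%N.
Proof.
rewrite -ltz_nat gez0_abs ?modz_ge0 ?ltz_pmod //; lia.
Qed.

Definition column (z : int) : 'I_(2 * n) := Ordinal (column_proof z).

Lemma column_mod (z : int) : ((column z : nat)%:Z = z %% (2 * n)%N%:Z)%Z.
Proof. by rewrite /= gez0_abs // modz_ge0 //; lia. Qed.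

Lemma column_eq (z : int) (j : 'I_(2 * n)) :
  (z = j%:Z %[mod (2 * n)%N%:Z])%Z -> column z = j.
Proof.
move=> e; apply: val_inj; apply/eqP; rewrite -eqz_nat column_mod e.
by rewrite modz_nat modn_small.
Qed.

Lemma column_val (j : 'I_(2 * n)) : column j%:Z = j.
Proof. exact: column_eq. Qed.

Lemma columnD (z : int) : column (z + 1) = ordS (column z).
Proof.
apply: column_eq.
rewrite (_ : (ordS (column z) : nat) = ((column z).+1 %% (2 * n))%N) //.
by rewrite -modz_nat modz_mod -[(column z).+1]addn1 PoszD column_mod modzDml.
Qed.

Lemma columnB (z : int) : column (z - 1) = ord_pred (column z).
Proof. by rewrite -[in RHS](subrK 1 z) columnD ordSK. Qed.

Lemma column_period (z : int) : column (z + (2 * n)%N%:Z) = column z.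
Proof. by apply: column_eq; rewrite column_mod modz_mod modzDr. Qed.

Lemma column_parity (z : int) : exists k : int, (column z : nat)%:Z = z + 2 * k.
Proof.
exists (- (z %/ (2 * n)%N%:Z)%Z * n%:Z).
rewrite column_mod [X in _ = X + _](divz_eq z (2 * n)%N%:Z) PoszM; lia.
Qed.

End Columns.

(** * Recurrence for a periodic solution of the octahedron recurrence *)

Section GridHamiltonians.
Variables (K : fieldType) (m n : nat) (c : bool) (G : nat -> int -> int -> K).
Variable x : vertex m n -> K.
Hypotheses (m_gt0 : (0 < m)%N) (n_gt0 : (0 < n)%N).
Hypothesis G0 : forall P Q, G 0 P Q = 1.
Hypothesis Gtop : forall P Q, G m.+1 P Q = 1.
Hypothesis Gneq0 : forall i P Q, (i <= m.+1)%N -> G i P Q != 0.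
Hypothesis Goct : forall i P Q, (0 < i <= m)%N ->
  G i P Q * G i (P + 1) (Q + 1)
    = G i (P + 1) Q * G i P (Q + 1) + G i.+1 P Q * G i.-1 (P + 1) (Q + 1).
Hypothesis Gper : forall i (P Q : int), G i (P + n%:Z) (Q - n%:Z) = G i P Q.
Hypothesis x_neq0 : forall v, x v != 0.
Hypothesis initial_value_node : forall i (j : nat), (i <= m.+1)%N ->
  initial_value G c i j = node_value x (inord i, column n_gt0 j%:Z).

Local Notation A := (monodromy m n G).
Local Notation wave_mx := (wave_mx m G c).
Local Notation st := (step_weight c x).

Definition hamiltonian (k : nat) : K :=
  \sum_(D : {set edge m n} | tiling D && (nb_noncontractible c D == k))
    tiling_weight x D.

Lemma step_weight_col (b b' : cell m n) : st b b' != 0 -> b'.2 = ordS b.2.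
Proof.
apply: contraNeq => ne_col; rewrite /step_weight.
have ne_east (b1 : cell m n) : b1.2 = b.2 -> (b' == east b1) = false.
  by move=> e1; apply: contraNF ne_col => /eqP ->; rewrite /= e1.
by rewrite !ne_east // !andbF !mul0r !addr0 if_same.
Qed.

(** The weights of [step_weight] are the coefficients of [wave_even] divided by the
    coefficient of its left-hand side. *)
Lemma wave_transfer (b : cell m n) P :
  \sum_b' st b b' * wave_mx b.2.+1 b'.1 P = wave_mx b.2 b.1 P.
Proof.
have lt_b : (b.1 <= m)%N by rewrite -ltnS ltn_ord.
pose f (b' : cell m n) : K := wave_mx b.2.+1 b'.1 P.
have fE (b' : cell m n) : f b' = wave G c b.2.+1 b'.1 P%:Z by rewrite /f mxE.
rewrite [RHS]mxE; have [ob|eb] := boolP (odd_cell c b).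
  rewrite (@wave_odd _ m n G) //.
  by rewrite (sum_step_weight_odd _ f ob) fE.
have xsw : node_value x (sw b) = initial_value G c b.1 b.2.
  rewrite initial_value_node ?(column_val n_gt0); last by lia.
  by congr (node_value _ (_, _)); apply: val_inj; rewrite /= inordK //; lia.
have xnw : node_value x (nw b) = initial_value G c b.1.+1 b.2.
  rewrite initial_value_node ?(column_val n_gt0) //.
  by congr (node_value _ (_, _)); apply: val_inj; rewrite /= inordK.
have colS : column n_gt0 (b.2.+1)%:Z = ordS b.2.
  by rewrite -[in RHS]((column_val n_gt0) b.2) -columnD; congr (column _ _); lia.
have xse : node_value x (se b) = initial_value G c b.1 b.2.+1.
  rewrite initial_value_node ?colS; last by lia.
  by congr (node_value _ (_, _)); apply: val_inj; rewrite /= inordK //; lia.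
have xne : node_value x (ne b) = initial_value G c b.1.+1 b.2.+1.
  rewrite initial_value_node ?colS //.
  by congr (node_value _ (_, _)); apply: val_inj; rewrite /= inordK.
apply: (sum_step_weight_even (f := f) x_neq0 eb).
have := wave_even G0 Gtop Gneq0 Goct Gper m_gt0 n_gt0 P lt_b eb.
rewrite xsw xnw xse xne !fE => ->; congr (_ + _ + _).
  by case: ifP => // lt; rewrite [((east (north b)).1 : nat)]north_row.
by case: ifP => // gt; rewrite [((east (south b)).1 : nat)]south_row.
Qed.

Lemma det_monodromy_tilings :
  \det (1%:M - 'X *: map_mx polyC A)
  = \sum_(D : {set edge m n} | tiling D)
      (- 'X) ^+ nb_noncontractible c D * (tiling_weight x D)%:P.
Proof.
rewrite -(det_twisted_step c x_neq0 n_gt0 (last_column n_gt0)).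
rewrite (det_cyclic_transfer n_gt0 step_weight_col wave_transfer); last first.
  exact: (wave_mx_unit G0 Gtop Gneq0 Goct m_gt0 n_gt0 c (2 * n)).
rewrite (@det_1subX_conj _ _ A) //.
  exact: (wave_mx_unit G0 Gtop Gneq0 Goct m_gt0 n_gt0 c (2 * n)).
by have := wave_mx_shift G0 Gtop Gneq0 Goct Gper m_gt0 n_gt0 c 0; rewrite add0n.
Qed.

(** The top coefficient is the determinant of the monodromy, which is 1; this agrees
    with the convention that the Hamiltonian of index m + 1 is 1. *)
Lemma coef_monodromy (i : 'I_m.+1) :
  (\det (1%:M - 'X *: map_mx polyC A))`_i.+1
   = (-1) ^+ i.+1 * (if (i == m :> nat) then 1 else hamiltonian i.+1).
Proof.
case: eqP => [->|_].
  by rewrite coef_det_1subX (det_monodromy G0 Gtop Gneq0 Goct Gper).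
rewrite det_monodromy_tilings coef_sum /hamiltonian mulr_sumr.
rewrite [RHS]big_mkcondr /=; apply: eq_bigr => D _.
have -> : (- 'X) ^+ nb_noncontractible c D
    = ((-1) ^+ nb_noncontractible c D)%:P * 'X^(nb_noncontractible c D) :> {poly K}.
  by rewrite [in LHS]exprNn rmorphXn rmorphN1.
rewrite -mulrA coefCM coefMC coefXn eq_sym.
by case: eqP => [->|_]; rewrite ?mul1r // mul0r mulr0.
Qed.


Theorem grid_recurrence (r : nat) (P Q : int) : (r <= m.+1)%N ->
  let N := 'C(m.+1, r) in
  \sum_(j < N.+1) (-1) ^+ j
    * mmap intr (fun i : 'I_m.+1 => if (i == m :> nat) then 1 else hamiltonian i.+1)
        (symf (plethysm m.+1 r j))
    * G r (P + (n * (N - j))%N%:Z) (Q + (n * (N - j))%N%:Z) = 0.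
Proof.
move=> le_rm N.
have [U [W UW]] := minor_diag G0 Gtop Gneq0 Goct Gper m_gt0 n_gt0 P Q le_rm.
have := plethysm_recurrence coef_monodromy U W; rewrite -/N => rec.
by rewrite -[RHS]rec; apply: eq_bigr => j _; rewrite UW.
Qed.

End GridHamiltonians.

(** * The T-system as a grid *)

Section Parity.
Variables (m n : nat) (c : bool).

Lemma dvdz2P (z : int) : reflect (exists k : int, z = 2 * k) (2 %| z)%Z.
Proof. by apply: (iffP dvdzP) => -[k ->]; exists k; rewrite mulrC. Qed.

Lemma epsilon_split (u : node m n) :
  exists2 k : nat, (u.1 + u.2 + c = epsilon c u + 2 * k)%N & (epsilon c u < 2)%N.
Proof.
exists ((u.1 + u.2 + c) %/ 2)%N; last by rewrite ltn_mod.
by rewrite {1}(divn_eq (u.1 + u.2 + c) 2) /epsilon; lia.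
Qed.

Lemma epsilon_shift (u u' : node m n) (k : int) :
  (u'.1 : nat)%:Z + (u'.2 : nat)%:Z = (u.1 : nat)%:Z + (u.2 : nat)%:Z + 1 + 2 * k ->
  (epsilon c u' + epsilon c u = 1)%N.
Proof.
have [l e lt] := epsilon_split u; have [l' e' lt'] := epsilon_split u'.
move: e e' lt lt'; move: (u.1 : nat) (u.2 : nat) (u'.1 : nat) (u'.2 : nat).
by move=> x y x' y'; lia.
Qed.

Lemma epsilon_below (u : node m n) : interior u ->
  (epsilon c (below u) + epsilon c u = 1)%N.
Proof.
move=> /andP[gt lt]; apply: (@epsilon_shift _ _ (-1)); rewrite /below /= inordK; lia.
Qed.

Lemma epsilon_above (u : node m n) : interior u ->
  (epsilon c (above u) + epsilon c u = 1)%N.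
Proof.
move=> /andP[gt lt]; apply: (@epsilon_shift _ _ 0); rewrite /above /= inordK; lia.
Qed.

End Parity.

Section Assembly.
Variables (m n : nat) (c : bool) (T : vertex m n -> int -> ratfun m n).
Hypotheses (m_gt0 : (0 < m)%N) (n_gt0 : (0 < n)%N) (hT : T_system c T).

Local Notation column := (column n_gt0).
Local Notation pos := (@positive #|{: vertex m n}|).
Local Notation bT := (boundary_ext T).

Lemma positive_boundary (u : node m n) t :
  (forall v : vertex m n, u = val v -> pos (T v t)) -> pos (bT u t).
Proof.
move=> H; rewrite /boundary_ext; case: insubP => [v _ ev|_]; last exact: positive1.
exact: H.
Qed.

Lemma epsilon_node (i : nat) (z : int) : (i <= m.+1)%N -> exists2 k : int,
  (@epsilon m n c (inord i, column z))%:Z = i%:Z + z + c%:Z + 2 * k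
  & (@epsilon m n c (inord i, column z) < 2)%N.
Proof.
move=> le_im; have [k ek lt] := @epsilon_split m n c (inord i, column z).
have [l el] := column_parity n_gt0 z; move: (column z) ek lt el => w.
by rewrite /= inordK // => ek lt el; exists (l - k%:Z) => //; lia.
Qed.

Lemma epsilon_right (u : node m n) : (epsilon c (right_of u) + epsilon c u = 1)%N.
Proof.
have [k ek] := column_parity n_gt0 ((u.2 : nat)%:Z + 1).
apply: (@epsilon_shift _ _ _ _ _ k); rewrite /right_of /=.
by move: ek; rewrite columnD (column_val n_gt0) /= => ->; lia.
Qed.

Lemma epsilon_left (u : node m n) : (epsilon c (left_of u) + epsilon c u = 1)%N.
Proof.
have := epsilon_right (left_of u).
by rewrite /right_of /left_of /= ord_predK -surjective_pairing addnC.
Qed.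

Let pos_at (t : int) := forall v : vertex m n, (2 %| t + (epsilon c (val v))%:Z)%Z -> pos (T v t).

Lemma positive_rhs (v : vertex m n) (t : int) : (2 %| t + 1 + (epsilon c (val v))%:Z)%Z -> pos_at t ->
  pos (bT (left_of (val v)) t * bT (right_of (val v)) t
       + bT (below (val v)) t * bT (above (val v)) t).
Proof.
move=> /dvdz2P[k ek] post.
have nb u : (epsilon c u + epsilon c (val v) = 1)%N -> pos (bT u t).
  move=> eu; apply: positive_boundary => w ew; apply: post; apply/dvdz2P.
  rewrite -ew; exists (t + 1 - k); lia.
have int_v := valP v.
apply: positiveD; apply: positiveM; apply: nb.
- exact: epsilon_left.
- exact: epsilon_right.
- exact: epsilon_below.
- exact: epsilon_above.
Qed.

Lemma positive_step_up t : pos_at t -> pos_at (t + 1) -> pos_at (t + 1 + 1).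
Proof.
move=> pt pt1 v /[dup] h2 /dvdz2P[k ek].
have h : (2 %| t + (epsilon c (val v))%:Z)%Z by apply/dvdz2P; exists (k - 1); lia.
apply: (positive_div (pt v h) (positive_rhs h2 pt1)).
by have := hT.2 v (t + 1) h2; rewrite addrK.
Qed.

Lemma positive_step_down t : pos_at (t + 1) -> pos_at t -> pos_at (t - 1).
Proof.
move=> pt1 pt v /dvdz2P[k ek].
have h : (2 %| t + 1 + (epsilon c (val v))%:Z)%Z by apply/dvdz2P; exists (k + 1); lia.
have h1 : (2 %| (t + 1) + (epsilon c (val v))%:Z)%Z by [].
apply: (positive_div (pt1 v h1) (positive_rhs h pt)).
by rewrite mulrC; exact: hT.2 v t h.
Qed.

(** The values at times 0 and 1 are indeterminates or unconstrained, according to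
    parity; the relation propagates positivity both forwards and backwards in time. *)
Lemma T_positive t : pos_at t.
Proof.
have base0 : pos_at 0.
  move=> v /dvdz2P[k ek]; have [l _ lt] := epsilon_split c (val v).
  have -> : 0 = (epsilon c (val v))%:Z by lia.
  by rewrite hT.1; apply: positiveX.
have base1 : pos_at 1.
  move=> v /dvdz2P[k ek]; have [l _ lt] := epsilon_split c (val v).
  have -> : 1 = (epsilon c (val v))%:Z by lia.
  by rewrite hT.1; apply: positiveX.
have up (k : nat) : pos_at k%:Z /\ pos_at (k%:Z + 1).
  elim: k => [|k [IH1 IH2]]; first by rewrite add0r.
  have -> : k.+1%:Z = k%:Z + 1 by lia.
  by split=> //; apply: positive_step_up.
have down (k : nat) : pos_at (- k%:Z) /\ pos_at (- k%:Z + 1).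
  elim: k => [|k [IH1 IH2]]; first by rewrite oppr0 add0r.
  have -> : - k.+1%:Z = - k%:Z - 1 by lia.
  by split; [apply: positive_step_down | rewrite subrK].
case: t => k; first by case: (up k).
by rewrite NegzE; case: (down k.+1).
Qed.

(** The T-system in light-cone coordinates. *)
Definition grid (i : nat) (P Q : int) : ratfun m n :=
  bT (inord i, column (P - Q)) (P + Q + i%:Z + c%:Z).

Lemma grid_parity i (P Q : int) : (i <= m.+1)%N ->
  (2 %| P + Q + i%:Z + c%:Z + (@epsilon m n c (inord i, column (P - Q)))%:Z)%Z.
Proof.
move=> le_im; have [k -> _] := epsilon_node (P - Q) le_im.
by apply/dvdz2P; exists (P + i%:Z + c%:Z + k); lia.
Qed.

Lemma grid0 P Q : grid 0 P Q = 1.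
Proof. by rewrite /grid /boundary_ext insubN // /interior /= inordK. Qed.

Lemma grid_top P Q : grid m.+1 P Q = 1.
Proof. by rewrite /grid /boundary_ext insubN // /interior /= inordK // ltnn andbF. Qed.

Lemma grid_neq0 i P Q : (i <= m.+1)%N -> grid i P Q != 0.
Proof.
move=> le_im; apply: positive_neq0; apply: positive_boundary => v ev.
by apply: T_positive; rewrite -ev grid_parity.
Qed.

Lemma grid_vertex i (P Q : int) (hi : (0 < i <= m)%N) : exists v : vertex m n,
  val v = (inord i, column (P - Q)).
Proof.
have int_u : interior ((inord i, column (P - Q)) : node m n).
  by case/andP: hi => gt le; rewrite /interior /= inordK; lia.
by exists (Sub _ int_u); rewrite SubK.
Qed.

Lemma boundary_ext_val (v : vertex m n) t : bT (val v) t = T v t.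
Proof. by rewrite /boundary_ext valK. Qed.

Lemma grid_octahedron i (P Q : int) : (0 < i <= m)%N ->
  grid i P Q * grid i (P + 1) (Q + 1)
    = grid i (P + 1) Q * grid i P (Q + 1) + grid i.+1 P Q * grid i.-1 (P + 1) (Q + 1).
Proof.
move=> hi; have [v ev] := grid_vertex P Q hi.
pose t := P + Q + i%:Z + c%:Z + 1.
have le_im : (i <= m.+1)%N by lia.
have h : (2 %| t + 1 + (epsilon c (val v))%:Z)%Z.
  have /dvdz2P[k ek] := grid_parity P Q le_im.
  by apply/dvdz2P; exists (k + 1); rewrite ev /t; lia.
have := hT.2 v t h; rewrite -!boundary_ext_val !ev /left_of /right_of /below /above /=.
have -> : t - 1 = P + Q + i%:Z + c%:Z by rewrite /t; lia.
rewrite -/(grid i P Q) -columnB -columnD inordK //.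
have e1 : grid i (P + 1) (Q + 1) = bT (inord i, column (P - Q)) (t + 1).
  by congr (bT (_, column _) _); rewrite /t; lia.
have e2 : grid i P (Q + 1) = bT (inord i, column (P - Q - 1)) t.
  by congr (bT (_, column _) _); rewrite /t; lia.
have e3 : grid i (P + 1) Q = bT (inord i, column (P - Q + 1)) t.
  by congr (bT (_, column _) _); rewrite /t; lia.
have e4 : grid i.-1 (P + 1) (Q + 1) = bT (inord i.-1, column (P - Q)) t.
  by congr (bT (_, column _) _); rewrite /t; lia.
have e5 : grid i.+1 P Q = bT (inord i.+1, column (P - Q)) t.
  by congr (bT (_, column _) _); rewrite /t; lia.
by rewrite e1 e2 e3 e4 e5 mulrC => ->; rewrite [X in X + _]mulrC [X in _ + X]mulrC.
Qed.

Lemma grid_period i (P Q : int) : grid i (P + n%:Z) (Q - n%:Z) = grid i P Q.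
Proof.
rewrite /grid; have -> : P + n%:Z - (Q - n%:Z) = P - Q + (2 * n)%N%:Z by lia.
by rewrite column_period; congr (bT _ _); lia.
Qed.

Lemma initial_value_node i (j : nat) : (i <= m.+1)%N ->
  initial_value grid c i j = node_value (@xvar m n) (inord i, column j%:Z).
Proof.
move=> le_im; rewrite /initial_value /grid.
set l := (level c i j)%:Z.
have -> : l - i%:Z - c%:Z - (l - i%:Z - c%:Z - j%:Z) = j%:Z by lia.
have -> : l - i%:Z - c%:Z + (l - i%:Z - c%:Z - j%:Z) + i%:Z + c%:Z
    = (@epsilon m n c (inord i, column j%:Z))%:Z.
  by have [k ek lt] := epsilon_node j%:Z le_im; rewrite /l /level; lia.
rewrite /boundary_ext /node_value; case: insubP => // v _ <-.
exact: hT.1.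
Qed.

Lemma xvar_neq0 (v : vertex m n) : xvar v != 0.
Proof. by apply: positive_neq0; apply: positiveX. Qed.

End Assembly.

Theorem corollary3p4p2 (m n : nat) (c : bool) (r : nat)
    (hm : (0 < m)%N) (hn : (0 < n)%N) (hr : (1 <= r <= m)%N)
    (T : vertex m n -> int -> ratfun m n) (hT : T_system c T)
    (v : vertex m n) (hv : (val v).1 = r :> nat)
    (t : int) (ht : (2 %| t + (epsilon c (val v))%:Z)%Z) :
  let N := 'C(m.+1, r) in
  \sum_(j < N.+1)
    (-1) ^+ j * slice_coef m n c r j * T v (t + (2 * n * (N - j))%N%:Z) = 0.
Proof.
move=> N; set j0 := ((val v).2 : nat).
have [P [Q [ePQ et]]] : exists P Q : int, P - Q = j0%:Z /\ P + Q + r%:Z + c%:Z = t.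
  have /dvdz2P[k ek] := ht; have [l el lt] := epsilon_split c (val v).
  rewrite hv -/j0 in el.
  by exists (k + l%:Z - r%:Z - c%:Z), (k + l%:Z - r%:Z - c%:Z - j0%:Z); lia.
have le_rm : (r <= m.+1)%N by lia.
have vE : val v = (inord r, column hn (P - Q)) :> node m n.
  rewrite ePQ column_val [LHS]surjective_pairing; congr (_, _).
  by apply: val_inj; rewrite /= inordK // hv.
have rec := grid_recurrence hm (grid0 c T hn) (grid_top c T hn) (grid_neq0 hm hn hT)
  (grid_octahedron hm hn hT) (grid_period hm hn hT) (@xvar_neq0 m n)
  (initial_value_node hm hn hT) P Q le_rm.
rewrite -[RHS]rec; apply: eq_bigr => j _; congr (_ * _).
rewrite -[LHS]boundary_ext_val vE /grid; congr (boundary_ext T (_, column hn _) _).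
  by lia.
by rewrite -mulnA mul2n -addnn -et; move: (n * (N - j))%N => q; lia.
Qed.
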